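(* Let $(R,\mathfrak{m})$ be a commutative noetherian local ring with $\mathfrak m$-adic completion $\widehat R$, $I$ a principal ideal of $R$ and $M$ an artinian $R$-module. Then $\mathfrak{F}^I_i(M)/I\mathfrak{F}^I_i(M)$ is a noetherian $\widehat R$-module for all $i$.
   Context: For an $R$-module $N$, $H^{\mathfrak m}_i(N)=\varprojlim_s\operatorname{Tor}^R_i(R/\mathfrak m^s,N)$, and the $i$-th $I$-formal local homology module is $\mathfrak{F}^I_i(M)=\varinjlim_t H^{\mathfrak m}_i(0:_M I^t)$, where $0:_M I^t=\{x\in M:I^tx=0\}$ and the transition maps are induced by inclusions. It has a natural structure of $\widehat R$-module, since each $H^{\mathfrak m}_i(0:_MI^t)$ is an inverse limit of modules annihilated by powers of $\mathfrak m$. *)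

(* Defs.v *)
From HB Require Import structures.
From mathcomp Require Import all_boot all_algebra.
From mathcomp Require Import boolp.
From mathcomp Require Import freeg.

Set Implicit Arguments.
Unset Strict Implicit.
Unset Printing Implicit Defensive.

Import GRing.Theory.
Local Open Scope ring_scope.
Local Open Scope quotient_scope.

Section Submodules.
Variable R : pzRingType.
Implicit Types U V W : lmodType R.

(* Submodules are the library's `submodClosed V`; `mksub` turns a Prop-valued
   predicate into one, the Boolean being obtained classically. *)
Section Mk.
Variables (V : lmodType R) (P : V -> Prop).
Hypotheses (P0 : P 0) (PZD : forall a u v, P u -> P v -> P (a *: u + v)).

Lemma mksub_subproof : subsemimod_closed (fun x : V => `[< P x >]).
Proof.
have PD u v : P u -> P v -> P (u + v).
  by move=> Pu Pv; rewrite -[u]scale1r; apply: PZD.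
have PZ a u : P u -> P (a *: u) by move=> Pu; rewrite -[_ *: _]addr0; apply: PZD.
split; first split; rewrite ?unfold_in; first exact/asboolP.
  by move=> u v /asboolP Pu /asboolP Pv; apply/asboolP/PD.
by move=> a u /asboolP Pu; apply/asboolP/PZ.
Qed.

Definition mksub : submodClosed V :=
  HB.pack (fun x : V => `[< P x >])
    (GRing.isSubmodClosed.Build R V (fun x : V => `[< P x >]) mksub_subproof).

Lemma mksubP x : reflect (P x) (x \in mksub).
Proof. exact: asboolP. Qed.
End Mk.

Section MkLin.
Variables (U V : lmodType R) (f : U -> V) (lin : linear f).
Definition mklin : {linear U -> V} :=
  HB.pack f (GRing.isLinear.Build R U V *:%R f lin).
End MkLin.

Lemma span_subproof V (P : V -> Prop) :
  (fun x => forall S : submodClosed V, (forall y, P y -> y \in S) -> x \in S) 0 /\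
  forall a u v,
  (forall S : submodClosed V, (forall y, P y -> y \in S) -> u \in S) ->
  (forall S : submodClosed V, (forall y, P y -> y \in S) -> v \in S) ->
  (forall S : submodClosed V, (forall y, P y -> y \in S) -> a *: u + v \in S).
Proof.
split=> [S _|a u v Hu Hv S HS]; first exact: rpred0.
by apply: rpredD; [apply: rpredZ; apply: Hu | apply: Hv].
Qed.

(* The intersection of the submodules containing P, hence the set of finite
   linear combinations of elements of P. *)
Definition span V (P : V -> Prop) : submodClosed V :=
  mksub (span_subproof P).1 (span_subproof P).2.

Definition zmod_of V (S : submodClosed V) : zmodClosed V :=
  HB.pack (S : {pred V})
    (GRing.isZmodClosed.Build V (S : {pred V})
      (GRing.submod_closedB (submodClosedP S))).

(* A submodule and a quotient V/S, as modules in their own right. *)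
Definition submod_of V (S : submodClosed V) := {x : V | x \in S}.
HB.instance Definition _ V (S : submodClosed V) := SubChoice.on (submod_of S).
HB.instance Definition _ V (S : submodClosed V) :=
  [SubChoice_isSubLmodule of submod_of S by <:].

Definition quomod V (S : submodClosed V) := Quotient.quot (zmod_of S).
HB.instance Definition _ V (S : submodClosed V) := GRing.Zmodule.on (quomod S).

Section Quotient.
Variables (V : lmodType R) (S : submodClosed V).
Implicit Types x y : quomod S.

Definition qpi (x : V) : quomod S := \pi_(Quotient.quot (zmod_of S)) x.

Lemma qpi_zmod : zmod_morphism qpi.
Proof. exact: (@raddfB _ _ (\pi_(Quotient.quot (zmod_of S)))). Qed.

Lemma qpi_repr x : qpi (repr x) = x.
Proof. exact: reprK. Qed.

Lemma qpi_eq (x y : V) : (qpi x == qpi y) = (x - y \in S).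
Proof. by rewrite [LHS](esym (Quotient.idealrBE (zmod_of S) x y)). Qed.

Definition qscale (a : R) x : quomod S := qpi (a *: repr x).

Lemma qscale_pi a (v : V) : qscale a (qpi v) = qpi (a *: v).
Proof.
apply/eqP; rewrite qpi_eq -scalerBr; apply: rpredZ.
by rewrite -qpi_eq qpi_repr.
Qed.

Lemma qpiD u v : qpi (u + v) = qpi u + qpi v.
Proof. exact: (@raddfD _ _ (\pi_(Quotient.quot (zmod_of S)))). Qed.

Lemma qscaleA a b x : qscale a (qscale b x) = qscale (a * b) x.
Proof. by rewrite -(qpi_repr x) !qscale_pi scalerA. Qed.
Lemma qscale1 : left_id 1 qscale.
Proof. by move=> x; rewrite -(qpi_repr x) !qscale_pi scale1r. Qed.
Lemma qscaleDr : right_distributive qscale +%R.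
Proof.
move=> a x y; rewrite -(qpi_repr x) -(qpi_repr y) -qpiD !qscale_pi.
by rewrite scalerDr qpiD.
Qed.
Lemma qscaleDl x : {morph qscale^~ x : a b / a + b}.
Proof. by move=> a b; rewrite -(qpi_repr x) !qscale_pi scalerDl qpiD. Qed.

HB.instance Definition _ := GRing.Zmodule_isLmodule.Build R (quomod S)
  qscaleA qscale1 qscaleDr qscaleDl.

Lemma qpi_linear : linear qpi.
Proof. by move=> a u v; rewrite qpiD -qscale_pi. Qed.
HB.instance Definition _ := GRing.isLinear.Build R V (quomod S) *:%R qpi qpi_linear.

Lemma qpi_eq0 (x : V) : (qpi x == 0) = (x \in S).
Proof. by rewrite -(raddf0 qpi) qpi_eq subr0. Qed.
End Quotient.
End Submodules.

Section Maps.
Variable R : pzRingType.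

Section KerIm.
Variables (U V : lmodType R) (f : {linear U -> V}).

Fact lker_subproof : f 0 = 0 /\
  forall a u v, f u = 0 -> f v = 0 -> f (a *: u + v) = 0.
Proof.
by split=> [|a u v fu fv]; rewrite ?linear0 // linearP fu fv scaler0 addr0.
Qed.
Definition lker : submodClosed U := mksub lker_subproof.1 lker_subproof.2.

Fact limg_subproof : (exists x, f x = 0) /\
  forall a u v, (exists x, f x = u) -> (exists x, f x = v) ->
  exists x, f x = a *: u + v.
Proof.
split=> [|a _ _ [x <-] [y <-]]; first by exists 0; rewrite linear0.
by exists (a *: x + y); rewrite linearP.
Qed.
Definition limg : submodClosed V :=
  mksub (P := fun y => exists x, f x = y) limg_subproof.1 limg_subproof.2.
End KerIm.

Section Induced.
Variables (U V : lmodType R) (f : {linear U -> V}).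
Variables (A : submodClosed U) (B : submodClosed V).
Hypothesis fAB : forall x, x \in A -> f x \in B.

Definition sub_fun (x : submod_of A) : submod_of B :=
  Sub (f (val x)) (fAB (valP x)).
Fact sub_fun_linear : linear sub_fun.
Proof. by move=> a x y; apply: val_inj; rewrite /= linearP. Qed.
Definition sub_map : {linear submod_of A -> submod_of B} :=
  mklin sub_fun_linear.

Definition quo_fun (x : quomod A) : quomod B := qpi B (f (repr x)).
Lemma quo_fun_pi u : quo_fun (qpi A u) = qpi B (f u).
Proof.
apply/eqP; rewrite qpi_eq -linearB; apply: fAB.
by rewrite -qpi_eq qpi_repr.
Qed.
Fact quo_fun_linear : linear quo_fun.
Proof.
move=> a x y; rewrite -(qpi_repr x) -(qpi_repr y) -linearP !quo_fun_pi.
by rewrite -linearP -linearP.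
Qed.
Definition quo_map : {linear quomod A -> quomod B} := mklin quo_fun_linear.
Lemma quo_mapE u : quo_map (qpi A u) = qpi B (f u).
Proof. exact: quo_fun_pi. Qed.
End Induced.

Section SubIn.
Variables (V : lmodType R) (A B : submodClosed V).
Fact sub_in_subproof : val (0 : submod_of A) \in B /\
  forall a (u v : submod_of A), val u \in B -> val v \in B ->
  val (a *: u + v) \in B.
Proof.
split=> [|a u v uB vB]; first by rewrite linear0 rpred0.
by rewrite linearP; apply: rpredD => //; apply: rpredZ.
Qed.
(* A :&: B, as a submodule of A. *)
Definition sub_in : submodClosed (submod_of A) :=
  mksub (P := fun x : submod_of A => val x \in B)
    sub_in_subproof.1 sub_in_subproof.2.
End SubIn.

(* Middle homology of U -f-> V -g-> W. *)
Definition homology (U V W : lmodType R)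
    (f : {linear U -> V}) (g : {linear V -> W}) : lmodType R :=
  quomod (sub_in (lker g) (limg f)).

Section HomologyMap.
Variables (U V W U' V' W' : lmodType R).
Variables (f : {linear U -> V}) (g : {linear V -> W}).
Variables (f' : {linear U' -> V'}) (g' : {linear V' -> W'}).
Variables (a : {linear U -> U'}) (b : {linear V -> V'}) (c : {linear W -> W'}).
Hypotheses (abf : forall x, b (f x) = f' (a x)).
Hypotheses (bcg : forall x, c (g x) = g' (b x)).

Fact homology_map_ker x : x \in lker g -> b x \in lker g'.
Proof. by move/mksubP => gx; apply/mksubP; rewrite -bcg gx linear0. Qed.

Fact homology_map_img (x : submod_of (lker g)) :
  x \in sub_in (lker g) (limg f) ->
  sub_map homology_map_ker x \in sub_in (lker g') (limg f').
Proof.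
move/mksubP/mksubP => [u fu]; apply/mksubP/mksubP.
by exists (a u); rewrite /= -fu abf.
Qed.

Definition homology_map : {linear homology f g -> homology f' g'} :=
  quo_map homology_map_img.
End HomologyMap.

(* The product of the X s; a named copy of the dependent function type, so
   that the instances below cannot clash with other ones on functions. *)
Definition dprod (X : nat -> lmodType R) := forall s, X s.

Section Product.
Variable X : nat -> lmodType R.
Implicit Types x y z : dprod X.

HB.instance Definition _ := gen_eqMixin (dprod X).
HB.instance Definition _ := gen_choiceMixin (dprod X).

Definition dprod_zero : dprod X := fun=> 0.
Definition dprod_opp x : dprod X := fun s => - x s.
Definition dprod_add x y : dprod X := fun s => x s + y s.
Definition dprod_scale a x : dprod X := fun s => a *: x s.

Fact dprod_addA : associative dprod_add.
Proof. by move=> x y z; apply: functional_extensionality_dep => s; apply: addrA. Qed.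
Fact dprod_addC : commutative dprod_add.
Proof. by move=> x y; apply: functional_extensionality_dep => s; apply: addrC. Qed.
Fact dprod_add0 : left_id dprod_zero dprod_add.
Proof. by move=> x; apply: functional_extensionality_dep => s; apply: add0r. Qed.
Fact dprod_addN : left_inverse dprod_zero dprod_opp dprod_add.
Proof. by move=> x; apply: functional_extensionality_dep => s; apply: addNr. Qed.
HB.instance Definition _ := GRing.isZmodule.Build (dprod X)
  dprod_addA dprod_addC dprod_add0 dprod_addN.

Fact dprod_scaleA a b x :
  dprod_scale a (dprod_scale b x) = dprod_scale (a * b) x.
Proof. by apply: functional_extensionality_dep => s; apply: scalerA. Qed.
Fact dprod_scale1 : left_id 1 dprod_scale.
Proof. by move=> x; apply: functional_extensionality_dep => s; apply: scale1r. Qed.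
Fact dprod_scaleDr : right_distributive dprod_scale +%R.
Proof. by move=> a x y; apply: functional_extensionality_dep => s; apply: scalerDr. Qed.
Fact dprod_scaleDl x : {morph dprod_scale^~ x : a b / a + b}.
Proof. by move=> a b; apply: functional_extensionality_dep => s; apply: scalerDl. Qed.
HB.instance Definition _ := GRing.Zmodule_isLmodule.Build R (dprod X)
  dprod_scaleA dprod_scale1 dprod_scaleDr dprod_scaleDl.
End Product.

Section InverseLimit.
Variables (X : nat -> lmodType R) (p : forall s, {linear X s.+1 -> X s}).

Fact coherent_subproof : (forall s, p s ((0 : dprod X) s.+1) = (0 : dprod X) s) /\
  forall a (x y : dprod X), (forall s, p s (x s.+1) = x s) ->
  (forall s, p s (y s.+1) = y s) ->
  (forall s, p s ((a *: x + y) s.+1) = (a *: x + y) s).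
Proof.
split=> [s|a x y px py s]; first exact: linear0.
by rewrite [LHS]linearP px py.
Qed.
Definition coherent : submodClosed (dprod X) :=
  mksub (P := fun x : dprod X => forall s, p s (x s.+1) = x s)
    coherent_subproof.1 coherent_subproof.2.

Definition invlim := submod_of coherent.

Lemma invlimP (x : invlim) s : p s (val x s.+1) = val x s.
Proof. by have /mksubP := valP x; apply. Qed.
End InverseLimit.

Section DirectLimit.
Variables (X : nat -> lmodType R) (q : forall t, {linear X t -> X t.+1}).

Fact finsupp_subproof :
  (exists n, forall t, (n <= t)%N -> (0 : dprod X) t = 0) /\
  forall a (x y : dprod X), (exists n, forall t, (n <= t)%N -> x t = 0) ->
  (exists n, forall t, (n <= t)%N -> y t = 0) ->
  (exists n, forall t, (n <= t)%N -> (a *: x + y) t = 0).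
Proof.
split=> [|a x y [n x0] [k y0]]; first by exists 0%N.
exists (maxn n k) => t; rewrite geq_max => /andP[nt kt].
by rewrite [LHS](_ : _ = a *: x t + y t) // x0 // y0 // scaler0 addr0.
Qed.
Definition finsupp : submodClosed (dprod X) :=
  mksub (P := fun x : dprod X => exists n, forall t, (n <= t)%N -> x t = 0)
    finsupp_subproof.1 finsupp_subproof.2.
Definition dsum := submod_of finsupp.

Fact dsum_inj_subproof t (x : X t) :
  (dfwith (fun s => 0 : X s) x : dprod X) \in finsupp.
Proof.
apply/mksubP; exists t.+1 => s ts; rewrite dfwith_out //.
by rewrite neq_ltn ts.
Qed.
Definition dsum_inj t (x : X t) : dsum :=
  Sub (dfwith (fun s => 0 : X s) x : dprod X) (dsum_inj_subproof x).

(* The direct limit: the direct sum of the X t modulo the x - q x, x in X t. *)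
Definition dirlim : lmodType R :=
  quomod (span (fun z : dsum =>
    exists t (x : X t), z = dsum_inj x - dsum_inj (q t x))).
End DirectLimit.
End Maps.

Section Ideals.
Variable R : comPzRingType.

(* The submodule generated by the a *: x with a in A and x in S. *)
Definition ideal_smul (A : R -> Prop) (V : lmodType R) (S : submodClosed V) :
    submodClosed V :=
  span (fun z => exists a x, [/\ A a, x \in S & z = a *: x]).

Fact fullmod_subproof (V : lmodType R) : True /\
  forall (a : R) (u v : V), True -> True -> True.
Proof. by []. Qed.
Definition fullmod (V : lmodType R) : submodClosed V :=
  mksub (P := fun=> True) (fullmod_subproof V).1 (fullmod_subproof V).2.

Fixpoint ideal_pow (J : submodClosed R^o) (n : nat) : submodClosed R^o :=
  if n is k.+1 then ideal_smul (fun a => a \in J) (ideal_pow J k)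
  else fullmod R^o.

Lemma ideal_powS J n a : a \in ideal_pow J n.+1 -> a \in ideal_pow J n.
Proof.
move/mksubP => /(_ (ideal_pow J n)); apply=> _ [b [c [_ cJ ->]]].
exact: rpredZ.
Qed.

Section Annihilated.
Variables (M : lmodType R) (J : submodClosed R^o).
Fact ann_subproof : (forall a, a \in J -> a *: (0 : M) = 0) /\
  forall b (u v : M), (forall a, a \in J -> a *: u = 0) ->
  (forall a, a \in J -> a *: v = 0) ->
  forall a, a \in J -> a *: (b *: u + v) = 0.
Proof.
split=> [a _|b u v Hu Hv a aJ]; first exact: scaler0.
by rewrite scalerDr scalerA mulrC -scalerA Hu // Hv // scaler0 addr0.
Qed.
(* 0 :_M J *)
Definition annihilated : submodClosed M :=
  mksub (P := fun x : M => forall a, a \in J -> a *: x = 0)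
    ann_subproof.1 ann_subproof.2.
End Annihilated.

(* The ring R/J for an arbitrary ideal J, possibly J = R: hence a pzRing and
   not the library's quotient by a proper ideal. *)
Section QuotientRing.
Variable J : submodClosed R^o.

Definition quoring := quomod J.
HB.instance Definition _ := GRing.Lmodule.on quoring.
Implicit Types x y z : quoring.

Definition qrpi (a : R) : quoring := qpi J a.
Definition qone : quoring := qrpi 1.
Definition qmul x y : quoring := qrpi (repr x * repr y).

Lemma qmul_pi a b : qmul (qrpi a) (qrpi b) = qrpi (a * b).
Proof.
have mulJ (c d : R) : d \in J -> (c * d : R^o) \in J by move=> ?; apply: rpredZ.
apply/eqP; rewrite qpi_eq; set a' := repr _; set b' := repr _.
have Ha : a' - a \in J by rewrite -qpi_eq qpi_repr.
have Hb : b' - b \in J by rewrite -qpi_eq qpi_repr.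
rewrite (_ : a' * b' - a * b = a' * (b' - b) + b * (a' - a)).
  by apply: rpredD; apply: mulJ.
by rewrite !mulrBr addrA (mulrC b a') subrK (mulrC b a).
Qed.

Lemma qrpi_repr x : qrpi (repr x) = x. Proof. exact: qpi_repr. Qed.

Fact qmulA : associative qmul.
Proof.
move=> x y z; rewrite -(qrpi_repr x) -(qrpi_repr y) -(qrpi_repr z).
by rewrite !qmul_pi mulrA.
Qed.
Fact qmulC : commutative qmul.
Proof.
by move=> x y; rewrite -(qrpi_repr x) -(qrpi_repr y) !qmul_pi mulrC.
Qed.
Fact qmul1 : left_id qone qmul.
Proof. by move=> x; rewrite -(qrpi_repr x) qmul_pi mul1r. Qed.
Fact qmulDl : left_distributive qmul +%R.
Proof.
move=> x y z; rewrite -(qrpi_repr x) -(qrpi_repr y) -(qrpi_repr z).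
by rewrite /qrpi -linearD !qmul_pi -linearD -mulrDl.
Qed.
HB.instance Definition _ := GRing.Zmodule_isComPzRing.Build quoring
  qmulA qmulC qmul1 qmulDl.
End QuotientRing.
End Ideals.

Section Completion.
Variables (R : comPzRingType) (m : submodClosed R^o).

Fact idfun_pow s a : a \in ideal_pow m s.+1 -> idfun a \in ideal_pow m s.
Proof. exact: ideal_powS. Qed.

Definition quopow (s : nat) : lmodType R := quoring (ideal_pow m s).
Definition quopow_map s : {linear quopow s.+1 -> quopow s} :=
  quo_map (f := idfun) (@idfun_pow s).

(* The m-adic completion, lim_s R/m^s; here R/m^0 is the zero ring. *)
Definition completion := invlim quopow_map.
HB.instance Definition _ := GRing.Lmodule.on completion.
Implicit Types x y z : completion.

Definition completion_coord x s : quoring (ideal_pow m s) := val x s.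
Local Notation "x `_[ s ]" := (completion_coord x s) (at level 3).

Lemma completion_ext x y : (forall s, x `_[s] = y `_[s]) -> x = y.
Proof. by move=> xy; apply/val_inj/functional_extensionality_dep. Qed.

Lemma quopow_mapM s (a b : quoring (ideal_pow m s.+1)) :
  quopow_map s (a * b) = (quopow_map s a : quoring _) * quopow_map s b.
Proof.
rewrite -(qrpi_repr a) -(qrpi_repr b) [_ * _]qmul_pi.
rewrite /quopow_map !quo_mapE; exact: esym (qmul_pi _ _ _).
Qed.

Fact completion_mul_subproof x y :
  ((fun s => x `_[s] * y `_[s]) : dprod quopow) \in coherent quopow_map.
Proof. by apply/mksubP => s; rewrite quopow_mapM !invlimP. Qed.
Definition completion_mul x y : completion :=
  Sub ((fun s => x `_[s] * y `_[s]) : dprod quopow)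
    (completion_mul_subproof x y).

Fact completion_in_subproof (a : R) :
  ((fun s => qrpi (ideal_pow m s) a) : dprod quopow) \in coherent quopow_map.
Proof. by apply/mksubP => s; rewrite quo_mapE. Qed.
(* The canonical map from R to its completion. *)
Definition completion_in (a : R) : completion :=
  Sub ((fun s => qrpi (ideal_pow m s) a) : dprod quopow)
    (completion_in_subproof a).

Fact completion_mulA : associative completion_mul.
Proof. by move=> x y z; apply: completion_ext => s; apply: mulrA. Qed.
Fact completion_mulC : commutative completion_mul.
Proof. by move=> x y; apply: completion_ext => s; apply: mulrC. Qed.
Fact completion_mul1 : left_id (completion_in 1) completion_mul.
Proof. by move=> x; apply: completion_ext => s; apply: mul1r. Qed.
Fact completion_mulDl : left_distributive completion_mul +%R.
Proof. by move=> x y z; apply: completion_ext => s; apply: mulrDl. Qed.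
HB.instance Definition _ := GRing.Zmodule_isComPzRing.Build completion
  completion_mulA completion_mulC completion_mul1 completion_mulDl.
End Completion.

Section AdicLimit.
Variables (R : comPzRingType) (m : submodClosed R^o).
Variables (X : nat -> lmodType R) (p : forall s, {linear X s.+1 -> X s}).
Definition killed := forall s a (x : X s), a \in ideal_pow m s -> a *: x = 0.
Hypothesis kX : killed.

(* The inverse limit of modules X s killed by m^s is a module over the
   completion: the class of a in R/m^s acts on X s as a. *)
Definition adic_lim of killed := invlim p.
Local Notation L := (adic_lim kX).
HB.instance Definition _ := GRing.Zmodule.on L.
Implicit Types (r : completion m) (x y : L).

Definition qact s (r : quoring (ideal_pow m s)) (x : X s) : X s := repr r *: x.

Lemma qact_pi s (a : R) (x : X s) : qact (qrpi (ideal_pow m s) a) x = a *: x.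
Proof.
apply/eqP; rewrite -subr_eq0 -scalerBl; apply/eqP/kX.
by rewrite -qpi_eq qpi_repr.
Qed.

Fact adic_scale_subproof r x :
  ((fun s => qact (completion_coord r s) (val x s)) : dprod X) \in coherent p.
Proof.
apply/mksubP => s; set c := completion_coord r s.+1.
have cE : completion_coord r s = qrpi _ (repr c).
  have <- : quopow_map m s c = completion_coord r s := invlimP r s.
  by rewrite -{1}(qrpi_repr c) /quopow_map quo_mapE.
by rewrite cE qact_pi -/c -{1}(qrpi_repr c) qact_pi linearZ invlimP.
Qed.
Definition adic_scale r x : L :=
  Sub ((fun s => qact (completion_coord r s) (val x s)) : dprod X)
    (adic_scale_subproof r x).

Lemma adic_ext x y : (forall s, val x s = val y s) -> x = y.
Proof. by move=> xy; apply/val_inj/functional_extensionality_dep. Qed.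

Fact adic_scaleA r r' x : adic_scale r (adic_scale r' x) = adic_scale (r * r') x.
Proof.
apply: adic_ext => s /=.
rewrite -[completion_coord (r * r') s]/(completion_coord r s * completion_coord r' s).
rewrite -(qrpi_repr (completion_coord r s)) -(qrpi_repr (completion_coord r' s)).
by rewrite [_ * _]qmul_pi !qact_pi scalerA.
Qed.
Fact adic_scale1 : left_id 1 adic_scale.
Proof. by move=> x; apply: adic_ext => s; rewrite /= [LHS]qact_pi scale1r. Qed.
Fact adic_scaleDr : right_distributive adic_scale +%R.
Proof. by move=> r x y; apply: adic_ext => s; apply: scalerDr. Qed.
Fact adic_scaleDl x : {morph adic_scale^~ x : r r' / r + r'}.
Proof.
move=> r r'; apply: adic_ext => s.
rewrite -[RHS]/(qact (completion_coord r s) (val x s) +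
                qact (completion_coord r' s) (val x s)).
have E : completion_coord (r + r') s =
    qrpi _ (repr (completion_coord r s) + repr (completion_coord r' s)).
  by rewrite [RHS]qpiD !qpi_repr.
by rewrite -[LHS]/(qact (completion_coord (r + r') s) _) E qact_pi scalerDl.
Qed.
HB.instance Definition _ := GRing.Zmodule_isLmodule.Build (completion m) L
  adic_scaleA adic_scale1 adic_scaleDr adic_scaleDl.
End AdicLimit.

Section AdicLimitMap.
Variables (R : comPzRingType) (m : submodClosed R^o).
Variables (X Y : nat -> lmodType R).
Variables (p : forall s, {linear X s.+1 -> X s}).
Variables (q : forall s, {linear Y s.+1 -> Y s}).
Hypotheses (kX : killed m X) (kY : killed m Y).
Variable f : forall s, {linear X s -> Y s}.
Hypothesis fpq : forall s x, q s (f s.+1 x) = f s (p s x).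

Fact adic_map_subproof (x : adic_lim p kX) :
  ((fun s => f s (val x s)) : dprod Y) \in coherent q.
Proof. by apply/mksubP => s; rewrite fpq invlimP. Qed.
Definition adic_map_fun (x : adic_lim p kX) : adic_lim q kY :=
  Sub ((fun s => f s (val x s)) : dprod Y) (adic_map_subproof x).
Fact adic_map_linear : linear adic_map_fun.
Proof.
move=> r x y; apply: adic_ext => s /=.
rewrite -[LHS]/(f s (repr (completion_coord r s) *: val x s + val y s)).
by rewrite linearP.
Qed.
Definition adic_map : {linear adic_lim p kX -> adic_lim q kY} :=
  mklin adic_map_linear.
End AdicLimitMap.

Section Free.
Variables (R : comNzRingType) (K : choiceType) (V : lmodType R) (f : K -> V).

Fact fglift_linear : linear (fglift f : {freeg K / R} -> V).
Proof.
have add : zmod_morphism (fglift f : {freeg K / R} -> V).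
  exact: lift_is_additive.
pose g : {additive {freeg K / R} -> V} :=
  HB.pack (fglift f : {freeg K / R} -> V)
    (GRing.isZmodMorphism.Build _ _ (fglift f : {freeg K / R} -> V) add).
have gE x : fglift f x = g x by [].
move=> a x y; rewrite !gE raddfD; congr (_ + _).
have {1}-> : a *: x = fgscale a x by [].
rewrite -[X in a *: g X]freeg_sumE /fgscale !raddf_sum.
by apply: eq_bigr => k _; rewrite -!gE !liftU /= scalerA.
Qed.
Definition lift_free : {linear {freeg K / R} -> V} := mklin fglift_linear.
Lemma lift_freeE k : lift_free << k >> = f k.
Proof. by rewrite [LHS]liftU scale1r. Qed.
End Free.

Lemma free_ext (R : comNzRingType) (K : choiceType) (V : lmodType R)
    (f g : {linear {freeg K / R} -> V}) :
  (forall k, f << k >> = g << k >>) -> forall x, f x = g x.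
Proof.
move=> fg x; rewrite -[x]freeg_sumE !linear_sum; apply: eq_bigr => k _.
have -> : << coeff k x *g k >> = coeff k x *: << k >> :> {freeg K / R}.
  by apply/eqP/freeg_eqP => j; rewrite coeffZ !coeffU mul1r.
by rewrite !linearZ fg.
Qed.

Section Tensor.
Variables (R : comNzRingType).

(* The tensor product: the free module on A * N modulo bilinearity. *)
Definition tensor_rel (A N : lmodType R) (z : {freeg (A * N)%type / R}) : Prop :=
  [\/ exists a a' n, z = << (a + a', n) >> - << (a, n) >> - << (a', n) >>,
      exists a n n', z = << (a, n + n') >> - << (a, n) >> - << (a, n') >>,
      exists r a n, z = << (r *: a, n) >> - r *: << (a, n) >> |
      exists r a n, z = << (a, r *: n) >> - r *: << (a, n) >> ].

Definition tensor (A N : lmodType R) : lmodType R :=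
  quomod (span (@tensor_rel A N)).

Definition tens (A N : lmodType R) (a : A) (n : N) : tensor A N :=
  qpi _ << (a, n) >>.

Section Map.
Variables (A B N P : lmodType R) (f : {linear A -> B}) (g : {linear N -> P}).
Let F : {linear {freeg (A * N)%type / R} -> {freeg (B * P)%type / R}} :=
  lift_free (fun x => << (f x.1, g x.2) >>).

Fact tensor_map_subproof x :
  x \in span (@tensor_rel A N) -> F x \in span (@tensor_rel B P).
Proof.
move/mksubP => Hx.
pose S := mksub (P := fun x => F x \in span (@tensor_rel B P)).
have S0 : F 0 \in span (@tensor_rel B P) by rewrite linear0 rpred0.
have SD a u v : F u \in span (@tensor_rel B P) ->
    F v \in span (@tensor_rel B P) -> F (a *: u + v) \in span (@tensor_rel B P).
  by move=> Fu Fv; rewrite linearP; apply: rpredD => //; apply: rpredZ.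
apply/(mksubP S0 SD)/Hx => y Hy; apply/(mksubP S0 SD)/mksubP => T; apply.
case: Hy => [] [a [b [c ->]]].
- by constructor 1; exists (f a), (f b), (g c); rewrite !linearB !lift_freeE /= linearD.
- by constructor 2; exists (f a), (g b), (g c); rewrite !linearB !lift_freeE /= linearD.
- by constructor 3; exists a, (f b), (g c); rewrite linearB linearZ !lift_freeE /= linearZ.
- by constructor 4; exists a, (f b), (g c); rewrite linearB linearZ !lift_freeE /= linearZ.
Qed.
Definition tensor_map : {linear tensor A N -> tensor B P} :=
  quo_map tensor_map_subproof.
Lemma tensor_mapE a n : tensor_map (tens a n) = tens (f a) (g n).
Proof. by rewrite [LHS]quo_mapE [X in qpi _ X]lift_freeE. Qed.
End Map.

Lemma tensor_ext (A N W : lmodType R) (f g : {linear tensor A N -> W}) :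
  (forall a n, f (tens a n) = g (tens a n)) -> forall x, f x = g x.
Proof.
move=> fg x; rewrite -(qpi_repr x); set y := repr x.
have lf : linear (fun z => f (qpi (span (@tensor_rel A N)) z)).
  by move=> a u v; rewrite !linearP.
have lg : linear (fun z => g (qpi (span (@tensor_rel A N)) z)).
  by move=> a u v; rewrite !linearP.
by apply: (@free_ext _ _ _ (mklin lf) (mklin lg)) => -[a n]; apply: fg.
Qed.

Lemma tens_addl (A N : lmodType R) (a b : A) (n : N) :
  tens (a + b) n = tens a n + tens b n.
Proof.
apply/eqP; rewrite -linearD qpi_eq; apply/mksubP => S; apply.
by constructor 1; exists a, b, n; rewrite opprD addrA.
Qed.

Lemma tens_scalel (A N : lmodType R) r (a : A) (n : N) :
  tens (r *: a) n = r *: tens a n.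
Proof.
apply/eqP; rewrite -linearZ qpi_eq; apply/mksubP => S; apply.
by constructor 3; exists r, a, n.
Qed.
End Tensor.

Section Resolution.
Variable R : comNzRingType.
Implicit Types A B : lmodType R.

Definition aug A : {linear {freeg A / R} -> A} := lift_free id.
Definition kermod A : lmodType R := submod_of (lker (aug A)).

(* The canonical free resolution of A: res n A is free on the underlying set
   of the n-th syzygy syz n A, and syz n.+1 A is the kernel of the evaluation
   res n A -> syz n A. It is functorial in A. *)
Fixpoint syz (n : nat) A : lmodType R :=
  if n is k.+1 then kermod (syz k A) else A.
Definition res n A : lmodType R := {freeg (syz n A) / R}.

Lemma augE A a : aug A << a >> = a.
Proof. exact: lift_freeE. Qed.

Fact res_d_linear n A : linear (fun x : res n.+1 A =>
  val (aug (syz n.+1 A) x : kermod (syz n A)) : res n A).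
Proof. by move=> a x y; rewrite !linearP. Qed.
Definition res_d n A : {linear res n.+1 A -> res n A} := mklin (@res_d_linear n A).

Definition free_map A B (f : {linear A -> B}) :
    {linear {freeg A / R} -> {freeg B / R}} :=
  lift_free (fun a => << f a >>).

Lemma free_mapE A B (f : {linear A -> B}) a : free_map f << a >> = << f a >>.
Proof. exact: lift_freeE. Qed.

Lemma aug_map A B (f : {linear A -> B}) x : aug B (free_map f x) = f (aug A x).
Proof.
have lin : linear (fun x => aug B (free_map f x)) by move=> a u v; rewrite !linearP.
have lin' : linear (fun x => f (aug A x)) by move=> a u v; rewrite !linearP.
apply: (@free_ext _ _ _ (mklin lin) (mklin lin')) => k.
rewrite -[LHS]/(aug B (free_map f << k >>)) -[RHS]/(f (aug A << k >>)).
by rewrite free_mapE !augE.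
Qed.

Fact kermod_map_subproof A B (f : {linear A -> B}) x :
  x \in lker (aug A) -> free_map f x \in lker (aug B).
Proof. by move/mksubP => x0; apply/mksubP; rewrite aug_map x0 linear0. Qed.

Definition kermod_map A B (f : {linear A -> B}) : {linear kermod A -> kermod B} :=
  sub_map (@kermod_map_subproof A B f).

Fixpoint syz_map n A B (f : {linear A -> B}) : {linear syz n A -> syz n B} :=
  if n is k.+1 then kermod_map (syz_map k f) else f.
Definition res_map n A B (f : {linear A -> B}) : {linear res n A -> res n B} :=
  free_map (syz_map n f).

Lemma res_map_d n A B (f : {linear A -> B}) x :
  res_map n f (res_d n A x) = res_d n B (res_map n.+1 f x).
Proof. exact: esym (congr1 val (aug_map (syz_map n.+1 f) x)). Qed.

(* Multiplication by an element killing A is null-homotopic on res A; this is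
   what makes Tor_i(A, N) killed by it, see tor_kill. *)
Lemma res_homotopy_step n A (a : R) (h : res n A -> res n.+1 A) :
  linear h -> (forall z, aug (syz n A) z = 0 -> res_d n A (h z) = a *: z) ->
  exists2 k : res n.+1 A -> res n.+2 A, linear k &
    forall x, a *: x = res_d n.+1 A (k x) + h (res_d n A x).
Proof.
move=> lh Hh.
pose w (u : syz n.+1 A) : res n.+1 A := a *: << u >> - mklin lh (val u).
have w0 u : w u \in lker (aug (syz n.+1 A)).
  apply/mksubP; apply: val_inj; rewrite linearB linearZ augE.
  have /mksubP zu := valP u.
  rewrite linearB linearZ; apply/eqP; rewrite subr_eq add0r eq_sym; apply/eqP.
  exact: Hh.
pose k : {linear res n.+1 A -> res n.+2 A} :=
  lift_free (fun u : syz n.+1 A => << (Sub (w u) (w0 u) : syz n.+2 A) >>).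
exists k => [|x]; first exact: linearP.
have l1 : linear (fun x : res n.+1 A => a *: x).
  by move=> b u v; rewrite scalerDr !scalerA mulrC.
have l2 : linear (fun x => res_d n.+1 A (k x) + mklin lh (res_d n A x)).
  by move=> b u v; rewrite !linearP /= scalerDr addrACA.
apply: (@free_ext _ _ _ (mklin l1) (mklin l2)) => u.
rewrite -[LHS]/(a *: << u >>) -[RHS]/(val (aug _ (k << u >>)) + h (val (aug _ << u >>))).
by rewrite [k _]lift_freeE !augE SubK subrK.
Qed.

Lemma res_homotopy0 A (a : R) : (forall u : A, a *: u = 0) ->
  exists2 k : res 0 A -> res 1 A, linear k & forall x, a *: x = res_d 0 A (k x).
Proof.
move=> aA.
have w0 (u : A) : (a *: << u >> : {freeg A / R}) \in lker (aug A).
  by apply/mksubP; rewrite linearZ augE; exact: aA.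
pose k : {linear res 0 A -> res 1 A} :=
  lift_free (fun u : A => << (Sub (a *: << u >> : {freeg A / R}) (w0 u) : syz 1 A) >>).
exists k => [|x]; first exact: linearP.
have l1 : linear (fun x : res 0 A => a *: x).
  by move=> b u v; rewrite scalerDr !scalerA mulrC.
have l2 : linear (fun x => res_d 0 A (k x)) by move=> b u v; rewrite !linearP.
apply: (@free_ext _ _ _ (mklin l1) (mklin l2)) => u.
rewrite -[LHS]/(a *: << u >>) -[RHS]/(val (aug _ (k << u >>))).
by rewrite [k _]lift_freeE augE SubK.
Qed.

Lemma res_d_ker n A x : aug (syz n A) (res_d n A x) = 0.
Proof. by have /mksubP := valP (aug (syz n.+1 A) x : kermod (syz n A)). Qed.

Lemma res_homotopy n A (a : R) : (forall u : A, a *: u = 0) ->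
  exists2 h : res n A -> res n.+1 A, linear h &
    forall z, aug (syz n A) z = 0 -> res_d n A (h z) = a *: z.
Proof.
move=> aA; elim: n => [|n [h lh Hh]].
  by have [k lk Hk] := res_homotopy0 aA; exists k => // z _; rewrite Hk.
have [k lk Hk] := res_homotopy_step lh Hh; exists k => // z z0.
rewrite Hk [res_d n A z](_ : _ = 0); last first.
  transitivity (val (0 : kermod (syz n A))); last exact: linear0.
  exact: (congr1 (val : kermod (syz n A) -> res n A) z0).
by rewrite -[h 0]/(mklin lh 0) linear0 addr0.
Qed.
End Resolution.

Section Tor.
Variable R : comNzRingType.
Implicit Types A B N P : lmodType R.

Definition tor_chain i A N : lmodType R := tensor (res i A) N.
Definition tor_d i A N : {linear tor_chain i.+1 A N -> tor_chain i A N} :=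
  tensor_map (res_d i A) idfun.
Definition tor_out i A N : {linear tor_chain i A N -> tor_chain i.-1 A N} :=
  match i return {linear tor_chain i A N -> tor_chain i.-1 A N} with
  | 0 => \0
  | k.+1 => tor_d k A N
  end.

(* Tor_i(A, N) = H_i(res A (x) N), with the zero map out of degree 0. *)
Definition tor i A N : lmodType R := homology (tor_d i A N) (tor_out i A N).

Section Map.
Variables (A B N P : lmodType R) (f : {linear A -> B}) (g : {linear N -> P}).

Definition tor_chain_map i : {linear tor_chain i A N -> tor_chain i B P} :=
  tensor_map (res_map i f) g.

Lemma tor_chain_map_d i x :
  tor_chain_map i (tor_d i A N x) = tor_d i B P (tor_chain_map i.+1 x).
Proof.
have l1 : linear (fun x => tor_chain_map i (tor_d i A N x)).
  by move=> b u v; rewrite !linearP.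
have l2 : linear (fun x => tor_d i B P (tor_chain_map i.+1 x)).
  by move=> b u v; rewrite !linearP.
apply: (@tensor_ext _ _ _ _ (mklin l1) (mklin l2)) => a n.
rewrite [LHS](_ : _ = tor_chain_map i (tor_d i A N (tens a n))) //.
rewrite [RHS](_ : _ = tor_d i B P (tor_chain_map i.+1 (tens a n))) //.
by rewrite !tensor_mapE res_map_d.
Qed.

Lemma tor_chain_map_out i x :
  tor_chain_map i.-1 (tor_out i A N x) = tor_out i B P (tor_chain_map i x).
Proof.
by case: i x => [|i] x; [exact: linear0 | apply: tor_chain_map_d].
Qed.

Definition tor_map i : {linear tor i A N -> tor i B P} :=
  homology_map (@tor_chain_map_d i) (@tor_chain_map_out i).
End Map.

Lemma tor_kill i A N (a : R) :
  (forall u : A, a *: u = 0) -> forall x : tor i A N, a *: x = 0.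
Proof.
move=> aA x; rewrite -(qpi_repr x) -linearZ; apply/eqP; rewrite qpi_eq0.
suff H v : tor_out i A N v = 0 -> exists u, tor_d i A N u = a *: v.
  apply/mksubP/mksubP; rewrite linearZ.
  by have /mksubP := valP (repr x : submod_of _); apply: H.
case: i v {x} => [|i] y y0.
  have [k lk Hk] := res_homotopy0 aA.
  exists (tensor_map (mklin lk) idfun y).
  have l1 : linear (fun x : tor_chain 0 A N =>
      tor_d 0 A N (tensor_map (mklin lk) idfun x)).
    by move=> b u v; rewrite !linearP.
  have l2 : linear (fun x : tor_chain 0 A N => a *: x).
    by move=> b u v; rewrite scalerDr !scalerA mulrC.
  apply: (@tensor_ext _ _ _ _ (mklin l1) (mklin l2)) => u n.
  rewrite -[LHS]/(tor_d 0 A N (tensor_map (mklin lk) idfun (tens u n))).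
  rewrite -[RHS]/(a *: tens u n) !tensor_mapE -tens_scalel.
  by congr (tens _ _); rewrite Hk.
have [h lh Hh] := res_homotopy i aA.
have [k lk Hk] := res_homotopy_step lh Hh.
exists (tensor_map (mklin lk) idfun y).
have l1 : linear (fun x : tor_chain i.+1 A N =>
    tor_d i.+1 A N (tensor_map (mklin lk) idfun x) +
    tensor_map (mklin lh) idfun (tor_d i A N x)).
  by move=> b u v; rewrite !linearP /= scalerDr addrACA.
have l2 : linear (fun x : tor_chain i.+1 A N => a *: x).
  by move=> b u v; rewrite scalerDr !scalerA mulrC.
have E : mklin l1 y = mklin l2 y.
  apply: tensor_ext => u n.
  rewrite -[LHS]/(tor_d i.+1 A N (tensor_map (mklin lk) idfun (tens u n)) +
    tensor_map (mklin lh) idfun (tor_d i A N (tens u n))).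
  rewrite -[RHS]/(a *: tens u n) !tensor_mapE -tens_scalel -tens_addl.
  by congr (tens _ _); rewrite Hk.
rewrite -[RHS]/(mklin l2 y) -E -[LHS]addr0; congr (_ + _).
by rewrite [X in tensor_map _ _ X]y0 linear0.
Qed.
End Tor.

Section Functoriality.
Variable R : comNzRingType.

Lemma free_map_comm (A B C D : lmodType R) (f : {linear A -> B})
    (g : {linear B -> D}) (h : {linear A -> C}) (k : {linear C -> D}) :
  (forall x, g (f x) = k (h x)) ->
  forall x, free_map g (free_map f x) = free_map k (free_map h x).
Proof.
move=> gf.
have l1 : linear (fun x => free_map g (free_map f x)).
  by move=> b u v; rewrite !linearP.
have l2 : linear (fun x => free_map k (free_map h x)).
  by move=> b u v; rewrite !linearP.
apply: (@free_ext _ _ _ (mklin l1) (mklin l2)) => u.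
rewrite -[LHS]/(free_map g (free_map f << u >>)).
rewrite -[RHS]/(free_map k (free_map h << u >>)).
by rewrite !free_mapE gf.
Qed.

Lemma syz_map_comm n (A B C D : lmodType R) (f : {linear A -> B})
    (g : {linear B -> D}) (h : {linear A -> C}) (k : {linear C -> D}) :
  (forall x, g (f x) = k (h x)) ->
  forall x, syz_map n g (syz_map n f x) = syz_map n k (syz_map n h x).
Proof.
move=> gf; elim: n => [|n IHn] //= x; apply: val_inj => /=.
exact: free_map_comm.
Qed.

Lemma tor_map_comm i (A B C D N P Q S : lmodType R)
    (f : {linear A -> B}) (g : {linear B -> D})
    (h : {linear A -> C}) (k : {linear C -> D})
    (f' : {linear N -> P}) (g' : {linear P -> S})
    (h' : {linear N -> Q}) (k' : {linear Q -> S}) :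
  (forall x, g (f x) = k (h x)) -> (forall x, g' (f' x) = k' (h' x)) ->
  forall x, tor_map g g' i (tor_map f f' i x) = tor_map k k' i (tor_map h h' i x).
Proof.
move=> gf gf' x; rewrite -(qpi_repr x); move: (repr x) => y {x}.
rewrite [tor_map f f' i _]quo_mapE [tor_map h h' i _]quo_mapE.
rewrite [LHS]quo_mapE [RHS]quo_mapE; congr (qpi _ _); apply: val_inj.
rewrite -[LHS]/(tor_chain_map g g' i (tor_chain_map f f' i (val y))).
rewrite -[RHS]/(tor_chain_map k k' i (tor_chain_map h h' i (val y))).
move: (val y) => {}y.
have l1 : linear (fun x => tor_chain_map g g' i (tor_chain_map f f' i x)).
  by move=> b u v; rewrite !linearP.
have l2 : linear (fun x => tor_chain_map k k' i (tor_chain_map h h' i x)).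
  by move=> b u v; rewrite !linearP.
apply: (@tensor_ext _ _ _ _ (mklin l1) (mklin l2)) => u n.
rewrite -[LHS]/(tor_chain_map g g' i (tor_chain_map f f' i (tens u n))).
rewrite -[RHS]/(tor_chain_map k k' i (tor_chain_map h h' i (tens u n))).
rewrite !tensor_mapE gf'; congr (tens _ _).
exact/free_map_comm/syz_map_comm.
Qed.
End Functoriality.

Section FormalLocalHomology.
Variables (R : comNzRingType) (m : submodClosed R^o).

Lemma quopow_kill s (a : R) (u : quopow m s) :
  a \in ideal_pow m s -> a *: u = 0.
Proof.
move=> am; rewrite -[u](qpi_repr (u : quomod _)); move: (repr _) => v.
rewrite -[LHS]/(qscale a (qpi (ideal_pow m s) v)) qscale_pi.
have -> : a *: v = (v : R) *: (a : R^o) by rewrite [LHS]mulrC.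
by apply/eqP; rewrite qpi_eq0; apply: rpredZ.
Qed.

Fact tor_killed i (N : lmodType R) :
  killed m (fun s => tor i (quopow m s) N).
Proof.
move=> s a x am.
exact: (@tor_kill R i (quopow m s) N a (fun u => quopow_kill u am) x).
Qed.

(* lim_s Tor_i(R/m^s, N), as a module over the completion. *)
Definition local_homology i (N : lmodType R) : lmodType (completion m) :=
  adic_lim (fun s => tor_map (quopow_map m s) (idfun : {linear N -> N}) i)
    (@tor_killed i N).

Lemma local_homology_scaleE i (N : lmodType R) (a : R)
    (x : local_homology i N) :
  val ((completion_in m a : completion m) *: x) = a *: val x.
Proof.
by apply: functional_extensionality_dep => s; apply: qact_pi; apply: tor_killed.
Qed.

Section Map.
Variables (i : nat) (N P : lmodType R) (f : {linear N -> P}).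
Fact local_homology_map_subproof s (x : tor i (quopow m s.+1) N) :
  tor_map (quopow_map m s) idfun i (tor_map idfun f i x) =
  tor_map idfun f i (tor_map (quopow_map m s) idfun i x).
Proof. exact: tor_map_comm. Qed.
Definition local_homology_map :
    {linear local_homology i N -> local_homology i P} :=
  adic_map _ _ local_homology_map_subproof.
End Map.

Variables (I : submodClosed R^o) (M : lmodType R).

(* 0 :_M I^t, with I^0 = R. *)
Definition annpow (t : nat) : lmodType R :=
  submod_of (annihilated M (ideal_pow I t)).

Fact annpow_incl_subproof t x :
  x \in annihilated M (ideal_pow I t) ->
  idfun x \in annihilated M (ideal_pow I t.+1).
Proof. by move/mksubP => Hx; apply/mksubP => a /ideal_powS; apply: Hx. Qed.
Definition annpow_incl t : {linear annpow t -> annpow t.+1} :=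
  sub_map (f := idfun) (@annpow_incl_subproof t).

(* The direct limit of the H_i(0 :_M I^t) along the maps induced by the inclusions. *)
Definition formal_local_homology i : lmodType (completion m) :=
  dirlim (fun t => local_homology_map i (annpow_incl t)).
End FormalLocalHomology.

Definition noetherian_mod (R : pzRingType) (V : lmodType R) : Prop :=
  forall S : nat -> submodClosed V,
    (forall n, {subset S n <= S n.+1}) ->
    exists n, forall k, (n <= k)%N -> S k =i S n.

Definition artinian_mod (R : pzRingType) (V : lmodType R) : Prop :=
  forall S : nat -> submodClosed V,
    (forall n, {subset S n.+1 <= S n}) ->
    exists n, forall k, (n <= k)%N -> S k =i S n.

Definition maximal_ideal (R : comPzRingType) (m : submodClosed R^o) : Prop :=
  (1 : R) \notin m /\
  forall J : submodClosed R^o, {subset m <= J} -> (1 : R) \notin J -> J =i m.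

Definition is_local_ring (R : comPzRingType) (m : submodClosed R^o) : Prop :=
  maximal_ideal m /\ forall n : submodClosed R^o, maximal_ideal n -> n =i m.

Definition principal_ideal (R : comPzRingType) (I : submodClosed R^o) : Prop :=
  exists a : R, forall x, (x \in I) <-> exists r, x = r * a.

(* The image of I in the completion; with F a module over the completion,
   IF is ideal_smul (ideal_image m I) (fullmod F). *)
Definition ideal_image (R : comPzRingType) (m I : submodClosed R^o) :
    completion m -> Prop :=
  fun r => exists2 a : R, a \in I & r = completion_in m a.
Arguments ideal_image {R} m I _.

(* Main.v *)
(* Write I = (a), A_t = 0 :_M a^t, B_t = a A_(t+1), and F for the direct limit
   of the H_i(A_t).  As the chain a^t M is stationary, A_t maps onto M / aM for
   large t, with kernel B_t; and multiplication by a maps A_(t+1) onto B_t with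
   kernel A_1.  The long exact sequences of local homology then filter F / aF by
   a submodule of H_i(M / aM) and one of H_(i-1)(A_1): a class in the image of
   H_i(B_t) whose connecting image in H_(i-1)(A_1) vanishes comes from
   H_i(A_(t+1)), hence is a multiple of a.

   So it is enough that H_i(N) is noetherian for every artinian N.  The same
   argument, for x in m acting on N, bounds H_i(N) / x H_i(N) by H_i(N / xN) and
   H_(i-1)(0 :_N x), and H_i(N) is x-adically separated over an x-adically
   complete ring; by induction on i and on generators of m, N may be assumed to
   be killed by m.  Then N is noetherian and maps onto H_0(N), while H_i(N) = 0
   for i > 0, since by an Artin-Rees argument the transition maps
   Tor_i(R/m^k, N) -> Tor_i(R/m^s, N) vanish for large k.

   Exactness of the inverse limits holds because all the Tor_i(R/m^s, N) are
   artinian. *)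
From HB Require Import structures.
From mathcomp Require Import all_boot all_algebra.
From mathcomp Require Import boolp.
From mathcomp Require Import freeg.
Require Import Defs.

Set Implicit Arguments.
Unset Strict Implicit.
Unset Printing Implicit Defensive.

Import GRing.Theory.
Local Open Scope ring_scope.

(** * Chain conditions *)

(** The resolution [res] consists of free modules on underlying sets, in general infinitely
    generated, so that it shows no finiteness of Tor. Finiteness is recovered without changing the
    resolution: the map of resolutions over R/m^(k+s) -> R/m^s is replaced, up to homotopy, by a map
    with values in a finitely generated submodule. The case k = 0 bounds Tor by finitely many copies
    of N; for large k the values can be pushed into m^l times the same submodule, at the cost of one
    use of Artin-Rees in each degree, and l = 1 is what annihilates coefficients killed by m.

    The second piece of each filtration is reached by a connecting homomorphism preceded by the
    inverse of a map such as H_i(B_t) -> H_i(A_t), which may fail to be injective. It is therefore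
    only a linear relation, and chain conditions are carried along relations throughout.

    The passage from X/xX to X imitates Hilbert's basis theorem, with convergent power series in x
    in place of polynomials. *)

Section Span.
Variables (R : pzRingType) (V : lmodType R).

Lemma submodN (S : submodClosed V) x : x \in S -> - x \in S.
Proof. by move=> xS; rewrite -scaleN1r; apply: rpredZ. Qed.

Lemma submodB (S : submodClosed V) x y : x \in S -> y \in S -> x - y \in S.
Proof. by move=> xS /submodN yS; apply: rpredD. Qed.

Lemma mem_span (P : V -> Prop) x : P x -> x \in span P.
Proof. by move=> Px; apply/mksubP => S; apply. Qed.

Lemma span_sub (P : V -> Prop) (S : submodClosed V) :
  (forall x, P x -> x \in S) -> {subset span P <= S}.
Proof. by move=> PS x /mksubP; apply. Qed.

Lemma span_mono (P Q : V -> Prop) : (forall x, P x -> Q x) ->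
  {subset span P <= span Q}.
Proof. by move=> PQ; apply: span_sub => x /PQ; apply: mem_span. Qed.

Lemma span_add1 b (P : V -> Prop) x : x \in span (fun y => y = b \/ P y) ->
  exists r, x - r *: b \in span P.
Proof.
have P0 : exists r, (0 : V) - r *: b \in span P.
  by exists 0; rewrite scale0r subrr rpred0.
have PD a u v : (exists r, u - r *: b \in span P) ->
    (exists r, v - r *: b \in span P) ->
    exists r, (a *: u + v) - r *: b \in span P.
  move=> [r ru] [q qv]; exists (a * r + q).
  rewrite scalerDl opprD addrACA -scalerA -scalerBr.
  by apply: rpredD => //; apply: rpredZ.
move/(@span_sub _ (mksub P0 PD)) => H; apply/(mksubP P0 PD)/H => y [->|Py].
  by apply/mksubP; exists 1; rewrite scale1r subrr rpred0.
by apply/mksubP; exists 0; rewrite scale0r subr0; apply: mem_span.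
Qed.

Lemma span_cons b (s : seq V) x : x \in span (fun y => y \in b :: s) ->
  exists r, x - r *: b \in span (fun y => y \in s).
Proof.
move=> xs; apply: span_add1; move: x xs; apply: span_mono => y.
by rewrite inE => /orP[/eqP->|ys]; [left | right].
Qed.

Lemma span_nil x : x \in span (fun y : V => y \in [::]) -> x = 0.
Proof.
have P0 : (0 : V) = 0 by [].
have PD (a : R) (u v : V) : u = 0 -> v = 0 -> a *: u + v = 0.
  by move=> -> ->; rewrite scaler0 addr0.
by move/(@span_sub _ (mksub (P := fun x => x = 0) P0 PD)) => H;
   apply/(mksubP P0 PD)/H.
Qed.

End Span.

Section Chains.
Variables (R : pzRingType) (V : lmodType R).
Implicit Types S T : submodClosed V.

(** For submodules [D] of [E] this is noetherianity of E/D, without building the subquotient. As [D]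
    and [E] are mere predicates, [fun=> False] can serve as the lower bound 0. *)
Definition noeth_between (D E : V -> Prop) := forall S : nat -> submodClosed V,
  (forall n, {subset S n <= S n.+1}) ->
  (forall n x, D x -> x \in S n) -> (forall n x, x \in S n -> E x) ->
  exists n, forall k, (n <= k)%N -> {subset S k <= S n}.

Definition artin_in (E : V -> Prop) := forall S : nat -> submodClosed V,
  (forall n, {subset S n.+1 <= S n}) -> (forall n x, x \in S n -> E x) ->
  exists n, forall k, (n <= k)%N -> {subset S n <= S k}.

Lemma incr_chain (S : nat -> submodClosed V) n k :
  (forall n, {subset S n <= S n.+1}) -> (n <= k)%N -> {subset S n <= S k}.
Proof.
move=> inc; elim: k => [|k IH]; first by rewrite leqn0 => /eqP->.
rewrite leq_eqVlt => /orP[/eqP->//|]; rewrite ltnS => /IH nk x /nk.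
exact: inc.
Qed.

Lemma decr_chain (S : nat -> submodClosed V) n k :
  (forall n, {subset S n.+1 <= S n}) -> (n <= k)%N -> {subset S k <= S n}.
Proof.
move=> dec; elim: k => [|k IH]; first by rewrite leqn0 => /eqP->.
rewrite leq_eqVlt => /orP[/eqP->//|]; rewrite ltnS => /IH nk x /dec.
exact: nk.
Qed.

Lemma noetherian_modE :
  noetherian_mod V <-> noeth_between (fun=> False) (fun=> True).
Proof.
split=> [H S inc _ _|H S inc].
  by have [n Hn] := H S inc; exists n => k /Hn E x; rewrite E.
have [|//|n Hn] := H S inc _ _; first by [].
exists n => k nk x; apply/idP/idP; first exact: Hn.
exact: incr_chain.
Qed.

Lemma artinian_modE : artinian_mod V <-> artin_in (fun=> True).
Proof.
split=> [H S dec _|H S dec].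
  by have [n Hn] := H S dec; exists n => k /Hn E x; rewrite E.
have [//|n Hn] := H S dec _; exists n => k nk x.
by apply/idP/idP; [apply: decr_chain | apply: Hn].
Qed.

(** Otherwise elements of [L] can be chosen one after the other, each outside the span of [D] and
    its predecessors, and these spans increase strictly. *)
Lemma noeth_fg (D E : V -> Prop) : noeth_between D E ->
  forall L : submodClosed V, (forall x, D x -> x \in L) ->
  (forall x, x \in L -> E x) ->
  exists s : seq V, {subset s <= L} /\
    {subset L <= span (fun y => D y \/ y \in s)}.
Proof.
move=> noe L DL LE; apply: contrapT => nfg.
have /choice[next Hn] (s : seq V) : exists y, {subset s <= L} ->
    y \in L /\ y \notin span (fun y => D y \/ y \in s).
  case: (pselect ({subset s <= L})) => [sL|]; last by exists 0.
  apply: contrapT => H; apply: nfg; exists s; split=> // y yL.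
  by apply/negPn/negP => yn; apply: H; exists y.
pose c n := iter n (fun s => next s :: s) [::].
have cL n : {subset c n <= L}.
  elim: n => [|n IH] y //=; rewrite inE => /orP[/eqP->|/IH//].
  by have [] := Hn _ IH.
have [|n x Dx|n x|n Hst] := noe (fun n => span (fun y => D y \/ y \in c n)).
- move=> n; apply: span_sub => y [Dy|ys]; apply: mem_span; first by left.
  by right; rewrite /= inE ys orbT.
- by apply: mem_span; left.
- by move=> /span_sub H; apply/LE/H => y [/DL//|/cL].
have [_ /negP] := Hn _ (cL n); apply; apply: (Hst n.+1 (leqnSn n)).
by apply: mem_span; right; rewrite /= mem_head.
Qed.

Lemma noeth_max (D E : V -> Prop) : noeth_between D E ->
  forall P : submodClosed V -> Prop,
  (forall S x, P S -> D x -> x \in S) -> (forall S x, P S -> x \in S -> E x) ->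
  forall S0, P S0 ->
  exists2 S, P S & forall T, P T -> {subset S <= T} -> {subset T <= S}.
Proof.
move=> noe P PD PE S0 P0; apply: contrapT => nmax.
have /choice[next Hn] (S : submodClosed V) : exists T, P S ->
    [/\ P T, {subset S <= T} & ~ {subset T <= S}].
  case: (pselect (P S)) => [PS|]; last by exists S.
  apply: contrapT => H; apply: nmax; exists S => // T PT ST.
  by apply: contrapT => nTS; apply: H; exists T.
pose c n := iter n next S0.
have cP n : P (c n) by elim: n => //= n /Hn[].
have [|n x|n x|n Hst] := noe c.
- by move=> n; have [_ + _] := Hn _ (cP n).
- exact: PD.
- exact: PE.
have [_ _] := Hn _ (cP n); apply.
exact: (Hst n.+1).
Qed.

End Chains.

Section Relations.
Variables (R : pzRingType) (V : lmodType R).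

(* Relations spare us maps out of a direct limit and connecting homomorphisms. *)
Definition linrel (W : lmodType R) (r : V -> W -> Prop) :=
  r 0 0 /\ forall a v v' w w', r v w -> r v' w' -> r (a *: v + v') (a *: w + w').

Section Image.
Variables (W : lmodType R) (r : V -> W -> Prop) (lin : linrel r).
Variable S : submodClosed V.

Fact relimg_subproof : (exists2 v, v \in S & r v 0) /\
  forall a w w', (exists2 v, v \in S & r v w) -> (exists2 v, v \in S & r v w') ->
  exists2 v, v \in S & r v (a *: w + w').
Proof.
split=> [|a w w' [v vS rv] [v' vS' rv']]; first by exists 0; [exact: rpred0 | apply: lin.1].
exists (a *: v + v'); first by apply: rpredD => //; apply: rpredZ.
exact: lin.2.
Qed.
Definition relimg : submodClosed W :=
  mksub (P := fun w => exists2 v, v \in S & r v w)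
    relimg_subproof.1 relimg_subproof.2.
Lemma relimgP w : reflect (exists2 v, v \in S & r v w) (w \in relimg).
Proof. exact: mksubP. Qed.
End Image.

Lemma linrelB (W : lmodType R) (r : V -> W -> Prop) v v' w w' : linrel r ->
  r v w -> r v' w' -> r (v - v') (w - w').
Proof.
move=> lin rv rv'; rewrite -[v - v']addrC -[w - w']addrC -(scaleN1r v') -(scaleN1r w').
exact: lin.2.
Qed.

Variables (D E : V -> Prop) (W1 W2 : lmodType R).
Variables (r1 : V -> W1 -> Prop) (r2 : V -> W2 -> Prop).
Variables (E1 : W1 -> Prop) (E2 : W2 -> Prop).
Hypotheses (lin1 : linrel r1) (lin2 : linrel r2).
Hypotheses (r1_total : forall v, E v -> exists w, r1 v w).
Hypotheses (r1_in : forall v w, E v -> r1 v w -> E1 w).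
Hypotheses (r1_ker : forall v, E v -> r1 v 0 -> exists w, r2 v w).
Hypotheses (r2_in : forall v w, E v -> r2 v w -> E2 w).
Hypotheses (r2_ker : forall v, E v -> r2 v 0 -> D v).

(** A two-step chase: an element of [T] is corrected by one of [S] with the same [r1] value, the
    difference by one with the same [r2] value, and what is left lies in [D]. Both relations may be
    multivalued, since only differences related to 0 are used. *)
Lemma relimg_inj (S T : submodClosed V) :
  (forall x, D x -> x \in S) -> (forall x, x \in T -> E x) ->
  {subset S <= T} -> {subset relimg lin1 T <= relimg lin1 S} ->
  {subset relimg lin2 T <= relimg lin2 S} -> {subset T <= S}.
Proof.
move=> DS TE ST H1 H2 x xT; have [w xw] := r1_total (TE _ xT).
have /H1/relimgP[y yS yw] : w \in relimg lin1 T by apply/relimgP; exists x.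
have xyT : x - y \in T by apply: submodB => //; apply: ST.
have := linrelB lin1 xw yw; rewrite subrr => /(r1_ker (TE _ xyT))[u xyu].
have /H2/relimgP[z zS zu] : u \in relimg lin2 T by apply/relimgP; exists (x - y).
have xyzT : x - y - z \in T by apply: submodB => //; apply: ST.
have := linrelB lin2 xyu zu; rewrite subrr => /(r2_ker (TE _ xyzT))/DS xyzS.
by rewrite -(subrK y x) -(subrK z (x - y)); do 2![apply: rpredD => //].
Qed.

Lemma relimgS (W : lmodType R) (r : V -> W -> Prop) (lin : linrel r)
    (S T : submodClosed V) :
  {subset S <= T} -> {subset relimg lin S <= relimg lin T}.
Proof. by move=> ST w /relimgP[v /ST vT rv]; apply/relimgP; exists v. Qed.

Lemma noeth_rel : noeth_between (fun=> False) E1 -> noeth_between (fun=> False) E2 ->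
  noeth_between D E.
Proof.
move=> n1 n2 S inc DS SE.
have [n|//|n w /relimgP[v vS rv]|k1 H1] := n1 (fun n => relimg lin1 (S n)).
- exact/relimgS/inc.
- exact: r1_in (SE _ _ vS) rv.
have [n|//|n w /relimgP[v vS rv]|k2 H2] := n2 (fun n => relimg lin2 (S n)).
- exact/relimgS/inc.
- exact: r2_in (SE _ _ vS) rv.
exists (maxn k1 k2) => k; rewrite geq_max => /andP[k1k k2k].
apply: relimg_inj (DS _) (SE _) _ _ _.
- by apply: incr_chain; rewrite ?geq_max ?k1k.
- by move=> w /(H1 _ k1k); apply/relimgS/incr_chain/leq_maxl.
- by move=> w /(H2 _ k2k); apply/relimgS/incr_chain/leq_maxr.
Qed.

Lemma artin_rel : (forall x, D x -> x = 0) -> artin_in E1 -> artin_in E2 -> artin_in E.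
Proof.
move=> D0 n1 n2 S dec SE.
have [n|n w /relimgP[v vS rv]|k1 H1] := n1 (fun n => relimg lin1 (S n)).
- exact/relimgS/dec.
- exact: r1_in (SE _ _ vS) rv.
have [n|n w /relimgP[v vS rv]|k2 H2] := n2 (fun n => relimg lin2 (S n)).
- exact/relimgS/dec.
- exact: r2_in (SE _ _ vS) rv.
exists (maxn k1 k2) => k; rewrite geq_max => /andP[k1k k2k].
apply: relimg_inj (SE _) _ _ _.
- by move=> x /D0->; apply: rpred0.
- by apply: decr_chain; rewrite ?geq_max ?k1k.
- move=> w Hw; apply: (H1 _ k1k); move: w Hw.
  exact/relimgS/decr_chain/leq_maxl.
- move=> w Hw; apply: (H2 _ k2k); move: w Hw.
  exact/relimgS/decr_chain/leq_maxr.
Qed.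
End Relations.

Section Preimages.
Variables (R : pzRingType) (U V : lmodType R).

Section Preimage.
Variables (f : {linear U -> V}) (S : submodClosed V).
Fact preim_subproof : f 0 \in S /\
  forall a u v, f u \in S -> f v \in S -> f (a *: u + v) \in S.
Proof.
split=> [|a u v fu fv]; first by rewrite linear0 rpred0.
by rewrite linearP; apply: rpredD => //; apply: rpredZ.
Qed.
Definition preim_sub : submodClosed U :=
  mksub (P := fun u => f u \in S) preim_subproof.1 preim_subproof.2.
Lemma mem_preim u : (u \in preim_sub) = (f u \in S).
Proof. by apply/mksubP/idP. Qed.
End Preimage.

End Preimages.

Section Transfer.
Variable R : pzRingType.
Implicit Types U V W : lmodType R.

Lemma linrel_graph U V (f : {linear U -> V}) : linrel (fun u v => v = f u).
Proof. by split=> [|a v v' w w' -> ->]; rewrite ?linear0 ?linearP. Qed.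

Lemma artinian_inj U V (f : {linear U -> V}) : injective f ->
  artinian_mod V -> artinian_mod U.
Proof.
move=> finj /artinian_modE aV; apply/artinian_modE => S dec _.
have [n|//|n Hn] := aV (fun n => relimg (linrel_graph f) (S n)).
  exact/relimgS/dec.
exists n => k /Hn H x xS; have /H/relimgP[y yS /finj->//] : f x \in relimg (linrel_graph f) (S n).
by apply/relimgP; exists x.
Qed.

Lemma artinian_surj U V (f : {linear U -> V}) : (forall v, exists u, f u = v) ->
  artinian_mod U -> artinian_mod V.
Proof.
move=> fs /artinian_modE aU; apply/artinian_modE => S dec _.
have [n|//|n Hn] := aU (fun n => preim_sub f (S n)).
  by move=> x; rewrite !mem_preim; apply: dec.
exists n => k /Hn H x xS; have [u ux] := fs x.
by have := H u; rewrite !mem_preim ux; apply.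
Qed.

Lemma artinian_sub V (S : submodClosed V) : artinian_mod V -> artinian_mod (submod_of S).
Proof.
have lin : linear (val : submod_of S -> V) by move=> a x y; rewrite linearP.
by apply: (@artinian_inj _ _ (mklin lin)); apply: val_inj.
Qed.

Lemma artinian_quo V (S : submodClosed V) : artinian_mod V -> artinian_mod (quomod S).
Proof.
by apply: (@artinian_surj _ _ (qpi S)) => v; exists (repr v); apply: qpi_repr.
Qed.

Lemma noetherian_quo V (D : submodClosed V) :
  noeth_between (fun x => x \in D) (fun=> True) -> noetherian_mod (quomod D).
Proof.
move=> nV; apply/noetherian_modE => S inc _ _.
have [n|n x xD|//|n Hn] := nV (fun n => preim_sub (qpi D) (S n)).
- by move=> x; rewrite !mem_preim; apply: inc.
- by rewrite mem_preim [X in X \in _](_ : _ = 0) ?rpred0 //; apply/eqP; rewrite qpi_eq0.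
exists n => k /Hn H x xS.
by have := H (repr x); rewrite !mem_preim /= qpi_repr; apply.
Qed.

Lemma noeth_span V (s : seq V) : noetherian_mod R^o ->
  noeth_between (fun=> False) (fun x => x \in span (fun y => y \in s)).
Proof.
move/noetherian_modE => nR; elim: s => [|b s IHs].
  move=> S _ _ SE; exists 0%N => k _ x /SE/span_nil->; exact: rpred0.
set E := (fun x => x \in span (fun y => y \in s)).
suff: noeth_between (fun x => x = 0) (fun x => x \in span (fun y => y \in b :: s)).
  move=> H S inc _ SE; apply: H => // n x ->; exact: rpred0.
(* The coefficient of [b] is determined only up to linear dependence on [s], hence a relation to R;
   the second relation is the identity of the span of [s]. *)
apply: (@noeth_rel _ _ _ _ R^o V (fun v r => E (v - (r : R) *: b))
  (fun v w => E v /\ w = v) (fun=> True) E) => //.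
- split=> [|a v v' w w' vw vw']; first by rewrite scale0r subrr; apply: rpred0.
  rewrite scalerDl opprD addrACA -scalerA -scalerBr.
  by apply: rpredD => //; apply: rpredZ.
- split=> [|a v v' w w' [Ev ->] [Ev' ->]]; first by split=> //; apply: rpred0.
  by split=> //; apply: rpredD => //; apply: rpredZ.
- by move=> v /span_cons.
- by move=> v _; rewrite scale0r subr0; exists v.
- by move=> v w _ [Ev ->].
- by move=> v _ [_ <-].
Qed.

Lemma noetherian_zero V (S : submodClosed V) : S =i predT -> noetherian_mod (quomod S).
Proof.
move=> ST T inc; exists 0%N => k _ x.
suff -> : x = 0 by rewrite !rpred0.
by rewrite -(qpi_repr x); apply/eqP; rewrite qpi_eq0 ST.
Qed.

End Transfer.

(** * Powers of an ideal *)

Section IdealPowers.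
Variables (R : comPzRingType) (m : submodClosed R^o).
Implicit Types (V : lmodType R) (J T : submodClosed R^o).

Lemma ideal_mulr J a b : b \in J -> a * b \in J.
Proof. by move=> ?; apply: rpredZ. Qed.

Lemma smul_mem (A : R -> Prop) V (S : submodClosed V) a x :
  A a -> x \in S -> a *: x \in ideal_smul A S.
Proof. by move=> Aa xS; apply: mem_span; exists a, x. Qed.

Lemma smul_sub (A : R -> Prop) V (S T : submodClosed V) :
  (forall a x, A a -> x \in S -> a *: x \in T) -> {subset ideal_smul A S <= T}.
Proof. by move=> H; apply: span_sub => _ [a [x [Aa xS ->]]]; apply: H. Qed.

Lemma ideal_pow_mono n k : (n <= k)%N -> {subset ideal_pow m k <= ideal_pow m n}.
Proof.
elim: k => [|k IH]; first by rewrite leqn0 => /eqP->.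
rewrite leq_eqVlt => /orP[/eqP->//|]; rewrite ltnS => /IH nk x.
by move/ideal_powS; apply: nk.
Qed.

Lemma ideal_powM n a b : a \in m -> b \in ideal_pow m n -> a * b \in ideal_pow m n.+1.
Proof. by move=> am bm; apply: (@smul_mem (fun a => a \in m)). Qed.

Lemma ideal_pow_exp n a : a \in m -> a ^+ n \in ideal_pow m n.
Proof.
by move=> am; elim: n => [|n IH]; [apply/mksubP | rewrite exprS ideal_powM].
Qed.

Section Colon.
Variables (J : submodClosed R^o) (a : R).
Fact colon_subproof : a * (0 : R^o) \in J /\
  forall b (u v : R^o), a * (u : R) \in J -> a * (v : R) \in J ->
  a * ((b *: u + v) : R) \in J.
Proof.
split=> [|b u v au av]; first by rewrite mulr0; apply: rpred0.
by rewrite mulrDr mulrCA; apply: rpredD => //; apply: ideal_mulr.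
Qed.
Definition colon : submodClosed R^o :=
  mksub (P := fun b : R^o => a * (b : R) \in J) colon_subproof.1 colon_subproof.2.
Lemma colonP (u : R^o) : reflect (a * (u : R) \in J) (u \in colon).
Proof. exact: mksubP. Qed.
End Colon.

(** [ideal_pow] takes one factor at a time; the induction on [j] moves the outermost factor [c] into
    the target, which becomes the colon ideal (J : c). *)
Lemma ideal_pow_add_sub j k J :
  (forall a b, a \in ideal_pow m j -> b \in ideal_pow m k -> a * b \in J) ->
  {subset ideal_pow m (j + k) <= J}.
Proof.
elim: j J => [|j IH] J H.
  by move=> b bk; rewrite -[b]mul1r; apply: H => //; apply/mksubP.
apply: smul_sub => c y cm yjk; apply/colonP.
apply: (IH (colon J c)) => // a b aj bk; apply/colonP; rewrite mulrA.
by apply: H => //; apply: ideal_powM.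
Qed.

Section AddElt.
Variables (J : submodClosed R^o) (a : R).
Fact add_elt_subproof : (exists r, (0 : R^o) - r * a \in J) /\
  forall b (u v : R^o), (exists r, u - r * a \in J) -> (exists r, v - r * a \in J) ->
  (exists r, (b *: u + v) - r * a \in J).
Proof.
split=> [|b u v [r ru] [q qv]]; first by exists 0; rewrite mul0r subrr; apply: rpred0.
exists (b * r + q); rewrite mulrDl opprD addrACA -mulrA -mulrBr.
by apply: rpredD => //; apply: ideal_mulr.
Qed.
Definition add_elt : submodClosed R^o :=
  mksub (P := fun u : R^o => exists r, u - r * a \in J)
    add_elt_subproof.1 add_elt_subproof.2.
Lemma add_eltP (u : R^o) : reflect (exists r, u - r * a \in J) (u \in add_elt).
Proof. exact: mksubP. Qed.
End AddElt.

Lemma add_elt_mem J a : a \in add_elt J a.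
Proof. by apply/add_eltP; exists 1; rewrite mul1r subrr; apply: rpred0. Qed.

Lemma add_elt_sub J a : {subset J <= add_elt J a}.
Proof. by move=> u uJ; apply/add_eltP; exists 0; rewrite mul0r subr0. Qed.

(** Double induction, on the generators and on the exponent of the first one, [x]. Dropping [x]
    gives m^j in J + (x), lowering the exponent gives m^k in (J : x), and the product of these two
    ideals lies in J. *)
Lemma ideal_pow_sub_radical (s : seq R) J :
  (forall T, {subset J <= T} -> {subset s <= T} -> {subset m <= T}) ->
  (forall x, x \in s -> exists n, x ^+ n \in J) ->
  exists j, {subset ideal_pow m j <= J}.
Proof.
elim: s J => [|x s IHs] J mJ Js.
  exists 1%N; apply: smul_sub => a b am _; rewrite [_ *: _]mulrC.
  by apply: ideal_mulr; apply: mJ am.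
have [n xn] := Js x (mem_head _ _).
elim: n J mJ Js xn => [|n IHn] J mJ Js xn.
  exists 0%N => a _; rewrite -[a]mulr1; exact: ideal_mulr.
have [||j Hj] := IHs (add_elt J x).
- move=> T JT sT; apply: mJ => y; first by move/(@add_elt_sub _ x)/JT.
  by rewrite inE => /orP[/eqP->|/sT//]; apply/JT/add_elt_mem.
- move=> y ys; have [|p yp] := Js y; first by rewrite inE ys orbT.
  by exists p; apply: add_elt_sub.
have Jc : {subset J <= colon J x} by move=> y yJ; apply/colonP; apply: ideal_mulr.
have [|||k Hk] := IHn (colon J x).
- by move=> T cT; apply: mJ => y /Jc/cT.
- by move=> y /Js[p yp]; exists p; apply: Jc.
- by apply/colonP; rewrite -exprS.
exists (j + k)%N; apply: ideal_pow_add_sub => a b /Hj/add_eltP[r arJ] /Hk/colonP xbJ.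
rewrite -[a](subrK (r * x)) mulrDl -mulrA; apply: rpredD; last exact: ideal_mulr.
by rewrite mulrC; apply: ideal_mulr.
Qed.

(** * Artin-Rees for powers of an ideal *)

Section ArtinRees.
Variables (V : lmodType R) (E C : submodClosed V).
Hypotheses (R_noetherian : noetherian_mod R^o) (CE : {subset C <= E}).
Hypothesis E_noetherian : noeth_between (fun=> False) (fun x => x \in E).

Section AddMul.
Variables (L : submodClosed V) (a : R).
Fact add_mul_subproof : (exists2 e, e \in E & (0 : V) - a *: e \in L) /\
  forall b (u v : V), (exists2 e, e \in E & u - a *: e \in L) ->
  (exists2 e, e \in E & v - a *: e \in L) ->
  exists2 e, e \in E & (b *: u + v) - a *: e \in L.
Proof.
split=> [|b u v [e eE ue] [f fE vf]].
  by exists 0; rewrite ?scaler0 ?subrr rpred0.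
exists (b *: e + f); first by apply: rpredD => //; apply: rpredZ.
rewrite scalerDr opprD addrACA scalerA mulrC -scalerA -scalerBr.
by apply: rpredD => //; apply: rpredZ.
Qed.
Definition add_mul : submodClosed V :=
  mksub (P := fun u => exists2 e, e \in E & u - a *: e \in L)
    add_mul_subproof.1 add_mul_subproof.2.
Fact colon_in_subproof : ((0 : V) \in E /\ a *: (0 : V) \in L) /\
  forall b (u v : V), (u \in E /\ a *: u \in L) -> (v \in E /\ a *: v \in L) ->
  (b *: u + v \in E /\ a *: (b *: u + v) \in L).
Proof.
split=> [|b u v [uE uL] [vE vL]]; first by rewrite scaler0 !rpred0.
split; first by apply: rpredD => //; apply: rpredZ.
rewrite scalerDr scalerA mulrC -scalerA.
by apply: rpredD => //; apply: rpredZ.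
Qed.
Definition colon_in : submodClosed V :=
  mksub (P := fun u => u \in E /\ a *: u \in L)
    colon_in_subproof.1 colon_in_subproof.2.
End AddMul.

Section Transporter.
Variable L : submodClosed V.
Fact transporter_subproof : (forall e, e \in E -> (0 : R) *: e \in L) /\
  forall b (u v : R^o), (forall e, e \in E -> (u : R) *: e \in L) ->
  (forall e, e \in E -> (v : R) *: e \in L) ->
  forall e, e \in E -> ((b *: u + v) : R) *: e \in L.
Proof.
split=> [e _|b u v uL vL e eE]; first by rewrite scale0r rpred0.
by rewrite scalerDl -scalerA; apply: rpredD; [apply/rpredZ/uL | apply: vL].
Qed.
Definition transporter : submodClosed R^o :=
  mksub (P := fun u : R^o => forall e, e \in E -> (u : R) *: e \in L)
    transporter_subproof.1 transporter_subproof.2.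
End Transporter.

(* If L is maximal among the submodules of E that meet C in m^l C, then every
   element x of m satisfies x^n E <= L for large n. *)
Lemma artin_rees l : exists j, forall c, c \in C ->
  c \in ideal_smul (fun a => a \in ideal_pow m j) E ->
  c \in ideal_smul (fun a => a \in ideal_pow m l) C.
Proof.
pose ml := ideal_smul (fun a => a \in ideal_pow m l) C.
have mlC : {subset ml <= C} by apply: smul_sub => a x _; apply: rpredZ.
pose P (L : submodClosed V) := [/\ {subset L <= E}, {subset ml <= L} &
  forall c, c \in C -> c \in L -> c \in ml].
have [|||L [LE mlL LC] Lmax] := @noeth_max _ _ _ _ E_noetherian P _ _ ml => //.
- by move=> S x [SE _ _] /SE.
- by split=> // x /mlC/CE.
have rad x : x \in m -> exists n, x ^+ n \in transporter L.
  (* The submodules (L :_E x^n) become stationary at some [n]. For this [n], L + x^n E still meets C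
     in m^l C, so it equals L by maximality. *)
  move=> xm; have [|//|n y /mksubP[]//|n Hn] := E_noetherian (S := fun n => colon_in L (x ^+ n)).
    move=> n y /mksubP[yE yL]; apply/mksubP; split=> //.
    by rewrite exprS -scalerA; apply: rpredZ.
  exists n; apply/mksubP => e eE.
  suff H : {subset add_mul L (x ^+ n) <= L}.
    by apply: H; apply/mksubP; exists e; rewrite ?subrr ?rpred0.
  apply: Lmax; last first.
    by move=> y yL; apply/mksubP; exists 0; rewrite ?scaler0 ?subr0 ?rpred0.
  split.
  - move=> y /mksubP[f fE yf]; rewrite -(subrK (x ^+ n *: f) y).
    by apply: rpredD; [apply: LE | apply: rpredZ].
  - by move=> y /mlL yL; apply/mksubP; exists 0; rewrite ?scaler0 ?subr0 ?rpred0.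
  move=> c cC /mksubP[f fE cf]; apply: LC => //.
  (* Write c = y + x^n f with y in L. Then x^(l+n) f = x^l c - x^l y lies in L, and by stationarity
     so does x^n f. *)
  have xl : x ^+ l *: c \in L.
    by apply/mlL; apply: smul_mem cC; apply: ideal_pow_exp.
  suff /Hn/mksubP[|_ fL] : f \in colon_in L (x ^+ (l + n)); first exact: leq_addl.
    by rewrite -(subrK (x ^+ n *: f) c); apply: rpredD.
  apply/mksubP; split=> //.
  have -> : x ^+ (l + n) *: f = x ^+ l *: c - x ^+ l *: (c - x ^+ n *: f).
    by rewrite scalerBr opprB addrC subrK scalerA exprD.
  by apply: submodB => //; apply: rpredZ.
have [s [sm ms]] := noeth_fg ((noetherian_modE _).1 R_noetherian) (L := m) (fun _ => @False_ind _) (fun _ _ => I).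
have [|x /sm|j Hj] := ideal_pow_sub_radical (s := s) (J := transporter L).
- move=> T JT sT x /ms; apply: span_sub => y [//|]; exact: sT.
- exact: rad.
exists j => c cC cE; apply: LC => //; move: c cE {cC}.
by apply: smul_sub => a e /Hj/mksubP; apply.
Qed.
End ArtinRees.

(** N is a vector space over R/m. A strictly increasing sequence of subspaces yields independent
    vectors [v n], and the spans of the tails of this sequence decrease strictly. *)
Lemma killed_artin_noetherian (N : lmodType R) : maximal_ideal m ->
  (forall a (x : N), a \in m -> a *: x = 0) ->
  artinian_mod N -> noetherian_mod N.
Proof.
move=> [m1 mmax] mN /artinian_modE aN; apply/noetherian_modE => S inc _ _.
apply: contrapT => nst.
have unit_mod c : c \notin m -> exists r, forall x : N, r *: (c *: x) = x.
  move=> cm; have : 1 \in add_elt m c.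
    apply: contrapT => /negP n1; have /mmax H := @add_elt_sub m c.
    by move: cm; rewrite -(H n1) add_elt_mem.
  move=> /add_eltP[r r1]; exists r => x.
  by apply/eqP; rewrite eq_sym -subr_eq0 scalerA -{1}[x]scale1r -scalerBl mN.
have /choice[next Hn] n : exists kv : nat * N,
    [/\ (n <= kv.1)%N, kv.2 \in S kv.1 & kv.2 \notin S n].
  apply: contrapT => H; apply: nst; exists n => k nk x xk.
  by apply/negPn/negP => xn; apply: H; exists (k, x).
pose k n := iter n (fun n => (next n).1) 0%N; pose v n := (next (k n)).2.
have kS n : (k n <= k n.+1)%N by have [] := Hn (k n).
have vS n : v n \in S (k n.+1) by have [] := Hn (k n).
have vnS n : v n \notin S (k n) by have [] := Hn (k n).
have Sk n p : (n <= p)%N -> {subset S (k n) <= S (k p)}.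
  by apply: (incr_chain (S := fun n => S (k n))) => q; apply: incr_chain.
pose Q p d y := exists2 j, (p <= j < p + d)%N & y = v j.
have indep p d x : x \in span (Q p d) -> x \in S (k p) -> x = 0.
  elim: d x => [|d IHd] x.
    have H : {subset span (Q p 0%N) <= span (fun y : N => y \in [::])}.
      by apply: span_sub => y [j]; rewrite addn0; case: leqP => //= h /(leq_trans h); rewrite ltnn.
    by move=> /H/span_nil.
  have H : {subset span (Q p d.+1) <= span (fun y => y = v (p + d)%N \/ Q p d y)}.
    apply: span_mono => y [j]; rewrite addnS ltnS => /andP[pj].
    rewrite leq_eqVlt => /orP[/eqP-> ->|jd ->]; first by left.
    by right; exists j; rewrite // pj.
  move/H/span_add1 => [c]; have [cm|/unit_mod[r rc]] := boolP (c \in m).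
    by rewrite mN // subr0; apply: IHd.
  (* A nonzero last coefficient would put the last vector into S (k (p + d)), where x and all
     earlier vectors already lie. *)
  move=> xc xp; suff: v (p + d)%N \in S (k (p + d)%N) by rewrite (negPf (vnS _)).
  rewrite -(rc (v _)); apply: rpredZ.
  rewrite -[c *: _](subKr x); apply: submodB.
    by apply: (Sk p); rewrite ?leq_addr.
  move: xc; apply: span_sub => _ [j /andP[_ jpd] ->].
  exact: (Sk j.+1).
(* Where the tails become stationary, [v n] is a combination of later vectors; it lies in S (k
   n.+1), so [indep] with p = n.+1 makes it zero. *)
pose T p := span (fun y => exists2 j, (p <= j)%N & y = v j).
have [|//|n Hst] := aN T.
  by move=> n; apply: span_mono => y [j /ltnW nj ->]; exists j.
have : v n \in T n.+1 by apply: (Hst _ (leqnSn n)); apply: mem_span; exists n.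
have P0 : exists d, (0 : N) \in span (Q n.+1 d) by exists 0%N; apply: rpred0.
have PD a (u w : N) : (exists d, u \in span (Q n.+1 d)) ->
    (exists d, w \in span (Q n.+1 d)) -> exists d, a *: u + w \in span (Q n.+1 d).
  move=> [d ud] [e we]; exists (maxn d e).
  have Qm f : (f <= maxn d e)%N ->
      {subset span (Q n.+1 f) <= span (Q n.+1 (maxn d e))}.
    move=> fm; apply: span_mono => y [j /andP[nj jf] ->]; exists j => //.
    by rewrite nj (leq_trans jf) // leq_add2l.
  apply: rpredD; first apply: rpredZ; [apply: Qm ud | apply: Qm we].
    exact: leq_maxl.
  exact: leq_maxr.
move/(@span_sub _ _ _ (mksub P0 PD)) => H.
have /mksubP[d vd] : v n \in mksub P0 PD.
  apply: H => x [j nj ->].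
  apply/(mksubP P0 PD); exists (j - n)%N; apply: mem_span.
  by exists j; rewrite // nj addSn ltnS subnKC ?leqnn // ltnW.
have := vnS n; rewrite (indep _ _ _ vd (vS n)).
by rewrite rpred0.
Qed.

End IdealPowers.

(** * Modules over a complete ring *)

Section AdicNoetherian.
Variables (A : comPzRingType) (X : lmodType A) (x : A).

(** Completeness in the direction of [x]: the sum [y] of the series is prescribed modulo every power
    of [x], the remainder [q] being arbitrary. *)
Definition series_converge := forall r : nat -> A, exists y, forall p,
  exists q, y = \sum_(n < p) x ^+ n * r n + x ^+ p * q.

Hypothesis conv : series_converge.
Hypothesis sep : forall v : X, (forall n, exists w, v = x ^+ n *: w) -> v = 0.
Hypothesis nX : noeth_between (fun v : X => exists w, v = x *: w) (fun=> True).

(* The leading coefficients of the elements of S of order n in x, as in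
   Hilbert's basis theorem. *)
Section Initial.
Variables (n : nat) (S : submodClosed X).
Fact initial_subproof : (exists z, x ^+ n *: (0 : X) - x ^+ n.+1 *: z \in S) /\
  forall a (u v : X), (exists z, x ^+ n *: u - x ^+ n.+1 *: z \in S) ->
  (exists z, x ^+ n *: v - x ^+ n.+1 *: z \in S) ->
  exists z, x ^+ n *: (a *: u + v) - x ^+ n.+1 *: z \in S.
Proof.
split=> [|a u v [z zS] [w wS]]; first by exists 0; rewrite !scaler0 subrr rpred0.
exists (a *: z + w); rewrite !scalerDr opprD addrACA !scalerA ![_ * a]mulrC.
by rewrite -!scalerA -scalerBr; apply: rpredD => //; apply: rpredZ.
Qed.
Definition initial : submodClosed X :=
  mksub (P := fun y => exists z, x ^+ n *: y - x ^+ n.+1 *: z \in S)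
    initial_subproof.1 initial_subproof.2.
Lemma initialP y :
  reflect (exists z, x ^+ n *: y - x ^+ n.+1 *: z \in S) (y \in initial).
Proof. exact: mksubP. Qed.
End Initial.

Lemma initialS n S : {subset initial n S <= initial n.+1 S}.
Proof.
move=> y /initialP[z zS]; apply/initialP; exists z.
by rewrite !(exprS x n.+1) {1}exprS -!scalerA -scalerBr; apply: rpredZ.
Qed.

Lemma initial_mono n (S T : submodClosed X) : {subset S <= T} ->
  {subset initial n S <= initial n T}.
Proof. by move=> ST y /initialP[z /ST zT]; apply/initialP; exists z. Qed.

Lemma initial_mul n S w : x *: w \in initial n S.
Proof. by apply/initialP; exists w; rewrite scalerA -exprSr subrr rpred0. Qed.

Lemma span_mul_comb (s : seq X) v : uniq s ->
  v \in span (fun y => (exists w, y = x *: w) \/ y \in s) ->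
  exists (r : X -> A) w, v = \sum_(y <- s) r y *: y + x *: w.
Proof.
move=> us.
have P0 : exists (r : X -> A) w, 0 = \sum_(y <- s) r y *: y + x *: w.
  exists (fun=> 0), 0; rewrite scaler0 addr0 big1 // => y _; exact: scale0r.
have PD a (u t : X) : (exists (r : X -> A) w, u = \sum_(y <- s) r y *: y + x *: w) ->
    (exists (r : X -> A) w, t = \sum_(y <- s) r y *: y + x *: w) ->
    exists (r : X -> A) w, a *: u + t = \sum_(y <- s) r y *: y + x *: w.
  move=> [r [w ->]] [q [z ->]]; exists (fun y => a * r y + q y), (a *: w + z).
  rewrite !scalerDr addrACA scaler_sumr -big_split scalerA mulrC -scalerA; congr (_ + _).
  by apply: eq_bigr => y _; rewrite scalerDl scalerA.
move/(@span_sub _ _ _ (mksub P0 PD)) => H; apply/(mksubP P0 PD)/H => y [[w ->]|ys].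
  apply/(mksubP P0 PD); exists (fun=> 0), w.
  by rewrite big1 ?add0r // => z _; apply: scale0r.
apply/(mksubP P0 PD); exists (fun z => (z == y)%:R), 0.
rewrite scaler0 addr0 (bigD1_seq y) //= eqxx scale1r big1 ?addr0 // => z.
by move/negPf->; apply: scale0r.
Qed.

(** The modules of leading coefficients all contain xX, so they stabilise in the order n and in the
    index of S together. A later S k then has the same leading coefficients as S K, and its elements
    are approximated by those of S K to ever higher order. From order N on, finitely many generators
    suffice, so that the corrections add up to power series in x. *)
Lemma adic_noetherian : noetherian_mod X.
Proof.
apply/noetherian_modE => S inc _ _.
have Sm n k : (n <= k)%N -> {subset S n <= S k} by apply: incr_chain.
have Lm n k j l : (n <= k)%N -> (j <= l)%N ->
    {subset initial n (S j) <= initial k (S l)}.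
  move=> nk jl y yj.
  have : {subset initial n (S l) <= initial k (S l)}.
    by apply: (incr_chain (S := fun n => initial n (S l))) => // p; apply: initialS.
  by apply; move: y yj; apply/initial_mono/Sm.
(* The diagonal chain stabilises all orders n >= N at once; the finitely many orders below N are
   stabilised one by one through [Kf]. *)
have [n|n _ [w ->]|//|N HN] := nX (S := fun n => initial n (S n)).
- by apply: Lm; apply: leqnSn.
- exact: initial_mul.
have /choice[Kf HK] n : exists K, forall k, (K <= k)%N ->
    {subset initial n (S k) <= initial n (S K)}.
  apply: (nX (S := fun k => initial n (S k))) => [k|k _ [w ->]|//].
    by apply: Lm.
  exact: initial_mul.
pose K := maxn N (\max_(n < N) Kf n).
have NK : (N <= K)%N by apply: leq_maxl.
have tail n k : (N <= n)%N -> {subset initial n (S k) <= initial N (S N)}.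
  move=> Nn y yk; apply: (HN (maxn n k)); first by rewrite leq_max Nn.
  by move: y yk; apply: Lm; [apply: leq_maxl | apply: leq_maxr].
have LK n k : (K <= k)%N -> {subset initial n (S k) <= initial n (S K)}.
  move=> Kk y yk; case: (leqP N n) => [Nn|nN].
    by apply: (Lm N _ N _ Nn NK); apply: tail yk.
  have KnK : (Kf n <= K)%N.
    by apply: leq_trans (leq_maxr _ _); apply: (leq_bigmax (Ordinal nN)).
  apply: (Lm n n _ _ (leqnn _) KnK); apply: HK yk.
  exact: leq_trans KnK Kk.
have [s0 [s0L Ls0]] := noeth_fg nX (L := initial N (S K))
  (fun _ '(ex_intro w e) => eq_ind_r (fun v => v \in _) (initial_mul N (S K) w) e)
  (fun _ _ => I).
pose s := undup s0.
have sL y : y \in s -> y \in initial N (S K) by rewrite mem_undup; apply: s0L.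
have Ls v : v \in initial N (S K) ->
    exists (r : X -> A) w, v = \sum_(y <- s) r y *: y + x *: w.
  move/Ls0 => vs; apply: span_mul_comb; first exact: undup_uniq.
  by move: v vs; apply: span_mono => y; rewrite mem_undup.
have /choice[sg Hsg] y : exists z, y \in s -> x ^+ N *: y - x ^+ N.+1 *: z \in S K.
  have [/sL/initialP[z zS]|] := boolP (y \in s); first by exists z.
  by exists 0.
pose sig y := x ^+ N *: y - x ^+ N.+1 *: sg y.
pose c (r : X -> A) := \sum_(y <- s) r y *: sig y.
have cS r : c r \in S K.
  by rewrite /c big_seq; apply: rpred_sum => y ys; apply/rpredZ/Hsg.
exists K => k Kk t tk.
(* Below order N the generators change with n, but only finitely many corrections are required: this
   is used for n = N. *)
have stepa n : exists2 u, u \in S K & exists w, t - u = x ^+ n *: w.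
  elim: n => [|n [u uK [w tu]]].
    by exists 0; [exact: rpred0 | exists t; rewrite subr0 scale1r].
  have /LK/initialP[//|z zK] : w \in initial n (S k).
    apply/initialP; exists 0; rewrite scaler0 subr0 -tu.
    by apply: submodB => //; apply: Sm uK.
  exists (u + (x ^+ n *: w - x ^+ n.+1 *: z)); first exact: rpredD.
  by exists z; rewrite opprD addrA tu opprB addrC subrK.
have [u uK [w0 tu]] := stepa N.
rewrite -(subrK u t); apply: rpredD => //.
set t1 := t - u in tu *.
have t1k : t1 \in S k by apply: submodB => //; apply: Sm uK.
(* For an element of S k divisible by x^(N+n), these are the coefficients of the correction x^n *
   [c r], which raises the order by one. Elsewhere the default is 0. *)
have /choice[rho Hrho] (nv : nat * X) : exists r : X -> A,
    nv.2 \in S k -> (exists w, nv.2 = x ^+ (N + nv.1) *: w) ->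
    exists w, nv.2 - x ^+ nv.1 *: c r = x ^+ (N + nv.1).+1 *: w.
  case: nv => n v /=.
  have [vk|_] := boolP (v \in S k); last by exists (fun=> 0).
  case: (pselect (exists w, v = x ^+ (N + n) *: w)) => [[w vw]|nw]; last first.
    by exists (fun=> 0).
  have /tail wL : w \in initial (N + n) (S k).
    by apply/initialP; exists 0; rewrite scaler0 subr0 -vw.
  have /Ls[r [z wz]] : w \in initial N (S K).
    by apply: (Lm N _ N) => //; apply: wL; apply: leq_addr.
  exists r => _ _; exists (z + \sum_(y <- s) r y *: sg y).
  have -> : c r = x ^+ N *: (\sum_(y <- s) r y *: y) -
      x ^+ N.+1 *: \sum_(y <- s) r y *: sg y.
    rewrite /c !scaler_sumr -sumrB; apply: eq_bigr => y _.
    by rewrite /sig scalerBr !scalerA ![r y * _]mulrC.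
  set B := \sum_(y <- s) _; set C := \sum_(y <- s) _.
  have e1 : x ^+ n *: (x ^+ N *: B) = x ^+ (N + n) *: B by rewrite scalerA -exprD addnC.
  have e2 : x ^+ n *: (x ^+ N.+1 *: C) = x ^+ (N + n).+1 *: C.
    by rewrite scalerA -exprD addnS addnC.
  have e3 : x ^+ (N + n) *: (x *: z) = x ^+ (N + n).+1 *: z by rewrite scalerA -exprSr.
  rewrite vw wz -/B scalerBr e1 e2 !scalerDr e3 opprB [_ *: C - _]addrC.
  by rewrite addrACA subrr add0r.
pose tau := fix tau n := if n is p.+1 then tau p - x ^+ p *: c (rho (p, tau p)) else t1.
have tauk n : tau n \in S k.
  elim: n => //= n IH; apply: submodB => //.
  by apply/rpredZ/(Sm _ _ Kk).
have taux n : exists w, tau n = x ^+ (N + n) *: w.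
  elim: n => [|n IH] /=; first by exists w0; rewrite addn0.
  by rewrite addnS; apply: (Hrho (n, tau n) (tauk n) IH).
have tauE p : t1 = \sum_(n < p) x ^+ n *: c (rho (n : nat, tau n)) + tau p.
  elim: p => [|p IH]; first by rewrite big_ord0 add0r.
  by rewrite big_ord_recr /= -addrA [_ + (tau p - _)]addrC subrK.
(* For each generator y the coefficients chosen along [tau] are summed into one element of the ring,
   so the limit of the corrections is [c r], again in S K. *)
have /choice[r Hr] y := conv (fun n => rho (n, tau n) y).
suff /eqP : t1 - c r = 0 by rewrite subr_eq0 => /eqP->.
apply: sep => p.
have /choice[q Hq] y := Hr y p.
have cE : c r = \sum_(n < p) x ^+ n *: c (rho (n : nat, tau n)) + x ^+ p *: c q.
  rewrite /c scaler_sumr.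
  under [X in X + _]eq_bigr do rewrite scaler_sumr.
  rewrite exchange_big /= -big_split; apply: eq_bigr => y _ /=.
  rewrite Hq scalerDl scaler_suml scalerA; congr (_ + _).
  by apply: eq_bigr => n _; rewrite scalerA.
have [w tw] := taux p; exists (x ^+ N *: w - c q).
by rewrite (tauE p) cE opprD addrACA subrr add0r tw scalerBr scalerA -exprD addnC.
Qed.

End AdicNoetherian.

Section CompletionSeries.
Variables (R : comPzRingType) (m : submodClosed R^o).
Local Notation A := (completion m).

Lemma completion_coordD (y z : A) s :
  completion_coord (y + z) s = completion_coord y s + completion_coord z s.
Proof. by []. Qed.

Lemma completion_coordM (y z : A) s :
  completion_coord (y * z) s = completion_coord y s * completion_coord z s.
Proof. by []. Qed.

Lemma completion_in_exp (a : R) n : (completion_in m a) ^+ n = completion_in m (a ^+ n).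
Proof.
elim: n => [|n IH] //; rewrite !exprS IH; apply: completion_ext => s.
by rewrite completion_coordM; apply: (qmul_pi (ideal_pow m s)).
Qed.

Lemma completion_coord_exp (a : R) s : a \in m ->
  completion_coord (completion_in m a ^+ s) s = 0.
Proof.
move=> am; rewrite completion_in_exp; apply/eqP; rewrite qpi_eq0.
exact: ideal_pow_exp.
Qed.

(** As a^s vanishes in R/m^s, the coordinate s of the sum is read off the partial sum of length s.
    The remainder after p terms is the same construction on the shifted coefficients. *)
Lemma completion_series (a : R) : a \in m -> series_converge (completion_in m a).
Proof.
move=> am; set x := completion_in m a.
have coh (r : nat -> A) : ((fun s => completion_coord (\sum_(n < s) x ^+ n * r n) s) :
    dprod (quopow m)) \in coherent (quopow_map m).
  apply/mksubP => s; rewrite big_ord_recr /=.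
  apply: (etrans (@invlimP _ _ (quopow_map m) (\sum_(n < s) x ^+ n * r n + x ^+ s * r s : A) s)).
  by rewrite [LHS]completion_coordD completion_coordM completion_coord_exp // mul0r addr0.
pose ser r : A := Sub (_ : dprod (quopow m)) (coh r).
have serE r s : completion_coord (ser r) s = completion_coord (\sum_(n < s) x ^+ n * r n) s.
  by [].
have serS r : ser r = r 0%N + x * ser (fun n => r n.+1).
  apply: completion_ext => s; rewrite completion_coordD completion_coordM !serE.
  rewrite -completion_coordM -completion_coordD.
  have -> : r 0%N + x * \sum_(n < s) x ^+ n * r n.+1 =
      \sum_(n < s) x ^+ n * r n + x ^+ s * r s.
    transitivity (\sum_(n < s.+1) x ^+ n * r n); last by rewrite big_ord_recr.
    rewrite big_ord_recl expr0 mul1r mulr_sumr; congr (_ + _).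
    by apply: eq_bigr => n _; rewrite mulrA -exprS.
  by rewrite [RHS]completion_coordD completion_coordM completion_coord_exp // mul0r addr0.
move=> r; exists (ser r) => p; exists (ser (fun n => r (p + n)%N)).
elim: p => [|p IH]; first by rewrite big_ord0 add0r expr0 mul1r.
rewrite IH big_ord_recr /= -addrA; congr (_ + _).
rewrite serS addn0 mulrDr mulrA -exprSr; congr (_ + _ * ser _).
by apply: funext => n; rewrite addnS.
Qed.

End CompletionSeries.

(** * Tor *)

Section QuotientLift.
Variables (R : pzRingType) (V W : lmodType R) (S : submodClosed V).
Variables (f : {linear V -> W}) (fS : forall x, x \in S -> f x = 0).

Definition qlift_fun (x : quomod S) : W := f (repr x).
Lemma qlift_fun_pi v : qlift_fun (qpi S v) = f v.
Proof.
apply/eqP; rewrite -subr_eq0 -linearB; apply/eqP/fS.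
by rewrite -qpi_eq qpi_repr.
Qed.
Fact qlift_linear : linear qlift_fun.
Proof.
move=> a x y; rewrite -(qpi_repr x) -(qpi_repr y) -linearP !qlift_fun_pi.
by rewrite linearP.
Qed.
Definition qlift : {linear quomod S -> W} := mklin qlift_linear.
Lemma qliftE v : qlift (qpi S v) = f v. Proof. exact: qlift_fun_pi. Qed.
End QuotientLift.

(** * Tensor products with free modules *)

Section TensorFree.
Variable R : comNzRingType.
Implicit Types A B N P : lmodType R.

Lemma tens_addr A N (a : A) (n n' : N) : tens a (n + n') = tens a n + tens a n'.
Proof.
apply/eqP; rewrite -linearD qpi_eq; apply: mem_span.
by constructor 2; exists a, n, n'; rewrite opprD addrA.
Qed.

Lemma tens_scaler A N r (a : A) (n : N) : tens a (r *: n) = r *: tens a n.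
Proof.
apply/eqP; rewrite -linearZ qpi_eq; apply: mem_span.
by constructor 4; exists r, a, n.
Qed.

Lemma tens0r A N (a : A) : tens a (0 : N) = 0.
Proof. by rewrite -{1}(scale0r (0 : N)) tens_scaler scale0r. Qed.

Lemma tens_linearl A N (n : N) : linear (fun a : A => tens a n).
Proof. by move=> r a b; rewrite tens_addl tens_scalel. Qed.

(** The projection modulo [S] and the zero map agree on pure tensors. *)
Lemma tensor_ind A N (S : submodClosed (tensor A N)) :
  (forall a n, tens a n \in S) -> forall y, y \in S.
Proof.
move=> H y; rewrite -qpi_eq0; apply/eqP.
have lin0 : linear (fun _ : tensor A N => 0 : quomod S).
  by move=> a u v; rewrite scaler0 addr0.
apply: (@tensor_ext _ _ _ _ (qpi S : {linear tensor A N -> quomod S}) (mklin lin0)) => a n.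
by apply/eqP; rewrite [X in is_true X]qpi_eq0.
Qed.

Lemma tensor_map_id A N (f : {linear A -> A}) (g : {linear N -> N}) :
  (forall x, f x = x) -> (forall x, g x = x) -> forall y, tensor_map f g y = y.
Proof.
move=> fid gid y; have lid : linear (fun z : tensor A N => z) by [].
apply: (@tensor_ext _ _ _ _ (tensor_map f g) (mklin lid)) => a n.
by rewrite tensor_mapE fid gid.
Qed.

Lemma tensor_map_comp A B (C : lmodType R) N P (Q : lmodType R) (f : {linear A -> B}) (g : {linear N -> P})
    (f' : {linear B -> C}) (g' : {linear P -> Q})
    (f'' : {linear A -> C}) (g'' : {linear N -> Q}) :
  (forall x, f'' x = f' (f x)) -> (forall x, g'' x = g' (g x)) ->
  forall y, tensor_map f'' g'' y = tensor_map f' g' (tensor_map f g y).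
Proof.
move=> fE gE y.
have lc : linear (fun y => tensor_map f' g' (tensor_map f g y)).
  by move=> a u v; rewrite !linearP.
apply: (@tensor_ext _ _ _ _ (tensor_map f'' g'') (mklin lc)) => a n.
rewrite -[RHS]/(tensor_map f' g' (tensor_map f g (tens a n))).
by rewrite !tensor_mapE fE gE.
Qed.

Section FreeCoordinates.
Variables (K : choiceType) (N : lmodType R).
Local Notation F := ({freeg K / R} : lmodType R).
Local Notation C := (tensor F N).

Fact coord_pre_subproof k (z : {freeg (F * N)%type / R}) :
  z \in span (@tensor_rel R F N) ->
  lift_free (fun p : F * N => coeff k p.1 *: p.2) z = 0.
Proof.
set f := lift_free _.
suff H : {subset span (@tensor_rel R F N) <= lker f} by move/H/mksubP.
apply: span_sub => y Hy; apply/mksubP.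
case: Hy => [] [a [b [c ->]]]; rewrite /f !linearB ?linearZ !lift_freeE /=.
- by rewrite coeffD scalerDl -addrA -opprD subrr.
- by rewrite scalerDr -addrA -opprD subrr.
- by rewrite coeffZ scalerN scalerA subrr.
- by rewrite scalerN !scalerA mulrC subrr.
Qed.
(** F tensor N is a direct sum of copies of N indexed by K, and this is the projection to the copy
    of index k. Exactness of F tensor - is checked on these coordinates. *)
Definition tcoord k : {linear C -> N} := qlift (@coord_pre_subproof k).
Lemma tcoordE k x n : tcoord k (tens x n) = coeff k x *: n.
Proof. by rewrite [LHS]qliftE lift_freeE. Qed.

(** The formula is required on every duplicate-free list containing [s], so that two elements can be
    expanded over a common list. *)
Fact coord_sum_subproof :
  (exists s : seq K, forall s', uniq s' -> {subset s <= s'} ->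
    (0 : C) = \sum_(k <- s') tens (<< k >> : F) (tcoord k 0)) /\
  forall a (u v : C), (exists s : seq K, forall s', uniq s' -> {subset s <= s'} ->
    u = \sum_(k <- s') tens (<< k >> : F) (tcoord k u)) ->
  (exists s : seq K, forall s', uniq s' -> {subset s <= s'} ->
    v = \sum_(k <- s') tens (<< k >> : F) (tcoord k v)) ->
  exists s : seq K, forall s', uniq s' -> {subset s <= s'} ->
    a *: u + v = \sum_(k <- s') tens (<< k >> : F) (tcoord k (a *: u + v)).
Proof.
split=> [|a u v [s Hs] [t Ht]].
  exists [::] => s' _ _; rewrite big1 // => k _.
  by rewrite linear0 tens0r.
exists (s ++ t) => s' us' ss'.
have us : u = \sum_(k <- s') tens (<< k >> : F) (tcoord k u).
  by apply: Hs => // x xs; apply: ss'; rewrite mem_cat xs.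
have vs : v = \sum_(k <- s') tens (<< k >> : F) (tcoord k v).
  by apply: Ht => // x xs; apply: ss'; rewrite mem_cat xs orbT.
transitivity (a *: (\sum_(k <- s') tens (<< k >> : F) (tcoord k u)) +
    \sum_(k <- s') tens (<< k >> : F) (tcoord k v)); first by congr (a *: _ + _).
rewrite scaler_sumr -big_split; apply: eq_bigr => k _; rewrite linearP.
by rewrite tens_addr tens_scaler.
Qed.

Lemma tcoord_sum (y : C) :
  exists s, y = \sum_(k <- s) tens (<< k >> : F) (tcoord k y).
Proof.
suff : y \in mksub coord_sum_subproof.1 coord_sum_subproof.2.
  move/mksubP => [s Hs]; exists (undup s); apply: Hs; first exact: undup_uniq.
  by move=> k; rewrite mem_undup.
apply: tensor_ind => x n {y}.
set S := mksub _ _.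
suff H : qpi S (tens x n) = 0 by rewrite -qpi_eq0 H.
have l1 : linear (fun x : F => qpi S (tens x n)).
  by move=> a u v; rewrite tens_addl tens_scalel linearP.
have l0 : linear (fun _ : F => 0 : quomod S).
  by move=> a u v; rewrite scaler0 addr0.
apply: (@free_ext _ _ _ (mklin l1) (mklin l0)) => k.
apply/eqP; rewrite qpi_eq0; apply/mksubP; exists [:: k] => s' us' ks'.
rewrite (bigD1_seq k) ?ks' ?mem_head // big1 => [|j jk].
  by rewrite [RHS]addr0 tcoordE coeffU eqxx mulr1 scale1r.
rewrite tcoordE coeffU eq_sym (negPf jk) mulr0 scale0r.
by rewrite tens0r.
Qed.

Lemma tcoord_inj (y : C) : (forall k, tcoord k y = 0) -> y = 0.
Proof.
move=> y0; have [s ->] := tcoord_sum y; apply: big1 => k _.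
by rewrite y0 tens0r.
Qed.
End FreeCoordinates.
Arguments tcoord {K N} k.

Section FreeExact.
Variables (K : choiceType).
Local Notation F := ({freeg K / R} : lmodType R).

Lemma tcoord_map N P (g : {linear N -> P}) k (y : tensor F N) :
  tcoord k (tensor_map (idfun : {linear F -> F}) g y) = g (tcoord k y).
Proof.
have l1 : linear (fun y => tcoord k (tensor_map (idfun : {linear F -> F}) g y)).
  by move=> a u v; rewrite !linearP.
have l2 : linear (fun y : tensor F N => g (tcoord k y)).
  by move=> a u v; rewrite !linearP.
apply: (@tensor_ext _ _ _ _ (mklin l1) (mklin l2)) => x n.
rewrite -[LHS]/(tcoord k (tensor_map idfun g (tens x n))).
rewrite -[RHS]/(g (tcoord k (tens x n))).
by rewrite tensor_mapE !tcoordE linearZ.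
Qed.

Variables (N' N N'' : lmodType R) (f : {linear N' -> N}) (g : {linear N -> N''}).
Local Notation tf := (tensor_map (idfun : {linear F -> F}) f).
Local Notation tg := (tensor_map (idfun : {linear F -> F}) g).

Lemma free_tensor_inj : injective f -> injective tf.
Proof.
move=> finj u v uv; apply/eqP; rewrite -subr_eq0; apply/eqP/tcoord_inj => k.
apply: finj; rewrite -tcoord_map linearB uv subrr !linear0 //.
Qed.

Lemma free_tensor_exact : (forall y, g y = 0 -> exists x, f x = y) ->
  forall y, tg y = 0 -> exists x, tf x = y.
Proof.
move=> ex y gy.
have /choice[c Hc] k : exists x, f x = tcoord k y.
  by apply: ex; rewrite -tcoord_map gy linear0.
have [s ->] := tcoord_sum y.
exists (\sum_(k <- s) tens (<< k >> : F) (c k)); rewrite linear_sum.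
by apply: eq_bigr => k _; rewrite tensor_mapE Hc.
Qed.

Lemma free_tensor_surj : (forall y, exists x, g x = y) -> forall y, exists x, tg x = y.
Proof.
move=> gs y; suff /mksubP : y \in limg tg by [].
apply: tensor_ind => a n; apply/mksubP; have [x <-] := gs n.
by exists (tens a x); rewrite tensor_mapE.
Qed.
End FreeExact.
End TensorFree.

(** * Homology classes and their cycles *)

Section HomologyRep.
Variable R : pzRingType.
Section Rep.
Variables (U V W : lmodType R) (f : {linear U -> V}) (g : {linear V -> W}).
Implicit Types (x y : homology f g) (v w : V).

(** Relating a class to each of its cycles, instead of choosing one, lets diagram chases be carried
    out on chains. *)
Definition hrep x v := exists2 c : submod_of (lker g),
  val c = v & x = qpi (sub_in (lker g) (limg f)) c.

Lemma hrep_ex x : exists v, hrep x v.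
Proof.
exists (val (repr x : submod_of (lker g))), (repr x : submod_of (lker g)) => //.
by rewrite qpi_repr.
Qed.

Lemma hrep_cycle x v : hrep x v -> g v = 0.
Proof. by case=> c <- _; have /mksubP := valP c. Qed.

Lemma hrep_intro v : g v = 0 -> exists x, hrep x v.
Proof.
move=> gv; have vk : v \in lker g by apply/mksubP.
by exists (qpi _ (Sub v vk : submod_of (lker g))), (Sub v vk).
Qed.

Lemma hrep00 : hrep 0 0.
Proof. by exists 0; rewrite linear0. Qed.

Lemma hrep_lin a x y v w : hrep x v -> hrep y w -> hrep (a *: x + y) (a *: v + w).
Proof.
case=> c <- -> [d <- ->]; exists (a *: c + d); first by rewrite linearP.
by rewrite linearP.
Qed.

Lemma hrepB x y v w : hrep x v -> hrep y w -> hrep (x - y) (v - w).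
Proof.
move=> xv yw; rewrite [x - y]addrC [v - w]addrC -[- y]scaleN1r -[- w]scaleN1r.
exact: hrep_lin.
Qed.

Lemma hrep_bound x v : hrep x v -> (exists u, f u = v) -> x = 0.
Proof.
case=> c <- -> fc; apply/eqP; rewrite qpi_eq0.
by apply/mksubP/mksubP.
Qed.

Lemma hrep0 v : hrep 0 v -> exists u, f u = v.
Proof.
case=> c <- /esym/eqP; rewrite qpi_eq0.
by move/mksubP/mksubP.
Qed.

Lemma hrep_uniq x y v : hrep x v -> hrep y v -> x = y.
Proof.
move=> xv yv; apply/eqP; rewrite -subr_eq0; apply/eqP.
apply: (hrep_bound (hrepB xv yv)).
by exists 0; rewrite subrr linear0.
Qed.

Lemma hrep_add x v u : hrep x v -> g (f u) = 0 -> hrep x (v + f u).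
Proof.
move=> xv gfu; have [y yv] := hrep_intro gfu.
have y0 : y = 0 by apply: (hrep_bound yv); exists u.
rewrite -[x]addr0 -y0 -[x]scale1r -[v]scale1r; exact: hrep_lin.
Qed.
End Rep.

Lemma hrep_map (U V W U' V' W' : lmodType R)
    (f : {linear U -> V}) (g : {linear V -> W})
    (f' : {linear U' -> V'}) (g' : {linear V' -> W'})
    (a : {linear U -> U'}) (b : {linear V -> V'}) (c : {linear W -> W'})
    (abf : forall x, b (f x) = f' (a x)) (bcg : forall x, c (g x) = g' (b x))
    (x : homology f g) v :
  hrep x v -> hrep (homology_map abf bcg x) (b v).
Proof.
case=> d <- ->; exists (sub_map (homology_map_ker bcg) d) => //.
by rewrite [LHS]quo_mapE.
Qed.
End HomologyRep.

Section TorFunctor.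
Variable R : comNzRingType.
Implicit Types A B N P : lmodType R.

Lemma free_map_id A (f : {linear A -> A}) : (forall x, f x = x) ->
  forall x, free_map f x = x.
Proof.
move=> fid; have l1 : linear (fun x : {freeg A / R} => x) by [].
apply: (@free_ext _ _ _ (free_map f) (mklin l1)) => k.
by rewrite free_mapE fid.
Qed.

Lemma free_map_comp A B (C : lmodType R) (f : {linear A -> B}) (g : {linear B -> C})
    (h : {linear A -> C}) : (forall x, h x = g (f x)) ->
  forall x, free_map h x = free_map g (free_map f x).
Proof.
move=> hE; have l1 : linear (fun x : {freeg A / R} => free_map g (free_map f x)).
  by move=> a u v; rewrite !linearP.
apply: (@free_ext _ _ _ (free_map h) (mklin l1)) => k.
rewrite -[RHS]/(free_map g (free_map f << k >>)).
by rewrite !free_mapE hE.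
Qed.

Lemma syz_map_id n A (f : {linear A -> A}) : (forall x, f x = x) ->
  forall x, syz_map n f x = x.
Proof.
move=> fid; elim: n => [|n IH] //= x; apply: val_inj => /=.
exact: free_map_id.
Qed.

Lemma syz_map_comp n A B (C : lmodType R) (f : {linear A -> B}) (g : {linear B -> C})
    (h : {linear A -> C}) : (forall x, h x = g (f x)) ->
  forall x, syz_map n h x = syz_map n g (syz_map n f x).
Proof.
move=> hE; elim: n => [|n IH] //= x; apply: val_inj => /=.
exact: free_map_comp.
Qed.

Lemma tensor_map_comm A B (C D : lmodType R) N P (Q S : lmodType R)
    (f : {linear A -> B}) (g : {linear B -> D})
    (h : {linear A -> C}) (k : {linear C -> D})
    (f' : {linear N -> P}) (g' : {linear P -> S})
    (h' : {linear N -> Q}) (k' : {linear Q -> S}) :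
  (forall x, g (f x) = k (h x)) -> (forall x, g' (f' x) = k' (h' x)) ->
  forall x, tensor_map g g' (tensor_map f f' x) = tensor_map k k' (tensor_map h h' x).
Proof.
move=> gf gf'.
have l1 : linear (fun x => tensor_map g g' (tensor_map f f' x)).
  by move=> b u v; rewrite !linearP.
have l2 : linear (fun x => tensor_map k k' (tensor_map h h' x)).
  by move=> b u v; rewrite !linearP.
apply: (@tensor_ext _ _ _ _ (mklin l1) (mklin l2)) => u n.
rewrite -[LHS]/(tensor_map g g' (tensor_map f f' (tens u n))).
rewrite -[RHS]/(tensor_map k k' (tensor_map h h' (tens u n))).
by rewrite !tensor_mapE gf gf'.
Qed.

Lemma res_dd n A x : res_d n A (res_d n.+1 A x) = 0.
Proof. by rewrite [LHS](congr1 val (res_d_ker x)). Qed.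

Lemma tor_out_d i A N y : tor_out i A N (tor_d i A N y) = 0.
Proof.
case: i y => [|i] y //.
have l1 : linear (fun y => tor_d i A N (tor_d i.+1 A N y)).
  by move=> b u v; rewrite !linearP.
have l0 : linear (fun _ : tor_chain i.+2 A N => 0 : tor_chain i A N).
  by move=> a u v; rewrite scaler0 addr0.
apply: (@tensor_ext _ _ _ _ (mklin l1) (mklin l0)) => u n.
rewrite -[LHS]/(tor_d i A N (tor_d i.+1 A N (tens u n))) !tensor_mapE res_dd.
by rewrite -[LHS]/(mklin (@tens_linearl R _ _ _) 0) linear0.
Qed.

(** [tor_chain_map idfun g] contains [res_map i idfun], which is the identity only up to a proof.
    With [idfun] itself on the free factor, the exactness lemmas for free modules apply directly. *)
Definition chmap i A N P (g : {linear N -> P}) :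
    {linear tor_chain i A N -> tor_chain i A P} :=
  tensor_map (idfun : {linear res i A -> res i A}) g.

Lemma chmap_d i A N P (g : {linear N -> P}) y :
  chmap i A g (tor_d i A N y) = tor_d i A P (chmap i.+1 A g y).
Proof. exact: tensor_map_comm. Qed.

Lemma chmap_out i A N P (g : {linear N -> P}) y :
  chmap i.-1 A g (tor_out i A N y) = tor_out i A P (chmap i A g y).
Proof. by case: i y => [|i] y; [apply: linear0 | apply: chmap_d]. Qed.

Lemma tor_chain_map_id i A N P (f : {linear A -> A}) (g : {linear N -> P}) y :
  (forall x, f x = x) -> tor_chain_map f g i y = chmap i A g y.
Proof.
move=> fid; rewrite [RHS](@tensor_map_comp _ _ _ _ _ _ _ (res_map i f) g idfun idfun) //.
  by rewrite tensor_map_id.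
by move=> x; apply/esym/free_map_id => z; apply: syz_map_id.
Qed.

Lemma trep_map i A B N P (f : {linear A -> B}) (g : {linear N -> P})
    (x : tor i A N) v :
  hrep x v -> hrep (tor_map f g i x) (tor_chain_map f g i v).
Proof. exact: hrep_map. Qed.

Lemma trep_chmap i A N P (g : {linear N -> P}) (x : tor i A N) v :
  hrep x v -> hrep (tor_map (idfun : {linear A -> A}) g i x) (chmap i A g v).
Proof. by move=> /(trep_map idfun g); rewrite tor_chain_map_id. Qed.

Lemma tor_map_comp i A B (C : lmodType R) N P (Q : lmodType R)
    (f : {linear A -> B}) (g : {linear B -> C}) (h : {linear A -> C})
    (f' : {linear N -> P}) (g' : {linear P -> Q}) (h' : {linear N -> Q}) :
  (forall x, h x = g (f x)) -> (forall x, h' x = g' (f' x)) ->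
  forall x, tor_map h h' i x = tor_map g g' i (tor_map f f' i x).
Proof.
move=> hE hE' x; have [v xv] := hrep_ex x.
apply: (hrep_uniq (trep_map h h' xv)).
rewrite [tor_chain_map _ _ _ _](@tensor_map_comp _ _ _ _ _ _ _ (res_map i f) f' (res_map i g) g') //.
  by do 2![apply: trep_map].
by apply: free_map_comp; apply: syz_map_comp.
Qed.

Lemma tor_map_scale i A N (a : R) (g : {linear N -> N}) : (forall x, g x = a *: x) ->
  forall x, tor_map (idfun : {linear A -> A}) g i x = a *: x.
Proof.
move=> gE x; have [v xv] := hrep_ex x; apply: (hrep_uniq (trep_chmap g xv)).
have -> : chmap i A g v = a *: v + 0.
  rewrite addr0.
  have l2 : linear (fun x : tor_chain i A N => a *: x).
    by move=> b u w; rewrite scalerDr !scalerA mulrC.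
  apply: (@tensor_ext _ _ _ _ (chmap i A g) (mklin l2)) => u n.
  by rewrite [LHS]tensor_mapE gE tens_scaler.
rewrite -[a *: x]addr0; apply: hrep_lin => //.
exact: hrep00.
Qed.

End TorFunctor.

(** * The long exact sequence of Tor *)

Section TorExact.
Variables (R : comNzRingType) (N' N N'' : lmodType R).
Variables (f : {linear N' -> N}) (g : {linear N -> N''}).
Hypotheses (finj : injective f) (gsurj : forall y, exists x, g x = y).
Hypotheses (gf0 : forall x, g (f x) = 0).
Hypothesis fg : forall y, g y = 0 -> exists x, f x = y.
Implicit Type A : lmodType R.

Local Notation tmap i A h := (tor_map (idfun : {linear A -> A}) h i).

Lemma chmap_inj i A : injective (chmap i A f).
Proof. exact: free_tensor_inj. Qed.
Lemma chmap_exact i A y : chmap i A g y = 0 -> exists x, chmap i A f x = y.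
Proof. exact: free_tensor_exact. Qed.
Lemma chmap_surj i A y : exists x, chmap i A g x = y.
Proof. exact: free_tensor_surj. Qed.
Lemma chmap0 i A y : chmap i A g (chmap i A f y) = 0.
Proof.
have l0 : linear (fun _ : N' => 0 : N'') by move=> a u v; rewrite scaler0 addr0.
rewrite -[LHS](@tensor_map_comp _ _ _ _ _ _ _ idfun f idfun g idfun (mklin l0)) //=.
have l1 : linear (fun _ : tor_chain i A N' => 0 : tor_chain i A N'').
  by move=> a u v; rewrite scaler0 addr0.
apply: (@tensor_ext _ _ _ _ (tensor_map idfun (mklin l0)) (mklin l1)) => a n.
by rewrite tensor_mapE tens0r.
Qed.

Lemma tor_exact_mid i A (x : tor i A N) : tmap i A g x = 0 ->
  exists y, tmap i A f y = x.
Proof.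
move=> gx; have [v xv] := hrep_ex x.
have := trep_chmap g xv; rewrite gx => /hrep0[w dw].
have [w1 w1w] := chmap_surj w.
have xv' : hrep x (v - tor_d i A N w1).
  by rewrite -linearN; apply: hrep_add => //; apply: tor_out_d.
have [u uv] : exists u, chmap i A f u = v - tor_d i A N w1.
  by apply: chmap_exact; rewrite linearB chmap_d w1w dw subrr.
have [y yu] : exists y : tor i A N', hrep y u.
  apply: hrep_intro; apply: chmap_inj; rewrite chmap_out uv linear0.
  exact: hrep_cycle xv'.
exists y; apply: hrep_uniq xv'; rewrite -uv; exact: trep_chmap.
Qed.

Lemma tor0_surj A (x : tor 0 A N'') : exists y, tmap 0%N A g y = x.
Proof.
have [v xv] := hrep_ex x; have [w wv] := chmap_surj v.
have [y yw] : exists y : tor 0 A N, hrep y w by apply: hrep_intro.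
by exists y; apply: hrep_uniq xv; rewrite -wv; apply: trep_chmap.
Qed.

(* The graph of the connecting homomorphism. *)
Definition tconn i A (z : tor i.+1 A N'') (w : tor i A N') :=
  exists v u, [/\ hrep z (chmap i.+1 A g v), hrep w u &
    chmap i A f u = tor_d i A N v].

Lemma tconn_total i A z : exists w, tconn (i := i) (A := A) z w.
Proof.
have [y zy] := hrep_ex z; have [v vy] := chmap_surj y.
have [u uv] : exists u, chmap i A f u = tor_d i A N v.
  by apply: chmap_exact; rewrite chmap_d vy; apply: hrep_cycle zy.
have [w wu] : exists w : tor i A N', hrep w u.
  apply: hrep_intro; apply: chmap_inj.
  by rewrite chmap_out uv linear0 tor_out_d.
by exists w, v, u; rewrite vy.
Qed.

Lemma tconn_lin i A a z z' w w' : tconn (i := i) (A := A) z w -> tconn z' w' ->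
  tconn (a *: z + z') (a *: w + w').
Proof.
move=> [v [u [zv wu uv]]] [v' [u' [zv' wu' uv']]].
exists (a *: v + v'), (a *: u + u'); split.
- by rewrite linearP; apply: hrep_lin.
- exact: hrep_lin.
- by rewrite !linearP uv uv'.
Qed.

Lemma tconn0 i A w : tconn (i := i) (A := A) 0 w -> w = 0.
Proof.
move=> [v [u [/hrep0[y yv] wu uv]]]; have [y1 y1y] := chmap_surj y.
have [u' u'v] : exists u', chmap i.+1 A f u' = v - tor_d i.+1 A N y1.
  by apply: chmap_exact; rewrite linearB chmap_d y1y yv subrr.
apply: (hrep_bound wu); exists u'; apply: chmap_inj.
rewrite chmap_d u'v uv linearB.
by rewrite -[tor_d i A N (tor_d _ _ _ _)]/(tor_out i.+1 A N _) tor_out_d subr0.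
Qed.

Lemma tconnB i A z z' w w' : tconn (i := i) (A := A) z w -> tconn z' w' ->
  tconn (z - z') (w - w').
Proof.
move=> zw zw'; rewrite [z - z']addrC [w - w']addrC -[- z']scaleN1r -[- w']scaleN1r.
exact: tconn_lin.
Qed.

Lemma tconn_uniq i A z w w' : tconn (i := i) (A := A) z w -> tconn z w' -> w = w'.
Proof.
move=> zw zw'; apply/eqP; rewrite -subr_eq0; apply/eqP.
by apply: (@tconn0 i A); rewrite -(subrr z); apply: tconnB.
Qed.

Lemma tconn_exact i A z : tconn (i := i) (A := A) z 0 -> exists y, tmap i.+1 A g y = z.
Proof.
move=> [v [u [zv /hrep0[u' u'u] uv]]].
have [y yv] : exists y : tor i.+1 A N, hrep y (v - chmap i.+1 A f u').
  apply: hrep_intro; rewrite -[LHS]/(tor_d i A N _) linearB -uv -chmap_d u'u.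
  by rewrite subrr.
exists y; apply: hrep_uniq zv.
by have := trep_chmap g yv; rewrite linearB chmap0 subr0.
Qed.
End TorExact.

Section TorConnNatural.
Variables (R : comNzRingType) (N' N N'' P' P P'' : lmodType R).
Variables (f : {linear N' -> N}) (g : {linear N -> N''}).
Variables (f1 : {linear P' -> P}) (g1 : {linear P -> P''}).
Variables (a : {linear N' -> P'}) (b : {linear N -> P}) (c : {linear N'' -> P''}).
Hypotheses (abf : forall x, b (f x) = f1 (a x)) (bcg : forall x, c (g x) = g1 (b x)).

Lemma tconn_nat i (A B : lmodType R) (h : {linear A -> B}) z w :
  tconn f g (i := i) z w ->
  tconn f1 g1 (tor_map h c i.+1 z) (tor_map h a i w).
Proof.
move=> [v [u [zv wu uv]]].
exists (tor_chain_map h b i.+1 v), (tor_chain_map h a i u); split.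
- rewrite [X in hrep _ X](_ : _ = tor_chain_map h c i.+1 (chmap i.+1 A g v)).
    exact: trep_map.
  by apply: tensor_map_comm => // x; rewrite bcg.
- exact: trep_map.
rewrite -tor_chain_map_d -uv.
by apply: tensor_map_comm => // x; rewrite abf.
Qed.
End TorConnNatural.

(** * Maps of resolutions up to homotopy *)

Section Approximation.
Variable R : comNzRingType.
Implicit Types A B N : lmodType R.

Lemma free_ind (K : choiceType) (S : submodClosed ({freeg K / R} : lmodType R)) :
  (forall k, << k >> \in S) -> forall x, x \in S.
Proof.
move=> H x; rewrite -qpi_eq0; apply/eqP.
have l0 : linear (fun _ : {freeg K / R} => 0 : quomod S).
  by move=> a u v; rewrite scaler0 addr0.
apply: (@free_ext _ _ _ (qpi S : {linear {freeg K / R} -> quomod S}) (mklin l0)) => k.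
by apply/eqP; rewrite [X in is_true X]qpi_eq0.
Qed.

Lemma res_dE n A (u : syz n.+1 A) : res_d n A << u >> = val u.
Proof. by rewrite -[LHS]/(val (aug (syz n.+1 A) << u >>)) augE. Qed.

Lemma res_d_lift n A c : aug (syz n A) c = 0 -> exists x, res_d n A x = c.
Proof.
move=> c0; have ck : c \in lker (aug (syz n A)) by apply/mksubP.
by exists << (Sub c ck : syz n.+1 A) >>; rewrite res_dE.
Qed.

Section Step.
Variables (A B : lmodType R) (phi : {linear A -> B}).

(* Only cycles are controlled, so that the induction on n can start: in degree
   0 the map e of approx0 takes cycles, but not all chains, into m^(k+s). *)
Definition cycle_approx n (D : submodClosed (res n B)) :=
  exists (e : {linear res n A -> res n B}) (h : {linear res n A -> res n.+1 B}),
  forall z, aug (syz n A) z = 0 ->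
    e z \in D /\ res_map n phi z = e z + res_d n B (h z).

(** After tensoring, the term in [h] vanishes on cycles and the term in [k] is a boundary, so [e],
    with values in [D], induces the same map on Tor as [phi]. *)
Definition approx n (D : submodClosed (res n.+1 B)) :=
  exists (e : {linear res n.+1 A -> res n.+1 B})
    (h : {linear res n A -> res n.+1 B}) (k : {linear res n.+1 A -> res n.+2 B}),
  forall x, e x \in D /\
    res_map n.+1 phi x = e x + h (res_d n A x) + res_d n.+1 B (k x).

Lemma approx_cycle n D : approx (n := n) D -> cycle_approx D.
Proof.
move=> [e [h [k Hx]]]; exists e, k => z z0; have [ez ->] := Hx z; split=> //.
rewrite [res_d n A z](_ : _ = 0) ?linear0 ?addr0 //.
exact: (congr1 (val : kermod (syz n A) -> res n A) z0).
Qed.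

(** On a cycle, e differs from a cycle by a boundary, hence is a cycle of [D] and lifts into [D'].
    This defines the new e on the basis of the next free module; the remaining error [w] is again a
    cycle, so it is the boundary of a basis element one degree higher, which defines k. *)
Lemma approx_step n D (D' : submodClosed (res n.+1 B)) : cycle_approx (n := n) D ->
  (forall c, c \in D -> aug (syz n B) c = 0 -> exists2 c', c' \in D' & res_d n B c' = c) ->
  approx D'.
Proof.
move=> [e [h He]] DD'.
have u0 (u : syz n.+1 A) : aug (syz n A) (val u) = 0 by have /mksubP := valP u.
have /choice[c Hc] u : exists c, c \in D' /\ res_d n B c = e (val (u : syz n.+1 A)).
  have [eu ru] := He _ (u0 u).
  have [|c' c'D cE] := DD' _ eu; last by exists c'.
  have -> : e (val u) = res_map n phi (val u) - res_d n B (h (val u)).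
    by rewrite ru addrK.
  by rewrite linearB res_d_ker subr0 [LHS]aug_map u0 linear0.
pose e' : {linear res n.+1 A -> res n.+1 B} := lift_free c.
have e'E u : e' << u >> = c u by apply: lift_freeE.
pose w (u : syz n.+1 A) := res_map n.+1 phi << u >> - c u - h (val u).
have w0 u : w u \in lker (aug (syz n.+1 B)).
  apply/mksubP; apply: val_inj.
  rewrite -[LHS]/(res_d n B (w u)) /w !linearB -res_map_d res_dE.
  have [_ ->] := He _ (u0 u); have [_ ->] := Hc u.
  by rewrite [_ + res_d _ _ _]addrC addrK subrr.
pose k : {linear res n.+1 A -> res n.+2 B} :=
  lift_free (fun u => << (Sub (w u) (w0 u) : syz n.+2 B) >>).
exists e', h, k => x; split.
  rewrite -mem_preim; apply: free_ind => u; rewrite mem_preim [X in X \in _]e'E.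
  by have [] := Hc u.
have l2 : linear (fun x => e' x + h (res_d n A x) + res_d n.+1 B (k x)).
  move=> a u v; rewrite !linearP !scalerDr [X in X + (_ *: res_d _ _ _ + _)]addrACA.
  by rewrite [LHS]addrACA.
apply: (@free_ext _ _ _ (res_map n.+1 phi) (mklin l2)) => u.
rewrite -[RHS]/(e' << u >> + h (res_d n A << u >>) + res_d n.+1 B (k << u >>)).
have -> : k << u >> = << (Sub (w u) (w0 u) : syz n.+2 B) >> by apply: lift_freeE.
by rewrite e'E !res_dE SubK /w -[X in _ + X]addrA -opprD addrC addNKr.
Qed.
End Step.
End Approximation.

Section Generators.
Variables (R : comNzRingType) (m : submodClosed R^o).
Hypothesis R_noetherian : noetherian_mod R^o.
Local Notation lspan b := (span (fun y => y \in b)).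

Lemma smul_pow_sub (V : lmodType R) n (S : submodClosed V) :
  {subset ideal_smul (fun a => a \in ideal_pow m n) S <= S}.
Proof. by apply: smul_sub => a x _; apply: rpredZ. Qed.

(** [b'] lifts generators of the module C of cycles in the span E of [b]. By Artin-Rees a cycle in
    m^j E lies in m^l C for suitable j, so it lifts into m^l times the span of [b']. *)
Lemma cycles_lift n (B : lmodType R) (b : seq (res n B)) :
  exists b' : seq (res n.+1 B),
  (forall c, c \in lspan b -> aug (syz n B) c = 0 ->
    exists2 c', c' \in lspan b' & res_d n B c' = c) /\
  forall l, exists j, forall c,
    c \in ideal_smul (fun a => a \in ideal_pow m j) (lspan b) ->
    aug (syz n B) c = 0 ->
    exists2 c', c' \in ideal_smul (fun a => a \in ideal_pow m l) (lspan b') &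
      res_d n B c' = c.
Proof.
have C0 : (0 : res n B) \in lspan b /\ aug (syz n B) 0 = 0.
  by split; [apply: rpred0 | apply: linear0].
have CD (a : R) (u v : res n B) : (u \in lspan b /\ aug (syz n B) u = 0) ->
    (v \in lspan b /\ aug (syz n B) v = 0) ->
    a *: u + v \in lspan b /\ aug (syz n B) (a *: u + v) = 0.
  move=> [ub u0] [vb v0]; split; last by rewrite linearP u0 v0 scaler0 addr0.
  by apply: rpredD => //; apply: rpredZ.
pose C := mksub (P := fun c => c \in lspan b /\ aug (syz n B) c = 0) C0 CD.
have Cb c : c \in C -> c \in lspan b by case/mksubP.
have nb := noeth_span (s := b) R_noetherian.
have [cs [csC Ccs]] := noeth_fg nb (L := C) (fun _ => @False_ind _) Cb.
have /choice[lft Hl] c : exists x, aug (syz n B) c = 0 -> res_d n B x = c.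
  case: (pselect (aug (syz n B) c = 0)) => [/res_d_lift[x xc]|]; first by exists x.
  by exists 0.
pose b' := [seq lft c | c <- cs].
have lift c : c \in C -> exists2 c', c' \in lspan b' & res_d n B c' = c.
  move/Ccs; have lin := linrel_graph (res_d n B).
  move=> cc; suff /(relimgP lin)[u ub ->] : c \in relimg lin (lspan b') by exists u.
  move: c cc; apply: span_sub => c [//|cc]; apply/relimgP; exists (lft c).
    by apply: mem_span; apply: map_f.
  by rewrite Hl //; have /mksubP[] := csC _ cc.
exists b'; split=> [c cb c0|l]; first by apply: lift; apply/mksubP.
have [j Hj] := artin_rees m R_noetherian (E := lspan b) (C := C) Cb nb l.
exists j => c cj c0.
have cC : c \in C by apply/mksubP; split=> //; apply: smul_pow_sub cj.
have lin := linrel_graph (res_d n B).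
set D' := ideal_smul _ (lspan b').
suff /(relimgP lin)[u ub ->] : c \in relimg lin D' by exists u.
have := Hj c cC cj; move: c {cj c0 cC}; apply: smul_sub => a x al /lift[x' x'b <-].
by apply/relimgP; exists (a *: x'); [apply: smul_mem | rewrite linearZ].
Qed.

Fixpoint quopow_maps k s : {linear quopow m (k + s) -> quopow m s} :=
  if k is k'.+1 return {linear quopow m (k + s) -> quopow m s}
  then quopow_maps k' s \o quopow_map m (k' + s) else idfun.

Lemma quopow_mapsE k s (a : R) :
  quopow_maps k s (qpi (ideal_pow m (k + s)) a) = qpi (ideal_pow m s) a.
Proof.
elim: k => [|k IH] //.
rewrite -[LHS]/(quopow_maps k s (quopow_map m (k + s) (qpi (ideal_pow m (k + s).+1) a))).
by rewrite -IH; congr (quopow_maps _ _ _); apply: quo_mapE.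
Qed.

Section Base.
Variables s k : nat.
Local Notation A := (quopow m (k + s)).
Local Notation B := (quopow m s).
Local Notation one := (<< (qpi (ideal_pow m s) 1 : B) >> : res 0 B).

(** [rho] adds up representatives in R, so a chain x and [rho x] times the generator 1 have the same
    image in R/m^s and differ by a boundary. If x is a cycle, [rho x] lies in m^(k+s). *)
Lemma approx0 : exists (e : {linear res 0 A -> res 0 B})
    (h : {linear res 0 A -> res 1 B}),
  [/\ forall x, e x \in lspan [:: one],
      forall x, res_map 0 (quopow_maps k s) x = e x + res_d 0 B (h x) &
      forall z, aug A z = 0 ->
        e z \in ideal_smul (fun a => a \in ideal_pow m (k + s)) (lspan [:: one])].
Proof.
pose rho : {linear res 0 A -> R^o} := lift_free (fun u : A => repr u : R^o).
have rhoE x : qpi (ideal_pow m (k + s)) (rho x) = aug A x.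
  have l1 : linear (fun x : res 0 A => qpi (ideal_pow m (k + s)) (rho x)).
    by move=> a u v; rewrite !linearP.
  apply: (@free_ext _ _ _ (mklin l1) (aug A)) => u.
  rewrite -[LHS]/(qpi (ideal_pow m (k + s)) (rho << u >>)) augE.
  by have -> : rho << u >> = repr u by [apply: lift_freeE]; apply: qpi_repr.
have le : linear (fun x : res 0 A => (rho x : R) *: one).
  by move=> a u v; rewrite linearP scalerDl -scalerA.
have one_in : one \in lspan [:: one] by apply: mem_span; rewrite mem_head.
pose w (u : A) : res 0 B := << quopow_maps k s u >> - (rho << u >> : R) *: one.
have w0 u : w u \in lker (aug B).
  have ur : qpi (ideal_pow m (k + s)) (rho << u >>) = u by rewrite rhoE augE.
  apply/mksubP; rewrite linearB linearZ !augE -[X in quopow_maps k s X]ur quopow_mapsE.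
  apply/eqP; rewrite subr_eq0; apply/eqP; rewrite -[RHS]linearZ; congr (qpi _ _).
  by rewrite [RHS]mulr1.
pose h : {linear res 0 A -> res 1 B} :=
  lift_free (fun u : A => << (Sub (w u) (w0 u) : syz 1 B) >>).
exists (mklin le), h; split=> [x|x|z z0].
- by apply: rpredZ.
- have l2 : linear (fun x => mklin le x + res_d 0 B (h x)).
    by move=> a u v; rewrite (linearP (mklin le)) (linearP h) (linearP (res_d 0 B)) scalerDr addrACA.
  apply: (@free_ext _ _ _ (res_map 0 (quopow_maps k s)) (mklin l2)) => u.
  rewrite -[RHS]/((rho << u >> : R) *: one + res_d 0 B (h << u >>)).
  have -> : h << u >> = << (Sub (w u) (w0 u) : syz 1 B) >> by apply: lift_freeE.
  by rewrite res_dE SubK /w addrC subrK free_mapE.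
apply: (@smul_mem _ (fun a => a \in ideal_pow m (k + s))) => //.
by rewrite -qpi_eq0 rhoE z0.
Qed.
End Base.

(** The finite list [b] is chosen before l: the clause for k = 0 makes Tor artinian, the other one
    makes transition maps vanish. The induction runs on [cycle_approx], and only the last step
    passes to [approx]. *)
Lemma approx_all s n : exists b : seq (res n.+1 (quopow m s)),
  approx (quopow_maps 0 s) (lspan b) /\
  forall l, exists k, approx (quopow_maps k s)
    (ideal_smul (fun a => a \in ideal_pow m l) (lspan b)).
Proof.
suff [b [Hb Hl]] : exists b : seq (res n (quopow m s)),
    cycle_approx (quopow_maps 0 s) (lspan b) /\
    forall l, exists k, cycle_approx (quopow_maps k s)
      (ideal_smul (fun a => a \in ideal_pow m l) (lspan b)).
  have [b' [Hb' Hl']] := cycles_lift b; exists b'; split.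
    exact: approx_step Hb Hb'.
  move=> l; have [j Hj] := Hl' l; have [k Hk] := Hl j; exists k.
  exact: approx_step Hk Hj.
elim: n => [|n [b [Hb Hl]]].
  exists [:: (<< (qpi (ideal_pow m s) 1 : quopow m s) >> : res 0 (quopow m s))].
  split.
    have [e [h [He Hh _]]] := approx0 s 0; exists e, h => z _; split=> //.
  move=> l; exists l; have [e [h [_ Hh He]]] := approx0 s l; exists e, h => z z0.
  split=> //; move: (e z) (He z z0) => c; apply: smul_sub => a x al.
  by apply: smul_mem; apply: ideal_pow_mono al; apply: leq_addr.
have [b' [Hb' Hl']] := cycles_lift b; exists b'; split.
  exact/approx_cycle/(approx_step Hb Hb').
move=> l; have [j Hj] := Hl' l; have [k Hk] := Hl j; exists k.
exact/approx_cycle/(approx_step Hk Hj).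
Qed.

End Generators.

(** * Tor with artinian coefficients *)

Section TorArtinian.
Variables (R : comNzRingType) (N : lmodType R).
Implicit Types A B C : lmodType R.

Definition tspan A (b : seq A) : submodClosed (tensor A N) :=
  span (fun y => exists c n, c \in b /\ y = tens c n).

Lemma tspan_cons A c (b : seq A) y : y \in tspan (c :: b) ->
  exists n, y - tens c n \in tspan b.
Proof.
have P0 : exists n, (0 : tensor A N) - tens c n \in tspan b.
  by exists 0; rewrite tens0r subrr rpred0.
have PD a (u v : tensor A N) : (exists n, u - tens c n \in tspan b) ->
    (exists n, v - tens c n \in tspan b) ->
    exists n, (a *: u + v) - tens c n \in tspan b.
  move=> [n un] [n' vn]; exists (a *: n + n').
  rewrite tens_addr tens_scaler opprD addrACA -scalerBr.
  by apply: rpredD => //; apply: rpredZ.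
move/(@span_sub _ _ _ (mksub P0 PD)) => H; apply/(mksubP P0 PD)/H => z [d [n [+ ->]]].
rewrite inE => /orP[/eqP->|db]; apply/(mksubP P0 PD).
  by exists n; rewrite subrr rpred0.
by exists 0; rewrite tens0r subr0; apply: mem_span; exists d, n.
Qed.

(** Induction on [b] as in [noeth_span], the coefficient of a generator now being an element of N,
    again determined only up to a relation. *)
Lemma tspan_artin A (b : seq A) : artinian_mod N -> artin_in (fun y => y \in tspan b).
Proof.
move=> /artinian_modE aN; elim: b => [|c b IH].
  move=> S _ SE; exists 0%N => k _ y /SE.
  suff H : {subset tspan (Nil A) <= span (fun y : tensor A N => y \in [::])}.
    by move=> /H/span_nil->; apply: rpred0.
  by apply: span_sub => z [d [n []]].
apply: (@artin_rel _ _ (fun y => y = 0) _ N (tensor A N)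
  (fun y n => y - tens c n \in tspan b) (fun y z => y \in tspan b /\ z = y)
  (fun=> True) (fun y => y \in tspan b)) => //.
- split=> [|a y z n n' yn zn]; first by rewrite tens0r subrr rpred0.
  rewrite tens_addr tens_scaler opprD addrACA -scalerBr.
  by apply: rpredD => //; apply: rpredZ.
- split=> [|a y y' z z' [yb ->] [zb ->]]; first by rewrite rpred0.
  by split=> //; apply: rpredD => //; apply: rpredZ.
- by move=> y /tspan_cons.
- by move=> y _; rewrite tens0r subr0; exists y.
- by move=> y z _ [yb ->].
- by move=> y _ [_ <-].
Qed.

Lemma tensor_map_tspan A B (e : {linear A -> B}) (b : seq B) :
  (forall x, e x \in span (fun y => y \in b)) ->
  forall y : tensor A N, tensor_map e idfun y \in tspan b.
Proof.
move=> eb y; rewrite -mem_preim; apply: tensor_ind => a n.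
rewrite mem_preim tensor_mapE; pose t := mklin (@tens_linearl R B N n).
rewrite -[X in X \in _]/(t (e a)) -mem_preim.
move: (e a) (eb a); apply: span_sub => c cb.
by rewrite mem_preim; apply: mem_span; exists c, n.
Qed.

(** Every class has a cycle in [tspan b], so a submodule of Tor is recovered from the cycles in
    [tspan b] that represent its elements. *)
Lemma tor_artinian_rep i A (b : seq (res i A)) : artinian_mod N ->
  (forall x : tor i A N, exists2 v, v \in tspan b & hrep x v) ->
  artinian_mod (tor i A N).
Proof.
move=> aN rep; apply/artinian_modE => S dec _.
have P0 n : (0 : tor_chain i A N) \in tspan b /\ exists2 x, x \in S n & hrep x 0.
  split; first exact: rpred0.
  exists 0; [exact: rpred0 | exact: hrep00].
have PD n (a : R) (u v : tor_chain i A N) :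
    (u \in tspan b /\ exists2 x : tor i A N, x \in S n & hrep x u) ->
    (v \in tspan b /\ exists2 x : tor i A N, x \in S n & hrep x v) ->
    a *: u + v \in tspan b /\ exists2 x : tor i A N, x \in S n & hrep x (a *: u + v).
  move=> [ub [x xS xu]] [vb [y yS yv]]; split.
    by apply: rpredD => //; apply: rpredZ.
  exists (a *: x + y); last exact: hrep_lin.
  by apply: rpredD => //; apply: rpredZ.
have [n|n v|n Hn] := tspan_artin (b := b) aN (S := fun n => mksub (P0 n) (PD n)).
- move=> v /(mksubP (P0 n.+1) (PD n.+1))[vb [x /dec xS xv]].
  by apply/(mksubP (P0 n) (PD n)); split=> //; exists x.
- by case/(mksubP (P0 n) (PD n)).
exists n => k nk x xS; have [v vb xv] := rep x.
have /Hn/(mksubP (P0 k) (PD k))[//|_ [y yS yv]] : v \in mksub (P0 n) (PD n).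
  by apply/mksubP; split=> //; exists x.
by rewrite (hrep_uniq xv yv).
Qed.

Lemma approx_tensor n A B (phi : {linear A -> B})
    (e : {linear res n.+1 A -> res n.+1 B}) (h : {linear res n A -> res n.+1 B})
    (k : {linear res n.+1 A -> res n.+2 B}) :
  (forall x, res_map n.+1 phi x = e x + h (res_d n A x) + res_d n.+1 B (k x)) ->
  forall y : tor_chain n.+1 A N, tor_d n A N y = 0 ->
  tor_chain_map phi idfun n.+1 y = tensor_map e idfun y +
    tor_d n.+1 B N (tensor_map k idfun y).
Proof.
move=> Hx y y0.
have l2 : linear (fun y : tor_chain n.+1 A N => tensor_map e (idfun : {linear N -> N}) y +
    tensor_map h (idfun : {linear N -> N}) (tor_d n A N y) +
    tor_d n.+1 B N (tensor_map k idfun y)).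
  move=> a u v; rewrite !linearP !scalerDr [X in X + (_ *: tor_d _ _ _ _ + _)]addrACA.
  by rewrite [LHS]addrACA.
transitivity (mklin l2 y); last first.
  rewrite -[LHS]/(tensor_map e idfun y + tensor_map h idfun (tor_d n A N y) + _).
  by rewrite y0 linear0 addr0.
apply: (@tensor_ext _ _ _ _ (tor_chain_map phi idfun n.+1) (mklin l2)) => u x.
rewrite -[RHS]/(tensor_map e idfun (tens u x) + tensor_map h idfun (tor_d n A N (tens u x)) +
  tor_d n.+1 B N (tensor_map k idfun (tens u x))).
by rewrite !tensor_mapE Hx !tens_addl.
Qed.

Section Powers.
Variable m : submodClosed R^o.
Hypothesis R_noetherian : noetherian_mod R^o.

Lemma tor_chain_map_idid i A (y : tor_chain i A N) :
  tor_chain_map (idfun : {linear A -> A}) idfun i y = y.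
Proof. by rewrite tor_chain_map_id // [LHS]tensor_map_id. Qed.

Lemma tor_artinian i s : artinian_mod N -> artinian_mod (tor i (quopow m s) N).
Proof.
move=> aN; case: i => [|n].
  (* [approx] begins in degree 1. In degree 0 the identity equals e plus a boundary on all chains,
     by [approx0] with k = 0. *)
  have [e [h [eb Hx _]]] := approx0 m s 0.
  apply: (tor_artinian_rep aN) => x; have [v xv] := hrep_ex x.
  exists (tensor_map e idfun v); first exact: tensor_map_tspan eb v.
  have l2 : linear (fun y : tor_chain 0 (quopow m s) N =>
      tensor_map e (idfun : {linear N -> N}) y + tor_d 0 _ N (tensor_map h idfun y)).
    by move=> a u w; rewrite !linearP !scalerDr [LHS]addrACA.
  have E : v = tensor_map e idfun v + tor_d 0 _ N (tensor_map h idfun v).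
    rewrite -{1}[v]tor_chain_map_idid.
    apply: (@tensor_ext _ _ _ _ (tor_chain_map idfun idfun 0) (mklin l2)) => u y.
    rewrite -[RHS]/(tensor_map e idfun (tens u y) +
      tor_d 0 _ N (tensor_map h idfun (tens u y))).
    by rewrite !tensor_mapE Hx tens_addl.
  have -> : tensor_map e idfun v = v + tor_d 0 _ N (- tensor_map h idfun v).
    by rewrite [X in X + _]E linearN addrK.
  exact: hrep_add.
have [b [[e [h [k Hx]]] _]] := approx_all m R_noetherian s n.
apply: (@tor_artinian_rep n.+1 _ b aN) => x; have [v xv] := hrep_ex x.
exists (tensor_map e idfun v); first by apply: tensor_map_tspan => y; case: (Hx y).
have E := approx_tensor (fun x => (Hx x).2) (hrep_cycle xv).
have -> : tensor_map e idfun v = v + tor_d n.+1 _ N (- tensor_map k idfun v).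
  by rewrite -{2}[v]tor_chain_map_idid [X in X + _]E linearN addrK.
by apply: hrep_add => //; apply: tor_out_d.
Qed.

(** With l = 1 the approximating map takes values in m times a module, and these values die when
    tensored with N, which m kills. *)
Lemma tor_vanish n s : (forall a (x : N), a \in m -> a *: x = 0) ->
  exists k, forall x : tor n.+1 (quopow m (k + s)) N,
  tor_map (quopow_maps m k s) idfun n.+1 x = 0.
Proof.
move=> mN; have [b [_ /(_ 1%N)[k [e [h [l Hx]]]]]] := approx_all m R_noetherian s n.
exists k => x; have [v xv] := hrep_ex x.
apply: (hrep_bound (trep_map _ _ xv)).
rewrite (approx_tensor (fun x => (Hx x).2) (hrep_cycle xv)).
exists (tensor_map l idfun v); rewrite [X in X + _](_ : _ = 0) ?add0r //.
have l0 : linear (fun _ : tor_chain n.+1 (quopow m (k + s)) N =>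
    0 : tor_chain n.+1 (quopow m s) N).
  by move=> a u w; rewrite scaler0 addr0.
apply: (@tensor_ext _ _ _ _ (tensor_map e idfun) (mklin l0)) => u y.
rewrite tensor_mapE; pose t := mklin (@tens_linearl R (res n.+1 (quopow m s)) N y).
rewrite -[LHS]/(t (e u)); have [+ _] := Hx u.
suff H : {subset ideal_smul (fun a => a \in ideal_pow m 1) (span (fun y => y \in b)) <= lker t}.
  by move/H/mksubP.
apply: smul_sub => a c a1 _; apply/mksubP.
rewrite -[LHS]/(tens (a *: c) y) tens_scalel -tens_scaler mN ?tens0r //.
move: a a1; apply: smul_sub => a r am _.
by rewrite [_ *: _]mulrC; apply: ideal_mulr.
Qed.
End Powers.
End TorArtinian.

(** * Inverse limits of artinian modules *)

Section MittagLeffler.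
Variables (R : pzRingType) (X : nat -> lmodType R).
Variables (p : forall s, {linear X s.+1 -> X s}) (E : forall s, X s -> Prop).
Hypothesis X_artinian : forall s, artinian_mod (X s).
Hypothesis E_affine : forall s a (x y z : X s), E x -> E y -> E z -> E (x + a *: (y - z)).
Hypothesis E_inh : forall s, exists x : X s, E x.
Hypothesis E_map : forall s (x : X s.+1), E x -> E (p s x).

(** The image in X s of the set E at level s + k. *)
Fixpoint image_after k s (x : X s) : Prop :=
  if k is k'.+1 then exists2 x', image_after k' x' & p s x' = x else E x.

Lemma image_after_decr k s (x : X s) : image_after k.+1 x -> image_after k x.
Proof.
elim: k s x => [|k IH] s x; first by case=> x' /E_map Ex <-.
by case=> x' /IH kx <-; exists x'.
Qed.

Lemma image_after_affine k s a (x y z : X s) :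
  image_after k x -> image_after k y -> image_after k z -> image_after k (x + a *: (y - z)).
Proof.
elim: k s x y z => [|k IH] s x y z; first exact: E_affine.
move=> [x' Ex <-] [y' Ey <-] [z' Ez <-]; exists (x' + a *: (y' - z')); first exact: IH.
by rewrite linearD linearZ linearB.
Qed.

Lemma image_after_inh k s : exists x : X s, image_after k x.
Proof.
elim: k s => [|k IH] s; first exact: E_inh.
by have [x kx] := IH s.+1; exists (p s x), x.
Qed.

(** The differences of elements of [image_after k] form decreasing submodules of an artinian module.
    Two nested nonempty affine sets with the same differences are equal. *)
Lemma image_after_stable s : exists n, forall k (x : X s), image_after n x -> image_after k x.
Proof.
have P0 k : exists x y : X s, [/\ image_after k x, image_after k y & 0 = x - y].
  by have [x kx] := image_after_inh k s; exists x, x; rewrite subrr.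
have PD k (a : R) (u v : X s) :
    (exists x y : X s, [/\ image_after k x, image_after k y & u = x - y]) ->
    (exists x y : X s, [/\ image_after k x, image_after k y & v = x - y]) ->
    exists x y : X s, [/\ image_after k x, image_after k y & a *: u + v = x - y].
  move=> [x [y [kx ky ->]]] [x' [y' [kx' ky' ->]]].
  exists (x' + a *: (x - y)), y'; split=> //; first exact: image_after_affine.
  by rewrite addrC addrAC.
have [k v|//|n Hn] := (artinian_modE _).1 (@X_artinian s) (fun k => mksub (P0 k) (PD k)).
  move=> /mksubP[x [y [kx ky ->]]]; apply/mksubP.
  by exists x, y; split=> //; apply: image_after_decr.
have decr k l (x : X s) : (k <= l)%N -> image_after l x -> image_after k x.
  move=> kl; rewrite -(subnK kl); elim: (l - k)%N => [|d IH] //.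
  by rewrite addSn => /image_after_decr.
exists n => k x nx; apply: (decr _ (maxn n k)); first exact: leq_maxr.
have [z kz] := image_after_inh (maxn n k) s.
have nz : image_after n z by apply: decr kz; apply: leq_maxl.
have /(Hn _ (leq_maxl n k))/mksubP[x' [y' [kx' ky' xz]]] : x - z \in mksub (P0 n) (PD n).
  by apply/mksubP; exists x, z.
rewrite -(subrK z x) xz addrC -[x' - y']scale1r.
exact: image_after_affine.
Qed.

Lemma artinian_coset_lim : exists x : dprod X,
  (forall s, p s (x s.+1) = x s) /\ forall s, E (x s).
Proof.
pose stable s (x : X s) := forall k, image_after k x.
have [x0 Hx0] : exists x : X 0%N, stable 0%N x.
  have [n Hn] := image_after_stable 0; have [x nx] := image_after_inh n 0.
  by exists x => k; apply: Hn.
have lift s (x : X s) : stable s x -> exists x', stable s.+1 x' /\ p s x' = x.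
  move=> sx; have [n Hn] := image_after_stable s.+1.
  (* Surviving n+1 steps at level s gives a preimage that survives n steps at level s+1, where n
     already means stable. *)
  have [x' nx <-] := sx n.+1; exists x'; split=> // k; exact: Hn.
pose next s (x : {x : X s | stable s x}) : {x : X s.+1 | stable s.+1 x} :=
  let: exist x sx := x in
  let: exist x' H := cid (lift s x sx) in exist _ x' H.1.
have nextP s x : p s (sval (next s x)) = sval x.
  by case: x => x sx /=; case: cid => x' [].
pose f := fix f s : {x : X s | stable s x} :=
  if s is s'.+1 then next s' (f s') else exist _ x0 Hx0.
exists (fun s => sval (f s)); split=> s; first exact: nextP.
exact: (svalP (f s) 0%N).
Qed.
End MittagLeffler.

(** * Local homology *)

Section LocalHomology.
Variables (R : comNzRingType) (m : submodClosed R^o).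
Implicit Types N P : lmodType R.
Local Notation H i N := (local_homology m i N).
Local Notation Rhat := (completion m).
Local Notation tmap i s h :=
  (tor_map (idfun : {linear quopow m s -> quopow m s}) h i).
Local Notation tdown i s N :=
  (tor_map (quopow_map m s) (idfun : {linear N -> N}) i).

Lemma lh_coh i N (z : H i N) s : tdown i s N (val z s.+1) = val z s.
Proof. exact: (invlimP z s). Qed.

Lemma lh_intro i N (x : dprod (fun s => tor i (quopow m s) N)) :
  (forall s, tdown i s N (x s.+1) = x s) ->
  exists z : H i N, forall s, val z s = x s.
Proof.
move=> cx; have xc : x \in coherent (fun s => tdown i s N) by apply/mksubP.
by exists (Sub x xc : invlim _) => s; rewrite SubK.
Qed.

Lemma lh_ext i N (z w : H i N) : (forall s, val z s = val w s) -> z = w.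
Proof. exact: adic_ext. Qed.

Lemma lh_mapE i N P (f : {linear N -> P}) (z : H i N) s :
  val (local_homology_map m i f z) s = tmap i s f (val z s).
Proof. by []. Qed.

Lemma lh_linE i N (r : Rhat) (z w : H i N) s :
  val (r *: z + w) s = (repr (completion_coord r s) : R) *: val z s + val w s.
Proof. by []. Qed.

Lemma lh_map_comp i N P (Q : lmodType R) (f : {linear N -> P}) (g : {linear P -> Q})
    (h : {linear N -> Q}) : (forall x, h x = g (f x)) ->
  forall z, local_homology_map m i h z =
    local_homology_map m i g (local_homology_map m i f z).
Proof.
by move=> hE z; apply: lh_ext => s; rewrite !lh_mapE; apply: tor_map_comp.
Qed.

Lemma lh_map_scale i N (a : R) (h : {linear N -> N}) : (forall x, h x = a *: x) ->
  forall z, local_homology_map m i h z = completion_in m a *: z.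
Proof.
move=> hE z; apply: lh_ext => s; rewrite lh_mapE (tor_map_scale hE).
by rewrite [in RHS]local_homology_scaleE.
Qed.

Lemma lh_coh_down i N (z : H i N) k s :
  tor_map (quopow_maps m k s) (idfun : {linear N -> N}) i (val z (k + s)%N) = val z s.
Proof.
elim: k => [|k IH]; first by rewrite (tor_map_scale (a := 1)) ?scale1r // => x; rewrite scale1r.
rewrite -[RHS]IH -[in RHS]lh_coh; exact: tor_map_comp.
Qed.

(** The level s of the limit is killed by m^s, in particular by a^s. *)
Lemma lh_separated i N (a : R) (z : H i N) : a \in m ->
  (forall n, exists w, z = (completion_in m a) ^+ n *: w) -> z = 0.
Proof.
move=> am Hz; apply: lh_ext => s; have [w ->] := Hz s.
rewrite completion_in_exp local_homology_scaleE.
rewrite -[LHS]/(a ^+ s *: val w s); apply: tor_killed; exact: ideal_pow_exp.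
Qed.

Section Exact.
Hypothesis R_noetherian : noetherian_mod R^o.
Variables (N' N N'' : lmodType R).
Variables (f : {linear N' -> N}) (g : {linear N -> N''}).
Hypotheses (finj : injective f) (gsurj : forall y, exists x, g x = y).
Hypotheses (gf0 : forall x, g (f x) = 0).
Hypothesis fg : forall y, g y = 0 -> exists x, f x = y.

(* The fibres of the level-wise maps are cosets in artinian modules. *)
Lemma lh_lift i P (Q : lmodType R) (k : {linear P -> Q}) (z : H i Q) :
  artinian_mod P -> (forall s, exists y, tmap i s k y = val z s) ->
  exists y : H i P, local_homology_map m i k y = z.
Proof.
move=> aP Hz.
have [||||x [cx xE]] := @artinian_coset_lim R (fun s => tor i (quopow m s) P)
  (fun s => tdown i s P) (fun s y => tmap i s k y = val z s).
- by move=> s; apply: tor_artinian.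
- by move=> s a x y y' xE yE yE'; rewrite linearD linearZZ linearB xE yE yE' subrr scaler0 addr0.
- exact: Hz.
- move=> s x xE; rewrite -lh_coh -xE; apply: esym; exact: tor_map_comm.
have [y yE] := lh_intro cx; exists y; apply: lh_ext => s.
by rewrite lh_mapE yE xE.
Qed.

Lemma lh_exact_mid i (z : H i N) : artinian_mod N' ->
  local_homology_map m i g z = 0 -> exists y, local_homology_map m i f y = z.
Proof.
move=> aN' gz; apply: lh_lift => // s; apply: (tor_exact_mid finj gsurj fg).
by rewrite -lh_mapE gz.
Qed.

Lemma lh0_surj (z : H 0 N'') : artinian_mod N ->
  exists y, local_homology_map m 0 g y = z.
Proof. by move=> aN; apply: lh_lift => // s; apply: tor0_surj. Qed.

Definition conn i (z : H i.+1 N'') (w : H i N') :=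
  forall s, tconn f g (val z s) (val w s).

(** At each level the connecting value is unique, so naturality alone makes these values
    coherent. *)
Lemma conn_total i (z : H i.+1 N'') : exists w, conn z w.
Proof.
pose w s := sval (cid (tconn_total finj gsurj fg (val z s))).
have wP s : tconn f g (val z s) (w s) by rewrite /w; case: cid.
have [s|w' w'E] := @lh_intro i N' w; last by exists w' => s; rewrite w'E.
apply: (tconn_uniq finj gsurj fg _ (wP s)); rewrite -(lh_coh z s).
by apply: (tconn_nat (a := idfun) (b := idfun) (c := idfun)) (wP s.+1).
Qed.

Lemma conn_lin i r (z z' : H i.+1 N'') (w w' : H i N') : conn z w -> conn z' w' ->
  conn (r *: z + z') (r *: w + w').
Proof.
by move=> zw zw' s; rewrite !lh_linE; apply: tconn_lin.
Qed.

Lemma conn_exact i (z : H i.+1 N'') : artinian_mod N ->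
  conn z 0 -> exists y, local_homology_map m i.+1 g y = z.
Proof.
by move=> aN z0; apply: lh_lift => // s; apply: (tconn_exact gf0); apply: z0.
Qed.

End Exact.

(* H_(i-1), with H_(-1) = 0. *)
Fixpoint prev_homology i N : lmodType Rhat :=
  if i is j.+1 then H j N else quomod (fullmod Rhat^o).

(** In degree 0 the target is the zero module, and the relation that always holds is the graph of
    the zero map. *)
Definition prev_conn N' N N'' (f : {linear N' -> N}) (g : {linear N -> N''}) i :
    H i N'' -> prev_homology i N' -> Prop :=
  match i with
  | 0 => fun _ _ => True
  | j.+1 => fun z w => conn f g z w
  end.

Lemma prev_conn_lin N' N N'' (f : {linear N' -> N}) (g : {linear N -> N''}) i
    r (z z' : H i N'') w w' : prev_conn f g z w -> prev_conn f g z' w' ->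
  prev_conn f g (r *: z + z') (r *: w + w').
Proof. by case: i z z' w w' => [//|i] z z' w w'; apply: conn_lin. Qed.

Lemma prev_conn_nat N' N N'' P P'' (f : {linear N' -> N}) (g : {linear N -> N''})
    (f1 : {linear N' -> P}) (g1 : {linear P -> P''})
    (b : {linear N -> P}) (c : {linear N'' -> P''}) i (z : H i N'') w :
  (forall x, b (f x) = f1 x) -> (forall x, c (g x) = g1 (b x)) ->
  prev_conn f g z w -> prev_conn f1 g1 (local_homology_map m i c z) w.
Proof.
move=> bf cg; case: i z w => [//|i] z w zw s.
have := tconn_nat (a := idfun) bf cg idfun (zw s).
by rewrite [X in tconn f1 g1 _ X](tor_map_scale (a := 1)) ?scale1r // => x; rewrite scale1r.
Qed.

Section PrevExact.
Hypothesis R_noetherian : noetherian_mod R^o.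
Variables (N' N N'' : lmodType R).
Variables (f : {linear N' -> N}) (g : {linear N -> N''}).
Hypotheses (finj : injective f) (gsurj : forall y, exists x, g x = y).
Hypotheses (gf0 : forall x, g (f x) = 0).
Hypothesis fg : forall y, g y = 0 -> exists x, f x = y.

Lemma prev_conn_total i (z : H i N'') : exists w, prev_conn f g z w.
Proof.
by case: i z => [|i] z; [exists 0 | apply: (conn_total finj gsurj fg)].
Qed.

Lemma prev_conn_exact i (z : H i N'') : artinian_mod N ->
  prev_conn f g z 0 -> exists y, local_homology_map m i g y = z.
Proof.
case: i z => [|i] z aN; first by move=> _; apply: lh0_surj.
exact: (conn_exact R_noetherian gf0).
Qed.
End PrevExact.
End LocalHomology.

(** * Noetherianity of local homology *)

Section LocalHomologyNoetherian.
Variables (R : comNzRingType) (m : submodClosed R^o).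
Hypotheses (R_noetherian : noetherian_mod R^o) (m_maximal : maximal_ideal m).
Implicit Types N P : lmodType R.
Local Notation H i N := (local_homology m i N).
Local Notation Rhat := (completion m).
Local Notation hmap := (local_homology_map m).

Section Generator.
Variables (s : nat) (N : lmodType R).
Local Notation one := (<< (qpi (ideal_pow m s) 1 : quopow m s) >> : res 0 (quopow m s)).

(** R/m^s is cyclic, so Tor_0 is a quotient of N: [approx0] with k = 0 moves any chain to a multiple
    of the generator. *)
Lemma tor0_gen (x : tor 0 (quopow m s) N) : exists n, hrep x (tens one n).
Proof.
have P0 : exists n u, (0 : tor_chain 0 (quopow m s) N) = tens one n + tor_d 0 _ N u.
  by exists 0, 0; rewrite tens0r linear0 addr0.
have PD (a : R) (u v : tor_chain 0 (quopow m s) N) :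
    (exists n w, u = tens one n + tor_d 0 _ N w) ->
    (exists n w, v = tens one n + tor_d 0 _ N w) ->
    exists n w, a *: u + v = tens one n + tor_d 0 _ N w.
  move=> [n [w ->]] [n' [w' ->]]; exists (a *: n + n'), (a *: w + w').
  by rewrite linearP tens_addr tens_scaler scalerDr addrACA.
have [v xv] := hrep_ex x.
have /(mksubP P0 PD)[n [u vE]] : v \in mksub P0 PD.
  apply: tensor_ind => y n; apply/(mksubP P0 PD).
  have [e [h [eb Hx _]]] := approx0 m s 0.
  have [r] := span_cons (eb y); move=> /span_nil/eqP; rewrite subr_eq0 => /eqP ey.
  exists (r *: n), (tens (h y) n).
  rewrite tens_scaler -tens_scalel [tor_d _ _ _ _]tensor_mapE -tens_addl.
  congr (tens _ n); rewrite -ey; apply: etrans (Hx y).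
  by rewrite [RHS]free_map_id.
exists n; have -> : tens one n = v + tor_d 0 _ N (- u) by rewrite vE linearN addrK.
exact: hrep_add.
Qed.
End Generator.

(** N maps onto H_0(N): the elements of N representing the levels of z form decreasing cosets in an
    artinian module, a system with identity transition maps. *)
Lemma lh0_gen N (z : H 0 N) : artinian_mod N -> exists n : N, forall s,
  hrep (val z s) (tens (<< (qpi (ideal_pow m s) 1 : quopow m s) >> : res 0 (quopow m s)) n).
Proof.
move=> aN.
have [s|s a x y y' xE yE yE'|s|s n Hn|n [cn nE]] := @artinian_coset_lim R (fun=> N) (fun=> idfun)
  (fun s n => hrep (val z s) (tens (<< (qpi (ideal_pow m s) 1 : quopow m s) >> : res 0 (quopow m s)) n)).
- exact: aN.
- have := hrep_lin a (hrepB yE yE') xE.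
  rewrite subrr scaler0 add0r; congr (hrep _ _).
  rewrite addrC tens_addr tens_scaler; congr (_ + _ *: _).
  by rewrite tens_addr -[in RHS]scaleN1r tens_scaler scaleN1r.
- exact: tor0_gen.
- rewrite -(lh_coh z s) (_ : tens _ _ = tor_chain_map (quopow_map m s) idfun 0
    (tens (<< (qpi (ideal_pow m s.+1) 1 : quopow m s.+1) >> : res 0 (quopow m s.+1)) n)).
    exact: trep_map.
  rewrite [RHS]tensor_mapE; congr (tens _ _); rewrite [RHS]free_mapE.
  by congr << _ >>; rewrite [RHS]quo_mapE.
exists (n 0%N) => s; have -> : n 0%N = n s by elim: s => // s ->; rewrite -{1}cn.
exact: nE.
Qed.

(** In positive degree, level s of z is the image of level l + s under a zero map. In degree 0, a
    chain of submodules is pulled back along the surjection of N onto H_0(N). *)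
Lemma lh_noetherian_killed i N : artinian_mod N ->
  (forall a (x : N), a \in m -> a *: x = 0) -> noetherian_mod (H i N).
Proof.
move=> aN mN; case: i => [|n]; last first.
  move=> S _; exists 0%N => k _ z; suff -> : z = 0 by rewrite !rpred0.
  apply: lh_ext => s; have [l Hl] := tor_vanish R_noetherian n s mN.
  by rewrite -(lh_coh_down z l s) Hl.
pose one s := << (qpi (ideal_pow m s) 1 : quopow m s) >> : res 0 (quopow m s).
have /noetherian_modE nN := killed_artin_noetherian m_maximal mN aN.
apply/noetherian_modE => S inc _ _.
have P0 j : exists2 z : H 0 N, z \in S j & forall s, hrep (val z s) (tens (one s) 0).
  exists 0; first exact: rpred0.
  move=> s; rewrite tens0r; exact: hrep00.
have PD j (a : R) (u v : N) :
    (exists2 z : H 0 N, z \in S j & forall s, hrep (val z s) (tens (one s) u)) ->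
    (exists2 z : H 0 N, z \in S j & forall s, hrep (val z s) (tens (one s) v)) ->
    exists2 z : H 0 N, z \in S j & forall s, hrep (val z s) (tens (one s) (a *: u + v)).
  move=> [z zS zu] [w wS wv]; exists (completion_in m a *: z + w).
    by apply: rpredD => //; apply: rpredZ.
  move=> s; rewrite tens_addr tens_scaler.
  have -> : val (completion_in m a *: z + w) s = a *: val z s + val w s.
    rewrite -[LHS]/(val (completion_in m a *: z) s + val w s).
    by rewrite local_homology_scaleE.
  exact: hrep_lin.
have [j|//|//|j Hj] := nN (fun j => mksub (P0 j) (PD j)).
  move=> n /(mksubP (P0 j) (PD j))[z /inc zS zn].
  by apply/(mksubP (P0 j.+1) (PD j.+1)); exists z.
exists j => k jk z zS; have [n zn] := lh0_gen z aN.
have /(Hj _ jk)/(mksubP (P0 j) (PD j))[w wS wn] : n \in mksub (P0 k) (PD k).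
  by apply/(mksubP (P0 k) (PD k)); exists z.
have -> // : z = w.
by apply: lh_ext => s; apply: hrep_uniq (zn s) (wn s).
Qed.

Section Multiplication.
Variables (N : lmodType R) (a : R).
Fact mulmap_subproof : linear (fun x : N => a *: x).
Proof. by move=> b u v; rewrite scalerDr !scalerA mulrC. Qed.
Definition mulmap : {linear N -> N} := mklin mulmap_subproof.
End Multiplication.

Section Subobjects.
Variable N : lmodType R.

Definition sub_val (S : submodClosed N) : {linear submod_of S -> N} :=
  mklin (f := val : submod_of S -> N) (fun a u v => linearP val a u v).

Section Corestrict.
Variables (P : lmodType R) (f : {linear P -> N}) (S : submodClosed N).
Hypothesis fS : forall x, f x \in S.
Fact corestrict_subproof : linear (fun x => Sub (f x) (fS x) : submod_of S).
Proof. by move=> a u v; apply: val_inj; rewrite /= linearP. Qed.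
Definition corestrict : {linear P -> submod_of S} := mklin corestrict_subproof.
End Corestrict.
End Subobjects.

(** Multiplication by a is factored as [iota] after [g], through its image, with kernel [f]. What
    H_i(pr) kills comes from H_i(aN), and a class there with zero connecting value comes from
    H_i(N), so that its image under H_i(iota) is a multiple of a. *)
Lemma lh_noetherian_quo i N a : a \in m -> artinian_mod N ->
  (forall P, artinian_mod P -> noetherian_mod (prev_homology m i P)) ->
  noetherian_mod (H i (quomod (limg (mulmap N a)))) -> noetherian_mod (H i N).
Proof.
move=> am aN nprev nquo.
set mu := mulmap N a in nquo *.
have muL x : mu x \in limg mu by apply/mksubP; exists x.
pose f := sub_val (lker mu); pose g := corestrict muL.
pose iota := sub_val (limg mu); pose pr : {linear N -> _} := qpi (limg mu).
have gsurj y : exists x, g x = y.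
  by have /mksubP[x xy] := valP y; exists x; apply: val_inj.
have finj : injective f by move=> x y; apply: val_inj.
have iinj : injective iota by move=> x y; apply: val_inj.
have gf0 x : g (f x) = 0.
  by apply: val_inj; have /mksubP := valP x.
have fg y : g y = 0 -> exists x, f x = y.
  move=> gy; have yk : y \in lker mu by apply/mksubP; apply: (congr1 val gy).
  by exists (Sub y yk).
have prsurj y : exists x, pr x = y by exists (repr y); apply: qpi_repr.
have ip y : pr y = 0 -> exists x, iota x = y.
  move=> /eqP; rewrite qpi_eq0 => yl; by exists (Sub y yl).
apply: (@adic_noetherian _ _ (completion_in m a)).
- exact: completion_series.
- by move=> v; apply: lh_separated.
pose r1 := fun (v : H i N) w => w = hmap i pr v.
pose r2 := fun (v : H i N) w => exists2 z, v = hmap i iota z & prev_conn f g z w.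
apply: (@noeth_rel _ _ _ _ (H i (quomod (limg mu))) (prev_homology m i (submod_of (lker mu)))
  r1 r2 (fun=> True) (fun=> True)) => //.
- exact: linrel_graph.
- split=> [|c v v' w w' [z -> zw] [z' -> zw']].
    exists 0; first by rewrite linear0.
    (* Totality gives some w related to 0; linearity applied to -1 times this pair plus itself gives
       the pair (0, 0). *)
    have [w zw] := prev_conn_total (i := i) finj gsurj fg (0 : H i (submod_of (limg mu))).
    have := prev_conn_lin (-1) zw zw; by rewrite !scaleN1r !addNr.
  by exists (c *: z + z'); [rewrite linearP | apply: prev_conn_lin].
- by move=> v _; exists (hmap i pr v).
- move=> v _ /esym /(lh_exact_mid R_noetherian iinj prsurj ip (artinian_sub aN))[z <-].
  by have [w zw] := prev_conn_total finj gsurj fg z; exists w, z.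
- move=> v _ [z -> /(prev_conn_exact R_noetherian gsurj gf0 aN)[y <-]].
  exists y; rewrite -(lh_map_scale (h := mu)) //; apply: esym; exact: lh_map_comp.
- exact/noetherian_modE.
- exact/noetherian_modE/nprev/artinian_sub.
Qed.

Section Annihilator.
Variable N : lmodType R.
Fact annihilator_subproof : (forall x : N, (0 : R) *: x = 0) /\
  forall b (u v : R^o), (forall x : N, (u : R) *: x = 0) -> (forall x : N, (v : R) *: x = 0) ->
  forall x : N, ((b *: u + v) : R) *: x = 0.
Proof.
split=> [x|b u v uN vN x]; first exact: scale0r.
by rewrite scalerDl -scalerA uN vN scaler0 addr0.
Qed.
Definition annihilator : submodClosed R^o :=
  mksub (P := fun u : R^o => forall x : N, (u : R) *: x = 0)
    annihilator_subproof.1 annihilator_subproof.2.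
End Annihilator.

Lemma lh_noetherian_step i :
  (forall P, artinian_mod P -> noetherian_mod (prev_homology m i P)) ->
  forall N, artinian_mod N -> noetherian_mod (H i N).
Proof.
move=> nprev N.
have [s [sm ms]] := noeth_fg ((noetherian_modE _).1 R_noetherian) (L := m)
  (fun _ => @False_ind _) (fun _ _ => I).
(* The induction invariant is that m lies in the annihilator of N plus the ideal of [s]. Passing to
   N/aN puts a into the annihilator, so a can be removed from the list; for the empty list m kills
   N. *)
have {ms} : forall T : submodClosed R^o, {subset annihilator N <= T} ->
    {subset s <= T} -> {subset m <= T}.
  by move=> T _ sT x /ms; apply: span_sub => y [//|]; apply: sT.
elim: s N sm => [|a s IHs] N sm mT aN.
  apply: lh_noetherian_killed => // a x am.
  by have /mksubP := mT (annihilator N) (fun _ => id) (fun _ => ltac:(by [])) a am.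
apply: (@lh_noetherian_quo _ _ a) => //; first by apply: sm; rewrite mem_head.
apply: IHs => [b bs|T NT sT|].
- by apply: sm; rewrite inE bs orbT.
- apply: mT => [b /mksubP bN|b].
    apply: NT; apply/mksubP => x; rewrite -(qpi_repr x) -linearZ bN.
    exact: linear0.
  rewrite inE => /orP[/eqP->|]; last exact: sT.
  apply: NT; apply/mksubP => x; rewrite -(qpi_repr x) -linearZ.
  by apply/eqP; rewrite qpi_eq0; apply/mksubP; exists (repr x).
exact: artinian_quo.
Qed.

Lemma prev_noetherian i N : artinian_mod N -> noetherian_mod (prev_homology m i N).
Proof.
elim: i N => [|i IHi] N aN; last exact: lh_noetherian_step.
by apply: noetherian_zero => x; apply/mksubP.
Qed.

Lemma lh_noetherian i N : artinian_mod N -> noetherian_mod (H i N).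
Proof. exact: (@prev_noetherian i.+1). Qed.

End LocalHomologyNoetherian.

(** * Formal local homology *)

Section DirectLimitClasses.
Variables (R : pzRingType) (X : nat -> lmodType R) (q : forall t, {linear X t -> X t.+1}).

Definition dl_class t (x : X t) : dirlim q := qpi _ (dsum_inj x).

Lemma dl_class_step t (x : X t) : dl_class x = dl_class (q t x).
Proof.
apply/eqP; rewrite -subr_eq0 -linearB qpi_eq0; apply: mem_span.
by exists t, x.
Qed.

Lemma dsum_inj_linear t : linear (@dsum_inj R X t).
Proof.
move=> a x y; apply: val_inj; apply: functional_extensionality_dep => s.
rewrite -[RHS]/(a *: (dfwith (fun s => 0 : X s) x : dprod X) s +
  (dfwith (fun s => 0 : X s) y : dprod X) s) SubK.
have [<-|ts] := eqVneq t s; first by rewrite !dfwith_in.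
by rewrite !dfwith_out // scaler0 addr0.
Qed.

Lemma dl_class_linear t : linear (@dl_class t).
Proof. by move=> a x y; rewrite /dl_class dsum_inj_linear linearP. Qed.

Lemma dl_class0 t : dl_class (0 : X t) = 0.
Proof. by rewrite -[LHS]/(mklin (@dl_class_linear t) 0) linear0. Qed.

(** The last coordinate of a finitely supported family is split off, and the classes of both parts
    are raised to a common level. *)
Lemma dl_class_ex (v : dirlim q) : exists t (x : X t), v = dl_class x.
Proof.
rewrite -(qpi_repr v); move: (repr v : dsum X) => d {v}.
have /mksubP[n] := valP d; elim: n d => [|n IHn] d Hd.
  exists 0%N, 0; congr (qpi _ _); apply: val_inj; apply: functional_extensionality_dep => s.
  rewrite Hd // SubK; have [<-|ts] := eqVneq 0%N s; first by rewrite dfwith_in.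
  by rewrite dfwith_out.
have [|t [x dx]] := IHn (d - dsum_inj (val d n)).
  move=> s ns; rewrite -[LHS]/(val d s - (dfwith (fun s => 0 : X s) (val d n) : dprod X) s).
  have [<-|nes] := eqVneq n s; first by rewrite dfwith_in subrr.
  by rewrite dfwith_out // Hd ?subr0 // ltn_neqAle nes.
have raise u (y : X u) k : exists z : X (k + u)%N, dl_class y = dl_class z.
  elim: k => [|k [z yz]]; first by exists y.
  by exists (q _ z); rewrite yz dl_class_step.
(* Raising t by n and n by t brings both classes to level n + t. *)
have [z xz] := raise t x n; have := raise n (val d n) t.
rewrite addnC => -[w dw]; exists (n + t)%N, (1 *: z + w).
rewrite dl_class_linear scale1r -xz -dw -dx -linearD subrK //.
Qed.

Section Relation.
Variables (W : lmodType R) (K : W -> forall t, X t -> Prop).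
Hypothesis K_step : forall w t (x : X t), K w x -> K w (q t x).

Definition dl_rel (v : dirlim q) w := exists t (x : X t), v = dl_class x /\ K w x.

(** Representatives can be taken at an arbitrarily high level, as required by facts that hold only
    for large t. *)
Lemma dl_raise v w n : dl_rel v w ->
  exists t (x : X t), [/\ (n <= t)%N, v = dl_class x & K w x].
Proof.
move=> [t [x [-> xw]]]; elim: n => [|n [u [y [nu xy yw]]]]; first by exists t, x.
exists u.+1, (q u y); split=> //; last exact: K_step.
by rewrite xy dl_class_step.
Qed.

Lemma dl_raise_to u t (x : X t) w : (t <= u)%N -> K w x ->
  exists y : X u, dl_class x = dl_class y /\ K w y.
Proof.
move=> tu xw; rewrite -(subnK tu); elim: (u - t)%N => [|k [y [xy yw]]]; first by exists x.
by exists (q _ y); rewrite xy dl_class_step; split=> //; apply: K_step.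
Qed.

Hypothesis K0 : K 0 (0 : X 0%N).
Hypothesis K_lin : forall a w w' t (x y : X t), K w x -> K w' y -> K (a *: w + w') (a *: x + y).

Lemma dl_linrel : linrel dl_rel.
Proof.
split.
  by exists 0%N, 0; rewrite dl_class0.
move=> a v v' w w' [t [x [-> xw]]] [t' [x' [-> xw']]].
have [y [-> yw]] := dl_raise_to (leq_maxl t t') xw.
have [y' [-> yw']] := dl_raise_to (leq_maxr t t') xw'.
exists (maxn t t'), (a *: y + y'); split; first by rewrite dl_class_linear.
exact: K_lin.
Qed.
End Relation.
End DirectLimitClasses.

(** * Formal local homology for a principal ideal *)

Section Principal.
Variables (R : comNzRingType) (m I : submodClosed R^o) (M : lmodType R) (i : nat) (a : R).
Hypotheses (R_noetherian : noetherian_mod R^o) (m_maximal : maximal_ideal m).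
Hypotheses (Ia : forall x, (x \in I) <-> exists r, x = r * a).
Hypothesis M_artinian : artinian_mod M.
Local Notation hmap := (local_homology_map m i).
Local Notation A := (annpow I M).
Local Notation incl := (annpow_incl I M).

Lemma mem_annpow t (x : M) : x \in annihilated M (ideal_pow I t) <-> a ^+ t *: x = 0.
Proof.
have aI : a \in I by apply/Ia; exists 1; rewrite mul1r.
split=> [/mksubP H|Hx]; first by apply: H; apply: ideal_pow_exp.
apply/mksubP; elim: t x Hx => [|t IH] x.
  by rewrite scale1r => -> b _; rewrite scaler0.
move=> Hx b; have lin : linear (fun u : R^o => (u : R) *: x).
  by move=> c u v; rewrite scalerDl -scalerA.
suff H : {subset ideal_pow I t.+1 <= lker (mklin lin)} by move/H/mksubP.
apply: smul_sub => c y /Ia[r ->] yt; apply/mksubP.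
rewrite -[LHS]/((r * a * (y : R)) *: x) mulrC -scalerA; apply: IH => //.
by rewrite scalerA mulrCA -scalerA -exprSr Hx scaler0.
Qed.

Let mu := mulmap M a.

Fact ann_mul_subproof t : (a ^+ t *: (0 : M) = 0 /\ exists y, mu y = 0) /\
  forall b (u v : M), (a ^+ t *: u = 0 /\ exists y, mu y = u) ->
  (a ^+ t *: v = 0 /\ exists y, mu y = v) ->
  a ^+ t *: (b *: u + v) = 0 /\ exists y, mu y = b *: u + v.
Proof.
split=> [|b u v [u0 [y yu]] [v0 [z zv]]].
  by rewrite scaler0; split=> //; exists 0; rewrite linear0.
split; last by exists (b *: y + z); rewrite linearP yu zv.
by rewrite -[LHS]/(mulmap M (a ^+ t) _) linearP /= u0 v0 scaler0 addr0.
Qed.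
(** The intersection of aM with the kernel of a^t: visibly the kernel of [ann_proj], and equal to a
    A_(t+1) because a^t (a y) = a^(t+1) y. *)
Definition ann_mul t : submodClosed M :=
  mksub (P := fun x => a ^+ t *: x = 0 /\ exists y, mu y = x)
    (ann_mul_subproof t).1 (ann_mul_subproof t).2.
Local Notation B t := (submod_of (ann_mul t)).
Local Notation Q := (quomod (limg mu)).
Local Notation A1 := (submod_of (lker mu)).

Lemma annpow_val t (x : A t) : a ^+ t *: val x = 0.
Proof. by apply/mem_annpow/valP. Qed.

Fact ker_incl_subproof t (x : A1) : val x \in annihilated M (ideal_pow I t.+1).
Proof.
apply/mem_annpow; have /mksubP xa := valP x.
by rewrite exprSr -scalerA [a *: _]xa scaler0.
Qed.
Definition ker_incl t : {linear A1 -> A t.+1} :=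
  corestrict (f := sub_val (lker mu)) (@ker_incl_subproof t).

Fact ann_to_mul_subproof t (x : A t.+1) : (mu \o sub_val _) x \in ann_mul t.
Proof.
apply/mksubP; split; last by exists (val x).
by rewrite -[LHS]/(a ^+ t *: (a *: val x)) scalerA -exprSr annpow_val.
Qed.
Definition ann_to_mul t : {linear A t.+1 -> B t} := corestrict (@ann_to_mul_subproof t).

Fact mul_incl_subproof t (x : B t) : sub_val (ann_mul t) x \in annihilated M (ideal_pow I t).
Proof. by have /mksubP[x0 _] := valP x; apply/mem_annpow. Qed.
Definition mul_incl t : {linear B t -> A t} := corestrict (@mul_incl_subproof t).

Fact mul_step_subproof t (x : B t) : sub_val (ann_mul t) x \in ann_mul t.+1.
Proof.
have /mksubP[x0 xm] := valP x; apply/mksubP; split=> //.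
by rewrite exprS -scalerA [a ^+ t *: _]x0 scaler0.
Qed.
Definition mul_step t : {linear B t -> B t.+1} := corestrict (@mul_step_subproof t).

Definition ann_proj t : {linear A t -> Q} := qpi (limg mu) \o sub_val _.

Lemma ker_incl_inj t : injective (ker_incl t).
Proof. by move=> x y /(congr1 val) xy; apply: val_inj. Qed.

Lemma mul_incl_inj t : injective (mul_incl t).
Proof. by move=> x y /(congr1 val) xy; apply: val_inj. Qed.

Lemma ann_to_mul_surj t (y : B t) : exists x, ann_to_mul t x = y.
Proof.
have /mksubP[y0 [z zy]] := valP y.
have za : z \in annihilated M (ideal_pow I t.+1).
  by apply/mem_annpow; rewrite exprSr -scalerA [a *: z]zy.
by exists (Sub z za); apply: val_inj; apply: zy.
Qed.

Lemma ann_to_mul_ker_incl t x : ann_to_mul t (ker_incl t x) = 0.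
Proof. by apply: val_inj; have /mksubP := valP x. Qed.

Lemma ann_to_mul_ker t y : ann_to_mul t y = 0 -> exists x, ker_incl t x = y.
Proof.
move/(congr1 val) => y0; have yk : val y \in lker mu by apply/mksubP.
by exists (Sub (val y) yk); apply: val_inj.
Qed.

Lemma ann_proj_ker t y : ann_proj t y = 0 -> exists x, mul_incl t x = y.
Proof.
move/eqP; rewrite [X in is_true X]qpi_eq0 => /mksubP[z zy].
have yb : val y \in ann_mul t.
  by apply/mksubP; split; [apply: annpow_val | exists z].
by exists (Sub (val y) yb); apply: val_inj.
Qed.

(* The chain a^t M is stationary, hence M = (0 :_M a^t) + a M for large t. *)
Lemma ann_proj_surj : exists n, forall t, (n <= t)%N -> forall y, exists x, ann_proj t x = y.
Proof.
have dec n : {subset limg (mulmap M (a ^+ n.+1)) <= limg (mulmap M (a ^+ n))}.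
  move=> x /mksubP[y <-]; apply/mksubP; exists (a *: y).
  by rewrite -[LHS]/(a ^+ n *: (a *: y)) scalerA -exprSr.
have [//|n Hn] := (artinian_modE _).1 M_artinian _ dec.
exists n => t nt y; rewrite -(qpi_repr y); move: (repr y) => x {y}.
have : a ^+ t *: x \in limg (mulmap M (a ^+ t)) by apply/mksubP; exists x.
move/(decr_chain dec nt)/(Hn _ (leqW nt)) => /mksubP[z zx].
have xa : x - a *: z \in annihilated M (ideal_pow I t).
  apply/mem_annpow; rewrite scalerBr -zx -[X in X - _]/(a ^+ t.+1 *: z).
  by rewrite scalerA -exprSr subrr.
exists (Sub (x - a *: z) xa); apply/eqP; rewrite [X in is_true X]qpi_eq.
rewrite -[X in X \in _]/(x - a *: z - x) addrAC subrr add0r.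
by apply: submodN; apply/mksubP; exists z.
Qed.

Lemma A_artinian t : artinian_mod (A t).
Proof. exact: artinian_sub. Qed.

Let K1 (w : local_homology m i Q) t (x : local_homology m i (A t)) := w = hmap (ann_proj t) x.
(** The connecting homomorphism of A_1 -> A_(t+1) -> B_t, taken on any preimage under H_i(B_t) ->
    H_i(A_t). *)
Let K2 (w : prev_homology m i A1) t (x : local_homology m i (A t)) :=
  exists2 z, x = hmap (mul_incl t) z & prev_conn (ker_incl t) (ann_to_mul t) z w.

Lemma K1_step w t x : K1 w x -> K1 w (hmap (incl t) x).
Proof. by move=> ->; apply: lh_map_comp. Qed.

(** The sequences for t and t+1 have the same kernel A_1, on which the inclusions induce the
    identity; hence [w] does not move. *)
Lemma K2_step w t x : K2 w x -> K2 w (hmap (incl t) x).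
Proof.
move=> [z -> zw]; exists (hmap (mul_step t) z).
  rewrite -(lh_map_comp (h := incl t \o mul_incl t)) //.
  by apply: lh_map_comp => y; apply: val_inj.
apply: (prev_conn_nat (b := incl t.+1)) zw => x0; exact: val_inj.
Qed.

Lemma formal_noetherian : noeth_between
  (fun v => v \in ideal_smul (ideal_image m I) (fullmod (formal_local_homology m I M i)))
  (fun=> True).
Proof.
have aI : a \in I by apply/Ia; exists 1; rewrite mul1r.
have lin1 : linrel (dl_rel (q := fun t => hmap (incl t)) K1).
  apply: dl_linrel => [w t x||c w w' t x y -> ->].
  - exact: K1_step.
  - by rewrite /K1 linear0.
  - by rewrite /K1 linearP.
have lin2 : linrel (dl_rel (q := fun t => hmap (incl t)) K2).
  apply: dl_linrel => [w t x||c w w' t x y [z -> zw] [z' -> zw']].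
  - exact: K2_step.
  - exists 0; first by rewrite linear0.
    have [w zw] := prev_conn_total (@ker_incl_inj 0) (@ann_to_mul_surj 0) (@ann_to_mul_ker 0)
      (0 : local_homology m i (B 0)).
    by have := prev_conn_lin (-1) zw zw; rewrite !scaleN1r !addNr.
  - by exists (c *: z + z'); [rewrite linearP | apply: prev_conn_lin].
apply: (@noeth_rel _ _ _ _ _ _ _ _ (fun=> True) (fun=> True) lin1 lin2) => //.
- by move=> v _; have [t [x ->]] := dl_class_ex v; exists (hmap (ann_proj t) x), t, x.
- move=> v _ vw; have [n Hn] := ann_proj_surj.
  (* The representative must live at a level t >= n, where A_t maps onto M/aM and the sequence is
     exact. *)
  have [t [x [nt -> /esym x0]]] := dl_raise K1_step n vw.
  have [z zx] := lh_exact_mid R_noetherian (@mul_incl_inj t) (Hn t nt) (@ann_proj_ker t)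
    (artinian_sub (S := ann_mul t) M_artinian) x0.
  have [w zw] := prev_conn_total (@ker_incl_inj t) (@ann_to_mul_surj t) (@ann_to_mul_ker t) z.
  by exists w, t, x; split=> //; exists z.
- move=> v _ [t [_ [-> [z -> z0]]]].
  have [y <-] := prev_conn_exact R_noetherian (@ann_to_mul_surj t) (@ann_to_mul_ker_incl t) (@A_artinian t.+1) z0.
  (* [y] lives at level t+1, so the class is moved there too; the composite A_(t+1) -> B_t -> A_t ->
     A_(t+1) is multiplication by a. *)
  rewrite dl_class_step.
  have -> : hmap (incl t) (hmap (mul_incl t) (hmap (ann_to_mul t) y)) = completion_in m a *: y.
    rewrite -(lh_map_comp (h := incl t \o mul_incl t)) //.
    rewrite -(lh_map_comp (h := incl t \o mul_incl t \o ann_to_mul t)) //.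
    by apply: lh_map_scale => x; apply: val_inj.
  rewrite -[completion_in m a *: y]addr0 dl_class_linear.
  apply: rpredD; last first.
    by rewrite dl_class0 rpred0.
  by apply: smul_mem; [exists a | apply/mksubP].
- apply/noetherian_modE/lh_noetherian => //; exact: artinian_quo.
- apply/noetherian_modE/prev_noetherian => //; exact: artinian_sub.
Qed.
End Principal.

Theorem theorem3p4 (R : comNzRingType) (m I : submodClosed R^o)
    (M : lmodType R) (i : nat)
    (R_noetherian : noetherian_mod R^o) (R_local : is_local_ring m)
    (I_principal : principal_ideal I) (M_artinian : artinian_mod M) :
  noetherian_mod
    (quomod (ideal_smul (ideal_image m I)
      (fullmod (formal_local_homology m I M i)))).
Proof.
have [a Ia] := I_principal; apply: noetherian_quo.
exact: formal_noetherian R_noetherian R_local.1 Ia M_artinian.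
Qed.
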